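(* Let $C$ be a planar convex body and, for $\theta\in\mathbb{R}$, let $\Theta=(\cos\theta,\sin\theta)$. Assume the existence of constants $\delta_{0},c_{1},c_{2}>0$, $1/2\leqslant\sigma\leqslant1$ and an interval $I$ of positive length in $(-\pi,\pi)$ such that for every $0<\delta\leqslant\delta_{0}$ we have $$\left\vert \gamma_{-\Theta}(\delta)\right\vert +\left\vert \gamma_{\Theta}(\delta)\right\vert \geqslant c_{1}\delta^{1/2}\quad\text{for every }\theta\in I,$$ $$\left\vert \gamma_{-\Theta}(\delta)\right\vert +\left\vert \gamma_{\Theta}(\delta)\right\vert \geqslant c_{2}\delta^{\sigma}\quad\text{for every }\theta\in(-\pi,\pi)\setminus I.$$ Then there exists $c>0$ such that for every integer $N\geqslant1$ and every set $\mathcal{P}_{N}$ of $N$ points in $\mathbb{T}^{2}$ we have $$\int_{0}^{1}\int_{\mathbb{T}^{2}}\left\vert \mathrm{card}\left(\mathcal{P}_{N}\cap\left(\lambda C+t\right)\right)-\lambda^{2}N\left\vert C\right\vert \right\vert ^{2}\,dt\,d\lambda\geqslant cN^{2/(2\sigma+3)}.$$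
   Context: $\mathbb{T}^{2}=\mathbb{R}^{2}/\mathbb{Z}^{2}$. A planar convex body is a bounded convex subset of $\mathbb{R}^2$ with non-empty interior, and $|C|$ is its area. For $\mathcal{P}_N=\{u_1,\dots,u_N\}\subset\mathbb{T}^2$, $\lambda>0$ and $t\in\mathbb{T}^2$, $\mathrm{card}(\mathcal{P}_N\cap(\lambda C+t))$ denotes $\sum_{j=1}^N\sum_{k\in\mathbb{Z}^2}\chi_{\lambda C}(u_j-t+k)$, where $\chi_{\lambda C}$ is the characteristic function of $\lambda C\subset\mathbb{R}^2$; this is the ordinary number of points of $\mathcal{P}_N$ in the translated set $\lambda C+t$ whenever $\lambda C$ projects injectively to $\mathbb{T}^2$. For a unit vector $\Theta$ and $\delta>0$, $\gamma_\Theta(\delta)$ is the chord $$\gamma_{\Theta}(\delta)=\left\{x\in C: x\cdot\Theta=\inf_{y\in C}(y\cdot\Theta)+\delta\right\}$$ and $|\gamma_\Theta(\delta)|$ is its length. *)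

(* Defs.v *)
From HB Require Import structures.
From mathcomp Require Export all_boot all_order all_algebra.
From mathcomp Require Export generic_quotient finmap.
From mathcomp Require Export all_classical all_reals all_analysis.
Export numFieldNormedType.Exports.
Import Order.TTheory GRing.Theory Num.Theory.

Set Implicit Arguments.
Unset Strict Implicit.
Unset Printing Implicit Defensive.

Local Open Scope classical_set_scope.
Local Open Scope ring_scope.
Local Open Scope quotient_scope.

Section Plane.
Context {R : realType}.
Implicit Types (C A : set (R * R)) (x y Theta : R * R).

Definition planar_convex_body C : Prop :=
  [/\ convex_set C, bounded_set C & C° !=set0].

(* The product measure is defined through vertical sections.  Those of a convex
   body are intervals whose length is a measurable function of the abscissa, so
   this is the area also when C is Lebesgue measurable but not Borel. *)
Definition area C : R := fine ((lebesgue_measure \x lebesgue_measure)%E C).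

Definition dilate (l : R) C : set (R * R) := [set l *: x | x in C].

Definition dot x y : R := x.1 * y.1 + x.2 * y.2.

Definition direction (theta : R) : R * R := (cos theta, sin theta).

Definition chord C Theta (delta : R) : set (R * R) :=
  [set x | C x /\ dot x Theta = inf [set dot y Theta | y in C] + delta].

(* The chord lies on a line orthogonal to Theta; for a unit vector Theta the
   coordinate x |-> x . Theta^perp is an isometry from this line onto R, through
   which length on the line is one-dimensional Lebesgue measure. *)
Definition chord_length C Theta (delta : R) : \bar R :=
  lebesgue_measure [set dot x (- Theta.2, Theta.1) | x in chord C Theta delta].

Definition lattice_point (k : int * int) : R * R := (k.1%:~R, k.2%:~R).

Definition lattice_cong : rel (R * R) :=
  fun x y => ((x - y).1 \is a Num.int) && ((x - y).2 \is a Num.int).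

Lemma lattice_congP x y :
  reflect (exists k, x = y + lattice_point k) (lattice_cong x y).
Proof.
apply: (iffP andP) => [[/intrP[a ha] /intrP[b hb]]|[k ->]].
  by exists (a, b); rewrite /lattice_point /= -ha -hb addrC subrK.
by rewrite [y + _]addrC addrK /= !intr_int.
Qed.

Lemma lattice_cong_refl : reflexive lattice_cong.
Proof. by move=> x; rewrite /lattice_cong subrr rpred0. Qed.

Lemma lattice_cong_sym : symmetric lattice_cong.
Proof. by move=> x y; rewrite /lattice_cong -opprB /= !rpredN. Qed.

Lemma lattice_cong_trans : transitive lattice_cong.
Proof.
move=> y x z /andP[xy1 xy2] /andP[yz1 yz2].
rewrite /lattice_cong -(subrK y x) -addrA.
by apply/andP; split; apply: rpredD.
Qed.

Canonical lattice_cong_equiv :=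
  EquivRel lattice_cong lattice_cong_refl lattice_cong_sym lattice_cong_trans.

(* \sum_(k in Z^2) chi_A (x + k); the support is finite when A is bounded. *)
Definition periodization A x : R :=
  \sum_(k \in [set: int * int]) (\1_A (x + lattice_point k) : R).

Lemma periodization_cong A x y :
  lattice_cong x y -> periodization A x = periodization A y.
Proof.
move=> /lattice_congP[m ->]; rewrite /periodization.
have mB : bijective (fun k : int * int => m + k).
  by exists (fun k => - m + k) => k; rewrite ?addKr ?addNKr.
symmetry; rewrite (reindex_fsbigT _ _ mB); apply: eq_fsbigr => k _.
congr (\1_A _); rewrite -addrA; congr (_ + _).
by congr pair; rewrite /= rmorphD.
Qed.

End Plane.

Definition torus (R : realType) : Type := {eq_quot (@lattice_cong R)}.
HB.instance Definition _ (R : realType) := Choice.on (torus R).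
HB.instance Definition _ (R : realType) := EqQuotient.on (torus R).

Section Torus.
Context {R : realType}.
Implicit Types (A : set (R * R)) (P : {fset torus R}) (t : torus R).

(* Integration against the Haar measure on the torus, read on the fundamental
   domain [0, 1)^2.  The integral of a nonnegative function is a supremum over
   Borel simple functions below it, hence has the right value for a function
   which is only Lebesgue measurable. *)
Definition torus_integral (f : torus R -> \bar R) : \bar R :=
  (\int[lebesgue_measure \x lebesgue_measure]_(x in `[0%R, 1%R[ `*` `[0%R, 1%R[)
     f (\pi_(torus R) x))%E.

(* card (P \cap (A + t)), counted with the multiplicities arising when A does
   not project injectively to the torus. *)
Definition card_translate P A t : R :=
  \sum_(u <- P) periodization A (repr u - repr t).

Lemma card_translate_pi P A (x : R * R) :
  card_translate P A (\pi_(torus R) x) = \sum_(u <- P) periodization A (repr u - x).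
Proof.
apply: eq_bigr => u _; apply: periodization_cong.
have /andP[h1 h2] : lattice_cong x (repr (\pi_(torus R) x)).
  by apply/(@eqquotP _ _ (torus R)); rewrite reprK.
by rewrite /lattice_cong opprB addrC addrA subrK h1 h2.
Qed.

End Torus.

(* Main.v *)
From HB Require Import structures.
Require Import Defs.
From mathcomp Require Import all_boot all_order all_algebra finmap.
From mathcomp Require Import all_classical all_reals all_analysis.
From mathcomp Require Import measurable_realfun ring lra zify.
Import Order.TTheory GRing.Theory Num.Theory.
Set Implicit Arguments.
Unset Strict Implicit.
Unset Printing Implicit Defensive.
Local Open Scope classical_set_scope.
Local Open Scope ring_scope.

(** Put B = closure of C and, for a lattice vector m, S(m) = sum_u e(m . u) over
    the points u. Three estimates carry the proof.

    Bessel. For a fixed dilation factor l, the function of t which counts the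
    points in l C + t has the Fourier coefficient S(m) times the transform of
    l B at m, so for every finite set F of non-zero frequencies the square of the
    discrepancy has an integral over the torus of at least
    sum_(m in F) |S(m)|^2 l^4 |B^(l m)|^2 (discrepancy_fourier). The counts for
    the interior and for the closure of C enclose the one for C and have the same
    integral, because the boundary of a convex body is null
    (body_boundary_null); this is how an arbitrary convex C is reduced to Borel
    sets.

    Decay on average. The mean over l in [0, 1] of l^4 |B^(l m)|^2 is bounded
    below by testing B^(l m) against sin^3(pi l) e^(i l psi). Integrating first
    in l turns the test into the integral over B of the explicit function
    kernel(2 (m . y - a) + 7/2) where a = min_B m . y is obtained by the choice
    of psi. This kernel is nonnegative on B and at least 1/200 on the strip
    a <= m . y <= a + 1/2, so the test is at least a constant times the area of
    a strip of width 1/(2 |m|) at one end of the body, and the area of that strip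
    is the integral of the chord lengths. Averaging over the two ends, the
    hypothesis on the chords gives |m|^(-2-2 sigma) for all m far from 0, and
    |m|^(-3) if m points to a direction of I or opposite to one
    (spectral_weight, mean_spectrum_ge).

    Exponential sums. Summing |S(x - y)|^2 over the pairs of a finite set X of
    frequencies gives at least N |X|^2 (sum_power_ge). This is applied to J
    boxes with |X| = W^2 J elements each, of length W J and slopes i/J. If k is a
    non-zero difference, the number of times that it occurs is at most a
    constant times J |X| W^(2 + 2 sigma) times the lower bound for the transform at k: a
    difference with |k.1| < 2 W has both coordinates of size O(W), and one with
    |k.1| >= 2 W lies in the cone |k.2| <= 2 |k.1|, where it occurs
    O(J |X| W / |k.1|) times and where an integer similarity and a stretch move
    the frequencies into the directions of I (stretch_in_cone). For
    J ~ W^(sigma - 1/2) and W ~ N^(2 / (2 sigma + 3)) one has |X| >= 2 N, and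
    dividing J N |X|^2 by J |X| W^(2 + 2 sigma) leaves N^2 / W^(2 + 2 sigma),
    which is N^(2 / (2 sigma + 3)) (lattice_sum_lower_bound). *)

(** * Exponential sums over differences of frequencies *)

Section ExponentialSums.
Context {R : realType}.
Implicit Types (us : seq (R * R)) (k m : int * int).

Definition phase m (x : R * R) : R := 2 * pi * dot (lattice_point m) x.

Definition power us m : R :=
  (\sum_(u <- us) cos (phase m u)) ^+ 2 + (\sum_(u <- us) sin (phase m u)) ^+ 2.

Lemma phaseB k m x : phase (k - m) x = phase k x - phase m x.
Proof. by rewrite /phase /dot /= !rmorphB /=; ring. Qed.

Lemma power_ge0 us m : 0 <= power us m.
Proof. by rewrite addr_ge0 // sqr_ge0. Qed.

Lemma power0 us : power us 0 = (size us)%:R ^+ 2.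
Proof.
rewrite /power; under eq_bigr do rewrite /phase /dot /= !mul0r addr0 mulr0 cos0.
under [X in _ + X ^+ 2]eq_bigr do rewrite /phase /dot /= !mul0r addr0 mulr0 sin0.
by rewrite !big_const_seq !iter_addr_0 count_predT mul0rn expr0n addr0.
Qed.

Lemma sum_cosB (I : Type) (s : seq I) (f : I -> R) :
  \sum_(i <- s) \sum_(j <- s) cos (f i - f j) =
  (\sum_(i <- s) cos (f i)) ^+ 2 + (\sum_(i <- s) sin (f i)) ^+ 2.
Proof.
rewrite !expr2 !mulr_suml -big_split; apply: eq_bigr => i _ /=.
by rewrite !mulr_sumr -big_split; apply: eq_bigr => j _ /=; rewrite cosB.
Qed.

(** Expanding the squares and summing over the pairs (x, y) first, a pair (u, v)
    of points contributes |sum_x e(k x . (u - v))|^2, which is nonnegative and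
    equal to #|X|^2 when u = v. *)
Lemma sum_power_ge (X : finType) (k : X -> int * int) us :
  (size us)%:R * #|X|%:R ^+ 2 <= \sum_x \sum_y power us (k x - k y).
Proof.
under eq_bigr => x _ do under eq_bigr => y _ do rewrite /power -sum_cosB.
rewrite (_ : \sum_x _ = \sum_(u <- us) \sum_(v <- us)
    \sum_x \sum_y cos ((phase (k x) u - phase (k x) v) - (phase (k y) u - phase (k y) v))).
  have -> : (size us)%:R * #|X|%:R ^+ 2 = \sum_(u <- us) (#|X|%:R ^+ 2 : R).
    by rewrite big_const_seq iter_addr_0 count_predT mulr_natl.
  rewrite big_seq [leRHS]big_seq; apply: ler_sum => u uus.
  rewrite (big_rem u) //= sum_cosB.
  have -> : \sum_x cos (phase (k x) u - phase (k x) u) = #|X|%:R.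
    by under eq_bigr do rewrite subrr cos0; rewrite sumr_const.
  have -> : \sum_x sin (phase (k x) u - phase (k x) u) = 0.
    by under eq_bigr do rewrite subrr sin0; rewrite big1.
  rewrite expr0n addr0 lerDl.
  by apply: sumr_ge0 => v _; rewrite sum_cosB addr_ge0 // sqr_ge0.
transitivity (\sum_x \sum_(u <- us) \sum_(v <- us) \sum_y
   cos (phase (k x) u - phase (k x) v - (phase (k y) u - phase (k y) v))).
  apply: eq_bigr => x _; rewrite exchange_big; apply: eq_bigr => u _ /=.
  rewrite exchange_big; apply: eq_bigr => v _ /=; apply: eq_bigr => y _.
  by rewrite !phaseB; congr cos; ring.
by rewrite exchange_big; apply: eq_bigr => u _; rewrite exchange_big.
Qed.

End ExponentialSums.

Section Count.
Variables (J W : nat).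
Hypotheses (J0 : (0 < J)%N) (JW : (J <= W)%N).
Local Notation X := ('I_W * 'I_W * 'I_J)%type.
Local Open Scope int_scope.

(** The points close to a segment of slope i / J: the first coordinate runs
    through an interval of length W J, written in base J, and the second one
    follows the segment within W. Segments of different slopes make the
    differences spread over a cone, so that a difference far from the vertical
    axis occurs for few of the indices i. *)
Definition lattice_box (i : nat) (x : X) : int * int :=
  (x.1.1%:Z * J%:Z + x.2%:Z, x.1.1%:Z * i%:Z + x.1.2%:Z).

Lemma lattice_box_inj i : injective (lattice_box i).
Proof.
move=> [[a b] c] [[a' b'] c'] [] /= h1 h2.
have hc : c = c' :> nat.
  have := congr1 (fun n : nat => n %% J)%N (_ : a * J + c = a' * J + c')%N.
  by rewrite !modnMDl !modn_small //; apply; lia.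
have ha : a = a' :> nat.
  have : (a * J = a' * J)%N by lia.
  by move/eqP; rewrite eqn_pmul2r // => /eqP.
have hb : b = b' :> nat by move: h2; rewrite ha; lia.
by congr (_, _, _); exact: val_inj.
Qed.

Definition box_diff (z : 'I_J * X * X) : int * int :=
  lattice_box z.1.1 z.1.2 - lattice_box z.1.1 z.2.

Definition box_mult (k : int * int) : nat := #|[pred z | box_diff z == k]|.

Lemma card_fibers_le (A B : finType) (S : {set A}) (P : pred (A * B)) :
  (forall x y y', P (x, y) -> P (x, y') -> y = y') ->
  (forall x y, P (x, y) -> x \in S) ->
  (#|P| <= #|S|)%N.
Proof.
move=> uP PS; rewrite -(card_in_imset (f := fst) (D := P)).
  by apply/subset_leq_card/fintype.subsetP => _ /imsetP[[x y] Pxy ->]; exact: PS Pxy.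
by move=> [x y] [x' y'] /= Pxy + /= xx; rewrite -xx => Pxy'; congr pair; exact: uP Pxy'.
Qed.

(** Once the slope and the first point are chosen, at most one second point is
    left. *)
Lemma box_mult_le k (S : {set 'I_J}) :
  (forall i x y, box_diff (i, x, y) = k -> i \in S) ->
  (box_mult k <= #|S| * (W * W * J))%N.
Proof.
move=> hS; rewrite /box_mult.
have -> : (#|S| * (W * W * J) = #|finset.setX S [set: X]%SET|)%N.
  by rewrite cardsX cardsT !card_prod !card_ord.
apply: card_fibers_le => [[i x] y y' /eqP h /eqP h'|[i x] y /eqP h].
  apply: (@lattice_box_inj i); apply: (@addrI _ (- lattice_box i x)).
  apply: oppr_inj; rewrite !opprD opprK; move: h h'; rewrite /box_diff /= => -> ->; done.
by rewrite !inE andbT; exact: hS h.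
Qed.

(** The progression b - a i moves by steps of |a|, so it stays in an interval of
    length 2 W for at most 2 W / |a| + 1 consecutive indices. *)
Lemma card_short_progression (a b : int) (S : {set 'I_J}) : a != 0 ->
  (forall i : 'I_J, i \in S -> `|b - a * i%:Z| < W%:Z) ->
  (#|S| * `|a|%N <= 2 * W + `|a|%N)%N.
Proof.
move=> a0 hS; have [->|[i0 i0S]] := set_0Vmem S; first by rewrite cards0.
have [i iS imin] := arg_minnP (fun i : 'I_J => val i) i0S.
pose d := ((2 * W) %/ `|a|)%N.
have ha : (0 < `|a|)%N by rewrite absz_gt0.
have hd (j : 'I_J) : j \in S -> (j - i < d.+1)%N.
  move=> jS; rewrite ltnS leq_divRL //.
  have ij := imin _ jS; have hj := hS _ jS; have hi := hS _ iS.
  have h : `|a * (j%:Z - i%:Z)| < (2 * W)%:Z by rewrite mulrBr; lia.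
  rewrite -lez_nat PoszM -subzn // abszE mulrC.
  by rewrite -[X in _ * X]ger0_norm ?subr_ge0 // -normrM ltW.
have : (#|S| <= d.+1)%N.
  rewrite -[d.+1]card_ord -(card_in_imset (f := fun j : 'I_J => inord (j - i) : 'I_d.+1) (D := S)).
    exact: max_card.
  move=> j j' jS j'S /(congr1 val) /=; rewrite !inordK ?hd // => h.
  apply: val_inj => /=; have ij : (i <= j)%N := imin _ jS.
  by have ij' : (i <= j')%N := imin _ j'S; rewrite -(subnK ij) h subnK.
move=> h; apply: (leq_trans (leq_mul h (leqnn _))).
by rewrite mulSn addnC leq_add2r leq_divM.
Qed.

Lemma box_diffE i x y : box_diff (i, x, y) =
  ((x.1.1%:Z - y.1.1%:Z) * J%:Z + (x.2%:Z - y.2%:Z),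
   (x.1.1%:Z - y.1.1%:Z) * i%:Z + (x.1.2%:Z - y.1.2%:Z)).
Proof. by rewrite /box_diff /lattice_box /=; congr pair; rewrite /=; ring. Qed.

Lemma box_mult_le_all k : (box_mult k <= J * (W * W * J))%N.
Proof.
by rewrite -[X in (X * _)%N](card_ord J) -cardsT; apply: box_mult_le => i *; rewrite inE.
Qed.

(** The first coordinate of the difference is a J + c with |c| < J, so a is one of
    the two integers next to k.1 / J. The second coordinate then requires
    |k.2 - a i| < W, which leaves O(W / |a|) = O(W J / |k.1|) slopes. *)
Lemma box_mult_far (k : int * int) : (2 * W)%:Z <= `|k.1| ->
  (box_mult k * `|k.1|%N <= 12 * (W * W * J) * (J * W))%N.
Proof.
move=> kW.
pose Sa (a : int) : {set 'I_J} := [set i : 'I_J | (a != 0) && (`|k.2 - a * i%:Z| < W%:Z)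
   && (`|k.1|%N < 2 * `|a|%N * J)%N && (`|a| < W)%N ]%SET.
pose q := (k.1 %/ J%:Z)%Z.
have cardSa a : (#|Sa a| * `|k.1|%N <= 6 * (J * W))%N.
  have [->|[i iS]] := set_0Vmem (Sa a); first by rewrite cards0.
  move: (iS); rewrite inE => /andP[/andP[/andP[a0 _] ka] aW].
  have /(_ _) h := @card_short_progression a k.2 (Sa a) a0.
  have {h} h : (#|Sa a| * `|a|%N <= 2 * W + `|a|%N)%N.
    by apply: h => j; rewrite inE => /andP[/andP[/andP[]]].
  nia.
have hS : forall i x y, box_diff (i, x, y) = k -> i \in (Sa q :|: Sa (q + 1)%R)%SET.
  move=> i [[a b] c] [[a' b'] c'] /=; rewrite box_diffE /=.
  move=> kE.
  have hq : k.1 = q * J%:Z + (k.1 %% J%:Z)%Z by exact: divz_eq.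
  have r0 : 0 <= (k.1 %% J%:Z)%Z by apply: modz_ge0; lia.
  have rJ : (k.1 %% J%:Z)%Z < J%:Z by apply: ltz_pmod; lia.
  have := ltn_ord a; have := ltn_ord b; have := ltn_ord c.
  have := ltn_ord a'; have := ltn_ord b'; have := ltn_ord c'.
  move=> h1 h2 h3 h4 h5 h6.
  have k1 : k.1 = (a%:Z - a'%:Z) * J%:Z + (c%:Z - c'%:Z) by rewrite -kE.
  have k2 : k.2 = (a%:Z - a'%:Z) * i%:Z + (b%:Z - b'%:Z) by rewrite -kE.
  have aq : a%:Z - a'%:Z = q \/ a%:Z - a'%:Z = q + 1 by nia.
  have fin : i \in Sa (a%:Z - a'%:Z).
    rewrite inE -!andbA; apply/and4P; split.
    - by apply/eqP => h; move: k1; rewrite h mul0r add0r; lia.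
    - by rewrite k2 addrC addKr; lia.
    - nia.
    - lia.
  by case: aq => <-; rewrite inE fin ?orbT.
have hU : (#|(Sa q :|: Sa (q + 1)%R)%SET| * `|k.1|%N <= 12 * (J * W))%N.
  have /leq_mul/(_ (leqnn `|k.1|%N)) :
    (#|(Sa q :|: Sa (q + 1)%R)%SET| <= #|Sa q| + #|Sa (q + 1)%R|)%N.
    by rewrite cardsU leq_subr.
  by have := cardSa q; have := cardSa (q + 1)%R; lia.
apply: leq_trans (leq_mul (box_mult_le hS) (leqnn _)) _.
rewrite mulnAC; apply: leq_trans (leq_mul hU (leqnn _)) _.
by rewrite mulnAC.
Qed.

(** The slopes are less than 1, and being within W of a segment no longer matters
    once |k.1| >= 2 W. *)
Lemma box_mult_cone (k : int * int) : (0 < box_mult k)%N ->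
  [/\ (`|k.1| < (W * J)%:Z)%R, (2 * W)%:Z <= `|k.1| -> (`|k.2| <= 2 * `|k.1|)%R
    & `|k.1| < (2 * W)%:Z -> (`|k.2| <= (4 * W)%:Z)%R].
Proof.
rewrite /box_mult => /card_gt0P[[[i [[a b] c]] [[a' b'] c']]]; rewrite inE => /eqP.
rewrite box_diffE /= => <- /=.
have := ltn_ord a; have := ltn_ord b; have := ltn_ord c; have := ltn_ord i.
have := ltn_ord a'; have := ltn_ord b'; have := ltn_ord c'.
move=> h1 h2 h3 h4 h5 h6 h7.
have : `|(a%:Z - a'%:Z) * i%:Z| <= `|(a%:Z - a'%:Z) * J%:Z|.
  by rewrite !normrM ler_wpM2l // !ger0_norm //; lia.
move=> h8; split; nia.
Qed.

End Count.

(** * A weighted sum of squared exponential sums *)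

Section WeightedSum.
Context {R : realType}.

Definition diff_support (J W : nat) : seq (int * int) :=
  [seq k <- undup [seq box_diff z | z : 'I_J * ('I_W * 'I_W * 'I_J) * ('I_W * 'I_W * 'I_J)] | k != 0].

Lemma big_pred1_uniq (I : eqType) (s : seq I) (i : I) (F : I -> R) :
  i \in s -> uniq s -> \sum_(j <- s | j == i) F j = F i.
Proof.
move=> si us; rewrite -big_filter (_ : [seq j <- s | j == i] = [:: i]) ?big_seq1 //.
exact: filter_pred1_uniq.
Qed.

Lemma sum_box_diff (J W : nat) (P : int * int -> R) :
  \sum_z P (@box_diff J W z) =
  \sum_(k <- diff_support J W) (box_mult J W k)%:R * P k + (box_mult J W 0)%:R * P 0.
Proof.
set s := undup [seq @box_diff J W z | z : 'I_J * ('I_W * 'I_W * 'I_J) * ('I_W * 'I_W * 'I_J)].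
have zs z : @box_diff J W z \in s by rewrite mem_undup map_f // mem_enum.
have -> : \sum_z P (@box_diff J W z) = \sum_(k <- s) (box_mult J W k)%:R * P k.
  transitivity (\sum_z \sum_(k <- s | k == @box_diff J W z) P k).
    by apply: eq_bigr => z _; rewrite (big_pred1_uniq _ (zs z)) // undup_uniq.
  rewrite (exchange_big_dep predT) //=; apply: eq_bigr => k _.
  rewrite mulr_natl -sumr_const; apply: eq_bigl => z.
  by rewrite /box_mult inE eq_sym.
rewrite (bigID (fun k => k != 0)) /= big_filter; congr (_ + _).
under eq_bigl do rewrite negbK.
have [s0|s0] := boolP (0 \in s).
  by rewrite (big_pred1_uniq _ s0) // undup_uniq.
rewrite (_ : box_mult J W 0 = 0%N) ?mul0r.
  by rewrite big_seq_cond big1 // => k /andP[ks /eqP k0]; rewrite k0 (negbTE s0) in ks.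
by apply: eq_card0 => z; rewrite inE; apply: contraNF s0 => /eqP <-.
Qed.

(** The averaging over pairs is applied to each of the J boxes; the zero
    difference, at which the squared exponential sum is (size us)^2, is then
    removed. The additive map m places the boxes among the actual
    frequencies. *)
Lemma weighted_power_ge (J W : nat) (us : seq (R * R)) (m : int * int -> int * int) :
  (0 < J)%N -> (J <= W)%N -> (forall k l, m (k - l) = m k - m l) ->
  J%:R * ((size us)%:R * (W * W * J)%:R ^+ 2 - (W * W * J)%:R * (size us)%:R ^+ 2) <=
  \sum_(k <- diff_support J W) (box_mult J W k)%:R * power us (m k).
Proof.
move=> J0 JW mB; have m0 : m 0 = 0 by rewrite -[X in m X](subrr 0) mB subrr.
rewrite mulrBr lerBlDr.
apply: (@le_trans _ _ (\sum_z power us (m (@box_diff J W z)))).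
  have -> : \sum_z power us (m (@box_diff J W z)) =
      \sum_i \sum_x \sum_y power us (m (@box_diff J W (i, x, y))).
    by rewrite !pair_big /=; apply: eq_bigr => [[[i x] y]].
  set A := (X in _ * X <= _); have -> : J%:R * A = \sum_(i < J) A by rewrite big_const_ord iter_addr_0 mulr_natl.
  apply: ler_sum => i _.
  have := sum_power_ge (fun x : 'I_W * 'I_W * 'I_J => m (lattice_box i x)) us.
  rewrite !card_prod !card_ord => /le_trans; apply.
  by rewrite le_eqVlt; apply/orP; left; apply/eqP; do 2 (apply: eq_bigr => ? _); rewrite -mB.
rewrite (@sum_box_diff J W (fun k => power us (m k))) lerD2l m0 power0 [leRHS]mulrA.
by rewrite ler_wpM2r ?sqr_ge0 // -?natrM ?ler_nat; exact: box_mult_le_all.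
Qed.

Lemma powR_split (sigma x : R) : 1 <= x ->
  x `^ (2 + 2 * sigma) = x ^+ 3 * (x `^ (sigma - 1 / 2)) ^+ 2.
Proof.
move=> x1; have x0 : x != 0 by apply/eqP; lra.
rewrite (_ : 2 + 2 * sigma = 3%:R + (sigma - 1 / 2) * 2%:R); last by field.
rewrite [LHS]powRD ?x0 ?implybT // powR_mulrn; last lra.
by rewrite powRrM powR_mulrn ?powR_ge0.
Qed.

Lemma powR_le_exp4 (sigma : R) : sigma <= 1 ->
  forall x : R, 1 <= x -> x `^ (2 + 2 * sigma) <= x ^+ 4.
Proof. by move=> s1 x x1; rewrite -powR_mulrn ?ler_powR //; lra. Qed.

(** If |k.1| < 2 W, the trivial bound for the multiplicity is compared with the
    weight of a vector of size O(W). Otherwise k lies in the cone, and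
    multiplicity times |k.1|^3 is O(J |X| W |k.1|^2) = O(J |X| W^3 J^2). The
    condition J <= W^(sigma - 1/2) makes this O(J |X| W^(2 + 2 sigma)) too. *)
Lemma box_mult_le_weight (sigma c : R) (w : int * int -> R) (J W : nat) (k : int * int) :
  0 < c -> 1 / 2 <= sigma <= 1 ->
  (forall (k : int * int) (B : R), k != 0 -> `|k.1|%:~R <= B -> `|k.2|%:~R <= B ->
     c <= w k * B `^ (2 + 2 * sigma)) ->
  (forall k : int * int, k != 0 -> `|k.2| <= 2 * `|k.1| -> c <= w k * `|k.1|%:~R ^+ 3) ->
  (0 < J)%N -> (J <= W)%N -> J%:R <= W%:R `^ (sigma - 1 / 2) :> R -> k != 0 ->
  c * (box_mult J W k)%:R <= 256 * (J%:R * (W * W * J)%:R * W%:R `^ (2 + 2 * sigma)) * w k.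
Proof.
move=> c0 /andP[s1 s2] hw1 hw2 J0 JW JZ k0.
have J1 : 1 <= J%:R :> R by rewrite ler1n.
have W1 : 1 <= W%:R :> R by rewrite ler1n (leq_trans J0).
have WpE := powR_split sigma W1.
have pow_le := powR_le_exp4 s2.
pose Z := W%:R `^ (sigma - 1 / 2); rewrite -/Z in JZ WpE.
pose Wp := W%:R `^ (2 + 2 * sigma); rewrite -/Wp in WpE *.
pose Xr : R := (W * W * J)%:R; rewrite -/Xr.
have Wp0 : 0 < Wp by rewrite powR_gt0 //; lra.
have wk0 : 0 <= w k.
  have := hw1 k (Num.max `|k.1|%:~R `|k.2|%:~R) k0.
  rewrite !le_max !lexx orbT => /(_ isT isT) h.
  rewrite leNgt; apply/negP => wk.
  have := powR_ge0 (Num.max `|k.1|%:~R `|k.2|%:~R : R) (2 + 2 * sigma); nra.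
have [->|] := posnP (box_mult J W k).
  rewrite mulr0; apply: mulr_ge0; last exact: wk0.
  apply: mulr_ge0; first lra.
  exact: mulr_ge0 (mulr_ge0 (ler0n _ _) (ler0n _ _)) (ltW Wp0).
move=> /(box_mult_cone J0 JW)[kWJ kfar knear].
have [kW|kW] := ltP `|k.1| (2 * W)%:Z.
  have hk1 : `|k.1|%:~R <= 4 * W%:R :> R.
    by rewrite -natrM pmulrn ler_int; lia.
  have hk2 : `|k.2|%:~R <= 4 * W%:R :> R.
    by rewrite -natrM pmulrn ler_int; exact: knear.
  have := hw1 k _ k0 hk1 hk2; rewrite powRM; [|lra|lra]; rewrite -/Wp => h.
  have h4 : 4 `^ (2 + 2 * sigma) <= 256 :> R.
    by apply: le_trans (pow_le 4 _) _; lra.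
  have hm : (box_mult J W k)%:R <= J%:R * Xr by rewrite /Xr -natrM ler_nat box_mult_le_all.
  have h' : c <= w k * (256 * Wp).
    by apply: le_trans h _; rewrite ler_wpM2l // ler_wpM2r // ltW.
  have JX0 : 0 <= J%:R * Xr by rewrite mulr_ge0 // ler0n.
  apply: (@le_trans _ _ (w k * (256 * Wp) * (J%:R * Xr))).
    exact: ler_pM (ltW c0) (ler0n _ _) h' hm.
  by rewrite le_eqVlt; apply/orP; left; apply/eqP; ring.
have hc := hw2 k k0 (kfar kW).
have hm : (box_mult J W k)%:R * `|k.1|%:~R <= 12 * Xr * (J%:R * W%:R) :> R.
  by rewrite /Xr -!natrM ler_nat; move: (box_mult_far J0 JW kW).
have hk : `|k.1|%:~R <= W%:R * J%:R :> R.
  by rewrite -natrM pmulrn ler_int ltW.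
have k10 : 0 <= `|k.1|%:~R :> R by rewrite ler0z.
move: hm hk hc k10; set a : R := `|k.1|%:~R; set u : R := (box_mult J W k)%:R => hm hk hc a0.
have u0 : 0 <= u by exact: ler0n.
apply: (@le_trans _ _ (w k * (u * a) * a ^+ 2)).
  rewrite (_ : w k * (u * a) * a ^+ 2 = w k * a ^+ 3 * u); last by ring.
  by rewrite ler_wpM2r.
apply: (@le_trans _ _ (w k * (12 * Xr * (J%:R * W%:R)) * (W%:R * J%:R) ^+ 2)).
  apply: ler_pM; rewrite ?sqr_ge0 ?mulr_ge0 //; first by rewrite ler_wpM2l.
  by rewrite ler_pXn2r ?nnegrE ?mulr_ge0 ?ler0n.
have J2 : J%:R ^+ 2 <= Z ^+ 2 by rewrite ler_pXn2r ?nnegrE //; lra.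
rewrite WpE.
set j := J%:R in J1 J2 *; set v := W%:R in W1 *.
have X0 : 0 <= Xr by exact: ler0n.
rewrite (_ : w k * (12 * Xr * (j * v)) * (v * j) ^+ 2 = 12 * (w k * Xr * j * v ^+ 3) * j ^+ 2); last by ring.
rewrite (_ : 256 * (j * Xr * (v ^+ 3 * Z ^+ 2)) * w k = 256 * (w k * Xr * j * v ^+ 3) * Z ^+ 2); last by ring.
have P0 : 0 <= w k * Xr * j * v ^+ 3 by rewrite !mulr_ge0 // ?exprn_ge0 //; lra.
(* The bound reduces to J^2 <= Z^2, multiplied by 12 <= 256 and a common factor. *)
have Z0 : 0 <= j ^+ 2 by exact: sqr_ge0.
by apply: ler_pM; rewrite ?mulr_ge0 //; lra.
Qed.

Lemma density_arith (c n Y Wp T n' : R) : 0 < c -> 1 <= n -> 0 <= Y -> 0 < Wp ->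
  Wp * Y <= 256 * n ^+ 2 -> n' <= Y -> c * n ^+ 2 <= 256 * Wp * T ->
  c / (256 * 256) * n' <= T.
Proof.
move=> c0 n1 Y0 W0 h1 h2 h3.
have n2 : 0 < n ^+ 2 by rewrite exprn_gt0 //; lra.
have T0 : 0 <= T.
  have : 0 <= 256 * Wp * T by apply: le_trans h3; rewrite mulr_ge0 // ltW.
  have c256 : 0 < 256 :> R by rewrite ltr0n.
  by rewrite (pmulr_rge0 _ (mulr_gt0 c256 W0)).
have h4 : c * n' <= c * Y by rewrite ler_pM2l.
have h5 : c * n ^+ 2 * Y <= 256 * Wp * T * Y by rewrite ler_wpM2r.
have h6 : T * (Wp * Y) <= T * (256 * n ^+ 2) by rewrite ler_wpM2l.
have h7 : n ^+ 2 * (c * Y) <= n ^+ 2 * (256 * 256 * T) by lra.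
by move: h7; rewrite ler_pM2l //; lra.
Qed.

(** W ~ N^(2 / (2 sigma + 3)) and J ~ W^(sigma - 1/2) are the sizes for which the
    multiplicities are controlled by the weights and |X| = W^2 J >= 2 N, so that
    the zero difference takes away at most half of the averaged sum. *)
Lemma lattice_sum_lower_bound (sigma c : R) (w : int * int -> R) :
  0 < c -> 1 / 2 <= sigma <= 1 ->
  (forall (k : int * int) (B : R), k != 0 -> `|k.1|%:~R <= B -> `|k.2|%:~R <= B ->
     c <= w k * B `^ (2 + 2 * sigma)) ->
  (forall k : int * int, k != 0 -> `|k.2| <= 2 * `|k.1| -> c <= w k * `|k.1|%:~R ^+ 3) ->
  exists2 c' : R, 0 < c' & forall N : nat, (0 < N)%N ->
    exists F : seq (int * int), [/\ uniq F, 0 \notin F &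
      forall (us : seq (R * R)) (m : int * int -> int * int), size us = N ->
        (forall k l, m (k - l) = m k - m l) ->
        c' * N%:R `^ (2 / (2 * sigma + 3)) <= \sum_(k <- F) w k * power us (m k)].
Proof.
move=> c0 s12 hw1 hw2; have /andP[s1 s2] := s12.
exists (c / (256 * 256)); first lra.
move=> N N0.
have NR : 1 <= N%:R :> R by rewrite ler1n.
pose e := 2 / (2 * sigma + 3).
have e0 : 0 < e by apply: divr_gt0; lra.
(* The factor 4 gives |X| >= 2 N in spite of the rounding in J >= Z / 2. *)
pose Y := (4 * N%:R) `^ e.
pose W := (Num.trunc Y).+1.
have Y1 : 1 <= Y by rewrite /Y -[leLHS](@powRr0 _ (4 * N%:R)) ler_powR //; lra.
have /andP[WY YW] : (Num.trunc Y)%:R <= Y < W%:R by apply: truncn_itv; lra.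
have W2Y : W%:R <= 2 * Y by rewrite /W -natr1; lra.
have W1 : 1 <= W%:R :> R by rewrite ler1n.
pose Z := W%:R `^ (sigma - 1 / 2).
have Z1 : 1 <= Z by rewrite /Z -[leLHS](@powRr0 _ W%:R) ler_powR //; lra.
pose J := Num.trunc Z.
have /andP[JZ ZJ] : J%:R <= Z < J.+1%:R by apply: truncn_itv; lra.
have J0 : (0 < J)%N by rewrite truncn_gt0.
have J1 : 1 <= J%:R :> R by rewrite ler1n.
have ZJ2 : Z <= 2 * J%:R by rewrite -natr1 in ZJ; lra.
have ZW : Z <= W%:R by rewrite /Z ler1_powR //; lra.
have JW : (J <= W)%N by rewrite -(ler_nat R); lra.
have W0 : W%:R != 0 :> R by rewrite pnatr_eq0.
have NW : 4 * N%:R <= W%:R ^+ 2 * Z.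
  rewrite -powR_mulrn ?ler0n // /Z -powRD ?W0 ?implybT //.
  rewrite (_ : 2%:R + (sigma - 1 / 2) = sigma + 3 / 2); last by field.
  have e1 : e * (sigma + 3 / 2) = 1 by rewrite /e; field; apply/eqP; lra.
  apply: (@le_trans _ _ ((4 * N%:R) `^ (e * (sigma + 3 / 2)))).
    by rewrite e1 powRr1 //; lra.
  by rewrite powRrM -/Y ge0_ler_powR ?nnegrE //; lra.
have YpE : Y `^ (2 + 2 * sigma) * Y = 16 * N%:R ^+ 2.
  have n0 : 4 * N%:R != 0 :> R by apply/eqP; lra.
  rewrite /Y -powRrM -powRD ?n0 ?implybT //.
  rewrite (_ : e * (2 + 2 * sigma) + e = 2%:R); last by rewrite /e; field; apply/eqP; lra.
  by rewrite powR_mulrn; [ring | lra].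
have pow_le := powR_le_exp4 s2.
have WpY : W%:R `^ (2 + 2 * sigma) * Y <= 256 * N%:R ^+ 2.
  have -> : 256 * N%:R ^+ 2 = 16 * (Y `^ (2 + 2 * sigma) * Y) by rewrite YpE; ring.
  rewrite mulrA ler_wpM2r //; first lra.
  apply: (@le_trans _ _ ((2 * Y) `^ (2 + 2 * sigma))).
    by rewrite ge0_ler_powR ?nnegrE //; lra.
  rewrite powRM; [|lra|lra]; rewrite ler_wpM2r ?powR_ge0 //.
  by apply: le_trans (pow_le 2 _) _; lra.
pose Xr : R := (W * W * J)%:R.
have XE : Xr = W%:R ^+ 2 * J%:R by rewrite /Xr !natrM expr2.
have NX : 2 * N%:R <= Xr.
  rewrite XE; have : W%:R ^+ 2 * Z <= W%:R ^+ 2 * (2 * J%:R) by rewrite ler_wpM2l ?sqr_ge0.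
  lra.
pose Wp := W%:R `^ (2 + 2 * sigma).
have Wp0 : 0 < Wp by rewrite powR_gt0 //; lra.
have mult_w k : k != 0 -> c * (box_mult J W k)%:R <= 256 * (J%:R * Xr * Wp) * w k.
  by move=> k0; exact: (box_mult_le_weight c0 s12 hw1 hw2 J0 JW JZ k0).
exists (diff_support J W); split.
- by rewrite filter_uniq // undup_uniq.
- by rewrite mem_filter eqxx.
move=> us m usN mB; rewrite -/e.
have h := weighted_power_ge us J0 JW mB; rewrite usN -/Xr in h.
have h2 : c * \sum_(k <- diff_support J W) (box_mult J W k)%:R * power us (m k) <=
    256 * (J%:R * Xr * Wp) * \sum_(k <- diff_support J W) w k * power us (m k).
  rewrite !mulr_sumr big_seq [leRHS]big_seq; apply: ler_sum => k.
  rewrite mem_filter => /andP[k0 _].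
  by rewrite [leLHS]mulrA [leRHS]mulrA ler_wpM2r ?power_ge0 // mult_w.
move: h h2; set S := \sum_(k <- _) (box_mult J W k)%:R * _; set T := (X in _ <= _ * X) => h h2.
have Xr0 : 0 < Xr by lra.
have YN : N%:R `^ e <= Y.
  apply: ge0_ler_powR (ltW e0) _ _ _ _ _; rewrite ?nnegrE; first exact: ler0n.
    by rewrite mulr_ge0 ?ler0n.
  by rewrite ler_peMl ?ler0n // ler1n.
have h3 : c * N%:R ^+ 2 <= 256 * Wp * T.
  have JX : 0 < J%:R * Xr by rewrite mulr_gt0 //; lra.
  rewrite -(ler_pM2l JX); apply: (@le_trans _ _ (c * (J%:R * (N%:R * Xr ^+ 2 - Xr * N%:R ^+ 2)))).
    rewrite (_ : J%:R * Xr * (c * N%:R ^+ 2) = c * (J%:R * (Xr * N%:R * N%:R))); last by ring.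
    rewrite (_ : N%:R * Xr ^+ 2 - Xr * N%:R ^+ 2 = Xr * N%:R * (Xr - N%:R)); last by ring.
    have XN : 0 <= Xr * N%:R by rewrite mulr_ge0 ?ler0n.
    by rewrite ler_pM2l // ler_wpM2l ?ler0n // ler_wpM2l //; lra.
  apply: (@le_trans _ _ (c * S)); first by rewrite ler_pM2l.
  by apply: le_trans h2 _; rewrite le_eqVlt; apply/orP; left; apply/eqP; ring.
have Y0 : 0 <= Y by exact: le_trans Y1.
exact: (density_arith c0 NR Y0 Wp0 WpY YN h3).
Qed.

End WeightedSum.

(** * Affine changes of variables *)

(* The image of a measure, packaged as a measure. *)
Local Notation image_measure :=
  measure_function_pushforward__canonical__measure_function_Measure.

Section Measure.
Context {R : realType}.
Local Notation leb := (@lebesgue_measure R).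
Local Notation leb2 := (@lebesgue_measure R \x @lebesgue_measure R)%E.

Lemma measurable_affine (a b : R) :
  measurable_fun [set: R] (fun x : R => a * x + b).
Proof. by apply: measurable_funD => //; apply: measurable_funM. Qed.

Lemma preimage_affine_itv (a b u v : R) (b0 b1 : bool) : 0 < a ->
  (fun x => a * x + b) @^-1` [set` Interval (BSide b0 u) (BSide b1 v)] =
  [set` Interval (BSide b0 ((u - b) / a)) (BSide b1 ((v - b) / a))].
Proof.
move=> a0; apply/seteqP; split=> x /=; rewrite !in_itv /=; case: b0; case: b1 => /=;
  rewrite ?ler_pdivrMr ?ltr_pdivrMr ?ler_pdivlMr ?ltr_pdivlMr // => ?; lra.
Qed.

Let leb_pos_affine (a b : R) (A : set R) : 0 < a -> measurable A ->
  leb A = (a%:E * leb ((fun x => a * x + b)%R @^-1` A))%E.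
Proof.
move=> a0 mA.
pose phi : measurableTypeR R -> measurableTypeR R := (fun x : R => (a * x + b)%R).
have mphi : measurable_fun [set: measurableTypeR R] phi by exact: measurable_affine.
pose nu : {measure set (measurableTypeR R) -> \bar R} := image_measure leb mphi.
pose r : {nonneg R} := NngNum (ltW a0).
rewrite -[RHS]/(mscale r (nu) A).
apply: lebesgue_measure_unique => // _ [[u v] _ <-].
rewrite -[RHS]/(a%:E * leb ((fun x => (a * x + b)%R) @^-1` [set` Interval (BSide false u) (BSide false v)]))%E.
rewrite (preimage_affine_itv b u v false false a0) !lebesgue_measure_itv /= !lte_fin ltr_pM2r ?invr_gt0 // ltrD2r.
case: ifP => _; rewrite ?mule0 // -EFinM; congr EFin.
by field; lra.
Qed.

Lemma lebesgue_measure_affine (a b : R) (A : set R) : a != 0 -> measurable A ->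
  leb A = (`|a|%:E * leb ((fun x => a * x + b)%R @^-1` A))%E.
Proof.
move=> a0 mA; have [ap|an|] := ltgtP 0 a; last by move=> /esym/eqP; rewrite (negbTE a0).
  by rewrite gtr0_norm //; exact: leb_pos_affine.
rewrite ltr0_norm // (@leb_pos_affine (- a) b A) ?oppr_gt0 //.
rewrite -lebesgue_measureN /pushforward; last first.
  by rewrite -[X in measurable X]setTI; exact: measurable_affine.
by congr (_ * leb _)%E; apply/seteqP; split=> x /=; rewrite mulrNN.
Qed.

Lemma ge0_integral_affine (a b : R) (f : R -> \bar R) : a != 0 ->
  measurable_fun [set: R] f -> (forall x, 0 <= f x)%E ->
  (\int[leb]_x f x = `|a|%:E * \int[leb]_x f (a * x + b)%R)%E.
Proof.
move=> a0 mf f0.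
pose phi : measurableTypeR R -> measurableTypeR R := (fun x : R => (a * x + b)%R).
have mphi : measurable_fun [set: measurableTypeR R] phi by exact: measurable_affine.
pose nu : {measure set (measurableTypeR R) -> \bar R} := image_measure leb mphi.
pose r : {nonneg R} := NngNum (normr_ge0 a).
transitivity (\int[mscale r (nu)]_x f x)%E.
  apply: eq_measure_integral => A mA _; rewrite /mscale /= /pushforward /nu.
  exact: lebesgue_measure_affine.
by rewrite ge0_integral_mscale // ge0_integral_pushforward.
Qed.

Implicit Types f : R * R -> \bar R.

Lemma measurable_affine2 f (a b c d e k : R) :
  measurable_fun setT f ->
  measurable_fun [set: measurableTypeR R * measurableTypeR R]
    (fun x => f (a * x.1 + b * x.2 + c, d * x.1 + e * x.2 + k)).
Proof.
move=> mf; apply: (measurableT_comp mf); apply: measurable_fun_pair;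
 by apply: measurable_funD => //; apply: measurable_funD; apply: measurable_funM.
Qed.

Lemma ge0_integral_homothety f (l : R) (c : R * R) : l != 0 ->
  measurable_fun [set: measurableTypeR R * measurableTypeR R] f ->
  (forall x, 0 <= f x)%E ->
  (\int[leb2]_x f x = (l ^+ 2)%:E * \int[leb2]_x f (c + l *: x)%R)%E.
Proof.
move=> l0 mf f0.
have mg : measurable_fun [set: measurableTypeR R * measurableTypeR R]
    (fun x : R * R => f (c + l *: x)).
  apply: (eq_measurable_fun (fun x : R * R => f (l * x.1 + 0 * x.2 + c.1, 0 * x.1 + l * x.2 + c.2))).
    move=> x _; congr f; rewrite [c in RHS]surjective_pairing [x in RHS]surjective_pairing.
    by congr pair => /=; rewrite mul0r ?addr0 ?add0r addrC.
  exact: measurable_affine2.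
rewrite (fubini_tonelli1 _ mf f0) (fubini_tonelli1 _ mg (fun x => f0 _)).
have mF := measurable_fun_fubini_tonelli_F (m2 := leb) _ mf f0.
have mG := measurable_fun_fubini_tonelli_F (m2 := leb) _ mg (fun x => f0 _).
have F0 x : (0 <= fubini_F leb f x)%E by apply: integral_ge0 => y _; exact: f0.
rewrite (ge0_integral_affine c.1 l0 mF F0).
transitivity (`|l|%:E * \int[leb]_x (`|l|%:E * \int[leb]_y f (c + l *: (x, y))%R))%E.
  congr (_ * _)%E; apply: eq_integral => x _.
  rewrite /fubini_F [LHS](@ge0_integral_affine l c.2) //; last exact: (measurable_fun_pair2 _ mf).
  congr (_ * _)%E; apply: eq_integral => y _; congr f.
  rewrite [c in RHS]surjective_pairing; congr pair => /=; exact: addrC.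
rewrite ge0_integralZl //; last by move=> x _; apply: integral_ge0 => y _; exact: f0.
by rewrite muleA -EFinM -expr2 real_normK ?num_real.
Qed.

Lemma ge0_integral_shear1 f (s : R) :
  measurable_fun [set: measurableTypeR R * measurableTypeR R] f ->
  (forall x, 0 <= f x)%E ->
  (\int[leb2]_x f x = \int[leb2]_x f (x.1 + s * x.2, x.2)%R)%E.
Proof.
move=> mf f0.
have mg : measurable_fun [set: measurableTypeR R * measurableTypeR R]
    (fun x : R * R => f (x.1 + s * x.2, x.2)).
  apply: (eq_measurable_fun (fun x : R * R => f (1 * x.1 + s * x.2 + 0, 0 * x.1 + 1 * x.2 + 0))).
    by move=> x _; congr (f (_, _)); ring.
  exact: measurable_affine2.
rewrite (fubini_tonelli2 _ mf f0) (fubini_tonelli2 _ mg (fun x => f0 _)).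
apply: eq_integral => y _.
rewrite /fubini_G /fubini_F [LHS](@ge0_integral_affine 1 (s * y)) ?oner_eq0 //; last exact: (measurable_fun_pair1 _ mf).
by rewrite normr1 mul1e /=; apply: eq_integral => x _ /=; rewrite mul1r.
Qed.

Lemma ge0_integral_shear2 f (s : R) :
  measurable_fun [set: measurableTypeR R * measurableTypeR R] f ->
  (forall x, 0 <= f x)%E ->
  (\int[leb2]_x f x = \int[leb2]_x f (x.1, x.2 + s * x.1)%R)%E.
Proof.
move=> mf f0.
have mg : measurable_fun [set: measurableTypeR R * measurableTypeR R]
    (fun x : R * R => f (x.1, x.2 + s * x.1)).
  apply: (eq_measurable_fun (fun x : R * R => f (1 * x.1 + 0 * x.2 + 0, s * x.1 + 1 * x.2 + 0))).
    by move=> x _; congr (f (_, _)); ring.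
  exact: measurable_affine2.
rewrite (fubini_tonelli1 _ mf f0) (fubini_tonelli1 _ mg (fun x => f0 _)).
apply: eq_integral => x _.
rewrite /fubini_G /fubini_F [LHS](@ge0_integral_affine 1 (s * x)) ?oner_eq0 //; last exact: (measurable_fun_pair2 _ mf).
by rewrite normr1 mul1e /=; apply: eq_integral => y _ /=; rewrite mul1r.
Qed.

(** A rotation is a product of three shears, with coefficients - t, s, - t for
    t = s / (1 + c), the tangent of half the angle; a shear preserves the area
    because it translates each line of one direction. *)
Lemma ge0_integral_rotation f (c s : R) : c ^+ 2 + s ^+ 2 = 1 -> 0 <= c ->
  measurable_fun [set: measurableTypeR R * measurableTypeR R] f ->
  (forall x, 0 <= f x)%E ->
  (\int[leb2]_x f x = \int[leb2]_x f (c * x.1 - s * x.2, s * x.1 + c * x.2)%R)%E.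
Proof.
move=> cs1 c0 mf f0; pose t := s / (1 + c).
have mg : measurable_fun [set: measurableTypeR R * measurableTypeR R]
    (fun x : R * R => f (1 * x.1 + (- t) * x.2 + 0, 0 * x.1 + 1 * x.2 + 0)).
  exact: measurable_affine2.
have mh : measurable_fun [set: measurableTypeR R * measurableTypeR R]
    (fun x : R * R => f ((1 - t * s) * x.1 + (- t) * x.2 + 0, s * x.1 + 1 * x.2 + 0)).
  exact: measurable_affine2.
pose g (x : R * R) := f (x.1 - t * x.2, x.2).
pose h (x : R * R) := g (x.1, x.2 + s * x.1).
have mg' : measurable_fun [set: measurableTypeR R * measurableTypeR R] g.
  by apply: (eq_measurable_fun _ _ mg) => x _; congr (f (_, _)) => /=; ring.
have mh' : measurable_fun [set: measurableTypeR R * measurableTypeR R] h.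
  by apply: (eq_measurable_fun _ _ mh) => x _; congr (f (_, _)) => /=; ring.
rewrite (ge0_integral_shear1 (- t) mf f0).
transitivity (\int[leb2]_x g x)%E.
  by apply: eq_integral => x _; rewrite mulNr.
rewrite (ge0_integral_shear2 s mg') ?(ge0_integral_shear1 (- t) mh') //;
  try by move=> x; exact: f0.
apply: eq_integral => x _; rewrite /h /g /=.
have c1 : 1 + c != 0 by apply/eqP; lra.
have s2 : s ^+ 2 = 1 - c ^+ 2 by lra.
by congr (f (_, _)); rewrite /t; field: s2.
Qed.

End Measure.

(** * Integrals of bounded measurable functions *)

Section BoundedMeasurable.
Context d (T : measurableType d) (R : realType).
Implicit Types (f g : T -> R) (D : set T).

(** A class of functions closed under the ring operations and integrable on every
    set of finite measure, so that linearity of the integral comes with a single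
    kind of side condition. *)
Definition bounded_measurable f :=
  measurable_fun setT f /\ exists K, forall x, `|f x| <= K.

Lemma bounded_measurable_cst (k : R) : bounded_measurable (fun=> k).
Proof. by split=> //; exists `|k|. Qed.

Lemma bounded_measurableD f g :
  bounded_measurable f -> bounded_measurable g -> bounded_measurable (fun x => f x + g x).
Proof.
move=> [mf [K hK]] [mg [L hL]]; split; first exact: measurable_funD.
by exists (K + L) => x; rewrite (le_trans (ler_normD _ _)) // lerD.
Qed.

Lemma bounded_measurableM f g :
  bounded_measurable f -> bounded_measurable g -> bounded_measurable (fun x => f x * g x).
Proof.
move=> [mf [K hK]] [mg [L hL]]; split; first exact: measurable_funM.
by exists (K * L) => x; rewrite normrM ler_pM.
Qed.

Lemma bounded_measurableN f :
  bounded_measurable f -> bounded_measurable (fun x => - f x).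
Proof.
move=> [mf [K hK]]; split; first exact: measurable_funN.
by exists K => x; rewrite normrN.
Qed.

Lemma bounded_measurableB f g :
  bounded_measurable f -> bounded_measurable g -> bounded_measurable (fun x => f x - g x).
Proof. by move=> bf bg; apply: bounded_measurableD => //; exact: bounded_measurableN. Qed.

Lemma bounded_measurable_sum (I : Type) (s : seq I) (h : I -> T -> R) :
  (forall i, bounded_measurable (h i)) ->
  bounded_measurable (fun x => \sum_(i <- s) h i x).
Proof.
move=> bh; elim: s => [|i s IH].
  under eq_fun do rewrite big_nil; exact: bounded_measurable_cst.
under eq_fun do rewrite big_cons; exact: bounded_measurableD.
Qed.

Lemma bounded_measurable_indic (A : set T) :
  measurable A -> bounded_measurable (\1_A : T -> R).
Proof.
move=> mA; split; first exact: measurable_indic.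
by exists 1 => x; rewrite indicE; case: (x \in A); rewrite ?normr1 ?normr0 // ler01.
Qed.

Lemma bounded_measurable_cos f : measurable_fun setT f -> bounded_measurable (fun x => cos (f x)).
Proof.
move=> mf; split; last by exists 1 => x; rewrite ler_norml cos_le1 cos_geN1.
apply: (measurableT_comp _ mf); apply: continuous_measurable_fun; exact: continuous_cos.
Qed.

Lemma bounded_measurable_sin f : measurable_fun setT f -> bounded_measurable (fun x => sin (f x)).
Proof.
move=> mf; split; last by exists 1 => x; rewrite ler_norml sin_le1 sin_geN1.
apply: (measurableT_comp _ mf); apply: continuous_measurable_fun; exact: continuous_sin.
Qed.

Variable mu : {measure set T -> \bar R}.
Variables (D : set T) (mD : measurable D) (Dfin : (mu D < +oo)%E).

Lemma bounded_measurable_integrable f :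
  bounded_measurable f -> mu.-integrable D (EFin \o f).
Proof.
move=> [mf [K hK]]; apply: measurable_bounded_integrable => //.
  exact: measurable_funTS.
by exists K; split; [exact: num_real | move=> M KM x _; exact: le_trans (hK x) (ltW KM)].
Qed.

Lemma bm_integralZl f k : bounded_measurable f ->
  \int[mu]_(x in D) (k * f x) = k * \int[mu]_(x in D) f x.
Proof. by move=> bf; apply: RintegralZl => //; exact: bounded_measurable_integrable. Qed.

Lemma bm_integralD f g : bounded_measurable f -> bounded_measurable g ->
  \int[mu]_(x in D) (f x + g x) = \int[mu]_(x in D) f x + \int[mu]_(x in D) g x.
Proof. by move=> bf bg; apply: RintegralD => //; exact: bounded_measurable_integrable. Qed.

Lemma bm_integralB f g : bounded_measurable f -> bounded_measurable g ->
  \int[mu]_(x in D) (f x - g x) = \int[mu]_(x in D) f x - \int[mu]_(x in D) g x.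
Proof. by move=> bf bg; apply: RintegralB => //; exact: bounded_measurable_integrable. Qed.

Lemma bm_integral_sum (I : Type) (s : seq I) (h : I -> T -> R) :
  (forall i, bounded_measurable (h i)) ->
  \int[mu]_(x in D) (\sum_(i <- s) h i x) = \sum_(i <- s) \int[mu]_(x in D) h i x.
Proof.
move=> bh; elim: s => [|i s IH].
  under eq_Rintegral do rewrite big_nil.
  by rewrite big_nil Rintegral_cst // mul0r.
under eq_Rintegral do rewrite big_cons.
by rewrite big_cons bm_integralD ?IH //; exact: bounded_measurable_sum.
Qed.

Lemma le_bm_integral f g : bounded_measurable f -> bounded_measurable g ->
  (forall x, D x -> f x <= g x) ->
  \int[mu]_(x in D) f x <= \int[mu]_(x in D) g x.
Proof. by move=> bf bg; apply: le_Rintegral => //; exact: bounded_measurable_integrable. Qed.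

Lemma bm_integral_fin f : bounded_measurable f ->
  (\int[mu]_(x in D) (f x)%:E = (\int[mu]_(x in D) f x)%:E)%E.
Proof.
move=> bf; rewrite /Rintegral fineK //.
exact: integrable_fin_num (bounded_measurable_integrable bf).
Qed.

End BoundedMeasurable.

Section NonMeasurable.
Context d (T : measurableType d) (R : realType) (mu : {measure set T -> \bar R}).
Variables (D : set T) (mD : measurable D) (Dfin : (mu D < +oo)%E).

(** The integral of a nonnegative function is a supremum over the simple
    functions below it, and this supremum is monotone in the function. *)
Lemma le_integral_nonneg (f g : T -> \bar R) :
  (forall x, D x -> 0 <= f x)%E -> (forall x, D x -> f x <= g x)%E ->
  (\int[mu]_(x in D) f x <= \int[mu]_(x in D) g x)%E.
Proof.
move=> f0 fg; rewrite ge0_integralE // ge0_integralE; last first.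
  by move=> x Dx; exact: le_trans (f0 _ Dx) (fg _ Dx).
apply: ub_ereal_sup => _ /= [h hf <-]; apply: ereal_sup_ubound; exists h => // x.
apply: le_trans (hf x) _; rewrite /patch; case: ifPn => // /set_mem; exact: fg.
Qed.

(** For lower bounds of the integral of the squared discrepancy, about which only
    pointwise information is available: f is replaced by its positive part. *)
Lemma bm_integral_le_nonneg (f : T -> R) (g : T -> \bar R) : bounded_measurable f ->
  (forall x, D x -> 0 <= g x)%E -> (forall x, D x -> (f x)%:E <= g x)%E ->
  ((\int[mu]_(x in D) f x)%:E <= \int[mu]_(x in D) g x)%E.
Proof.
move=> bf g0 fg.
have bf' : bounded_measurable (fun x => Num.max (f x) 0).
  case: bf => mf [K hK]; split; first exact: measurable_maxr.
  exists K => x; case: (leP (f x) 0) => _ //; rewrite normr0.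
  exact: le_trans (hK x).
apply: (@le_trans _ _ (\int[mu]_(x in D) (Num.max (f x) 0)%:E)%E).
  rewrite bm_integral_fin // lee_fin le_bm_integral // => x _.
  by rewrite le_max lexx.
apply: le_integral_nonneg => x Dx; first by rewrite lee_fin le_max lexx orbT.
by rewrite EFin_max ge_max fg // g0.
Qed.
End NonMeasurable.

Section Plane.
Context {R : realType}.
Local Notation leb2 := (@lebesgue_measure R \x @lebesgue_measure R)%E.
Local Notation RR := (measurableTypeR R * measurableTypeR R)%type.

Lemma Rintegral_homothety (f : R * R -> R) (l : R) (c : R * R) : l != 0 ->
  measurable_fun [set: RR] f ->
  \int[leb2]_x f x = l ^+ 2 * \int[leb2]_x f (c + l *: x).
Proof.
move=> l0 mf; have mf' : measurable_fun [set: RR] (EFin \o f) by exact/measurable_EFinP.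
rewrite /Rintegral [X in fine X = _]integralE [X in _ = _ * fine X]integralE.
rewrite (ge0_integral_homothety c l0) //; last exact: measurable_funepos.
rewrite (ge0_integral_homothety (f := ((EFin \o f)^\-)%E) c l0) //; last exact: measurable_funeneg.
have l2 : 0 < l ^+ 2 by rewrite exprn_even_gt0.
set a := (X in (_ * X - _)%E); set b := (X in (_ - _ * X)%E).
have -> : (\int[leb2]_x (fun y => (f (c + l *: y)%R)%:E)^\+ x = a)%E.
  by apply: eq_integral => x _; rewrite !funeposE.
have -> : (\int[leb2]_x (fun y => (f (c + l *: y)%R)%:E)^\- x = b)%E.
  by apply: eq_integral => x _; rewrite !funenegE.
clearbody a b; move: a b => [a||] [b||] //=; rewrite ?gt0_muley ?gt0_muleNy ?lte_fin //=
  ?mulr0 //; ring.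
Qed.

(** An open set is the union of the countably many squares with rational centre
    and rational size that it contains, and these are measurable rectangles. *)
Lemma open_measurable2 (U : set (R * R)) : open U -> measurable (U : set RR).
Proof.
move=> oU.
pose box (i : rat * rat * nat) : set RR :=
  (ball (ratr i.1.1 : R) i.2.+1%:R^-1 `*` ball (ratr i.1.2 : R) i.2.+1%:R^-1).
pose F (i : rat * rat * nat) : set RR := if pselect (box i `<=` U) then box i else set0.
have rat_near (r y : R) : 0 < r -> exists q : rat, ball (ratr q : R) r y.
  move=> r0; have [q] := rat_in_itvoo (y := y + r) (x := y) ltac:(lra).
  by rewrite in_itv /= => /andP[h1 h2]; exists q; rewrite /ball /= ltr_norml; lra.
have -> : U = \bigcup_i F i.
  apply/seteqP; split=> [x Ux|x [i _]]; last by rewrite /F; case: pselect => // h /h.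
  have [e /= e0 xU] : exists2 e : R, 0 < e & ball x e `<=` U.
    by have /nbhs_ballP := open_nbhs_nbhs (conj oU Ux).
  have [n hn] : exists n : nat, n.+1%:R^-1 < e / 2.
    have [n hn] := ltr_add_invr (y := 0) (x := e / 2) ltac:(lra).
    by exists n; rewrite add0r in hn.
  move: hn; set r : R := n.+1%:R^-1 => hn.
  have n0 : 0 < r by rewrite invr_gt0.
  have [p hp] := rat_near _ x.1 n0; have [q hq] := rat_near _ x.2 n0.
  exists (p, q, n) => //; rewrite /F; case: pselect => [sU|nb]; first by split.
  exfalso; apply: nb => y [/= h1 h2]; apply: xU; split; rewrite /ball /= in h1 h2 hp hq *;
   move: h1 h2 hp hq; rewrite -/r !ltr_norml; lra.
apply: countable_bigcupT_measurable; first exact: countableP.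
move=> i; rewrite /F; case: pselect => ?; last exact: measurable0.
by apply: measurableX; exact: measurable_ball.
Qed.

End Plane.

(** * The kernel *)

Section Trig.
Context {R : realType}.
Local Notation leb := (@lebesgue_measure R).

Lemma is_derive_sin_affine (w p x : R) :
  is_derive x 1 (fun t => sin (w * t + p)) (w * cos (w * x + p)).
Proof.
have h : is_derive x 1 (fun t : R => w * t + p) w.
  by apply: is_derive_eq; rewrite addr0 /GRing.scale /= mulr1.
by rewrite mulrC; exact: (@is_derive1_comp _ sin (fun t => w * t + p)).
Qed.

Lemma integral_cos_affine (w p : R) : w != 0 ->
  \int[leb]_(t in `[0, 1]) cos (w * t + p) = (sin (w + p) - sin p) / w.
Proof.
move=> w0; rewrite /Rintegral.
have dF (x : R) : is_derive x 1 (fun t => w^-1 * sin (w * t + p)) (cos (w * x + p)).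
  have h := is_derive_sin_affine w p x.
  by apply: is_derive_eq; rewrite /GRing.scale /= mulrA mulVf // mul1r.
have cF : continuous (fun t => w^-1 * sin (w * t + p)).
  by move=> x; apply/differentiable_continuous/derivable1_diffP; have [] := dF x.
rewrite (@continuous_FTC2 _ _ (fun t => w^-1 * sin (w * t + p))) //=.
- by rewrite mulr1 mulr0 add0r; field.
- apply: continuous_subspaceT => x; apply: continuous_comp; last exact: continuous_cos.
  by apply: cvgD; [apply: cvgM; [exact: cvg_cst|exact: cvg_id]|exact: cvg_cst].
- split.
  + by move=> x _; have [] := dF x.
  + by apply: cvg_at_right_filter; exact: cF.
  + by apply: cvg_at_left_filter; exact: cF.
- by move=> x _; rewrite derive1E; have [_ ->] := dF x.
Qed.

Lemma integral_sin_linear (w : R) : w != 0 ->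
  \int[leb]_(t in `[0, 1]) sin (w * t) = (1 - cos w) / w.
Proof.
move=> w0; under eq_Rintegral do rewrite -cosBpihalf.
rewrite integral_cos_affine // sinBpihalf sinN sin_pihalf; congr (_ / _); ring.
Qed.

Let lebI : (leb `[0%R, 1%R]%classic < +oo)%E.
Proof. by rewrite lebesgue_measure_itv /= lte_fin ltr01 -EFinB ltry. Qed.

(** The third power makes the weight vanish at both ends to an order for which
    the transform has a closed form of constant sign beyond z = 3. *)
Definition kernel (z : R) : R :=
  \int[leb]_(t in `[0, 1]) (sin (pi * t) ^+ 3 * cos (pi * z * t)).

Lemma sin3cos (a b : R) : 8 * (sin a ^+ 3 * cos b) =
  3 * sin (a + b) + 3 * sin (a - b) - sin (3 * a + b) - sin (3 * a - b).
Proof.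
have -> : 3 * a = a + a + a by ring.
have h : cos a ^+ 2 = 1 - sin a ^+ 2 := cos2sin2 a.
rewrite !(sinD, cosD, sinN, cosN); ring: h.
Qed.

(** From 4 sin^3 a = 3 sin a - sin (3 a), the integrand is a combination of four
    sines, whose frequencies all take the same value of the cosine at t = 1. *)
Lemma kernelE (z : R) : 3 < z ->
  kernel z = 6 * (1 + cos (pi * z)) / (pi * (z ^+ 2 - 1) * (z ^+ 2 - 9)).
Proof.
move=> z3.
have p0 : pi != 0 :> R by rewrite gt_eqF // pi_gt0.
have bs (w : R) : bounded_measurable (fun t : R => sin (w * t)).
  by apply: bounded_measurable_sin; apply: measurable_funM.
have w0 (u v : R) : u + v * z != 0 -> pi * (u + v * z) != 0.
  by move=> uv; rewrite mulf_neq0.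
(* The frequencies pi (1 +- z) and pi (3 +- z), indexed by two booleans. *)
have cw (n : bool) (s : bool) : cos (pi * ((if n then 1 else 3) + (if s then 1 else - 1) * z)) = - cos (pi * z).
  have -> : pi * ((if n then 1 else 3) + (if s then 1 else - 1) * z) =
     (if n then 0 else pi *+ 2) + ((if s then pi * z else - (pi * z)) + pi).
    by case: n; case: s; ring.
  case: n; rewrite ?add0r; last rewrite addrC cosD2pi.
    by rewrite cosDpi; case: s; rewrite ?cosN.
  by rewrite cosDpi; case: s; rewrite ?cosN.
have z2 : z ^+ 2 - 1 != 0 by apply/eqP; nra.
have z9 : z ^+ 2 - 9 != 0 by apply/eqP; nra.
rewrite /kernel.
transitivity (\int[leb]_(t in `[0, 1]) (8^-1 * (3 * sin (pi * (1 + 1 * z) * t) +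
   3 * sin (pi * (1 + (- 1) * z) * t) - sin (pi * (3 + 1 * z) * t) - sin (pi * (3 + (- 1) * z) * t)))).
  apply: eq_Rintegral => t _.
  have <- : 8 * (sin (pi * t) ^+ 3 * cos (pi * z * t)) =
     3 * sin (pi * (1 + 1 * z) * t) + 3 * sin (pi * (1 + (- 1) * z) * t)
     - sin (pi * (3 + 1 * z) * t) - sin (pi * (3 + (- 1) * z) * t).
    by rewrite sin3cos; do !congr (_ + _); do ?congr (- _); do ?congr (_ * _); congr sin; ring.
  by rewrite mulKf //; apply/eqP; lra.
have bc (k w : R) : bounded_measurable (fun t : R => k * sin (w * t)).
  by apply: bounded_measurableM => //; exact: bounded_measurable_cst.
have b2 : bounded_measurable (fun t : R => 3 * sin (pi * (1 + 1 * z) * t) +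
   3 * sin (pi * (1 + (- 1) * z) * t)) by apply: bounded_measurableD; exact: bc.
have b3 : bounded_measurable (fun t : R => 3 * sin (pi * (1 + 1 * z) * t) +
   3 * sin (pi * (1 + (- 1) * z) * t) - sin (pi * (3 + 1 * z) * t)) by exact: bounded_measurableB b2 (bs _).
rewrite bm_integralZl //; last exact: bounded_measurableB b3 (bs _).
have mI : measurable (`[0%R, 1%R]%classic : set R) by [].
rewrite (bm_integralB (mu := leb) mI lebI b3 (bs _)) (bm_integralB (mu := leb) mI lebI b2 (bs _)).
rewrite (bm_integralD (mu := leb) mI lebI (bc _ _) (bc _ _)) !(bm_integralZl (mu := leb) mI lebI _ (bs _)).
rewrite !integral_sin_linear; try by apply: w0; apply/eqP; lra.
rewrite (cw true true) (cw true false) (cw false true) (cw false false).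
field; do ?[apply/andP; split]; first [exact: p0|apply/eqP; nra].
Qed.

Lemma kernel_ge0 (z : R) : 7 / 2 <= z -> 0 <= kernel z.
Proof.
move=> z3; rewrite kernelE; last lra.
have := cos_geN1 (pi * z); have p0 := pi_gt0 R => c1.
apply: divr_ge0; first lra.
by apply: mulr_ge0; [apply: mulr_ge0; [lra|nra]|nra].
Qed.

(** On [7/2, 9/2], which is centred at the period 4, the cosine is nonnegative. *)
Lemma kernel_ge (z : R) : 7 / 2 <= z <= 9 / 2 -> 1 / 200 <= kernel z.
Proof.
move=> /andP[z3 z4]; rewrite kernelE; last lra.
have p0 := pi_gt0 R; have p4 : pi <= 4 :> R by have := pihalf_lt2 R; lra.
have c0 : 0 <= cos (pi * z).
  have -> : pi * z = pi * (z - 4) + pi *+ 2 + pi *+ 2 by ring.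
  rewrite !cosD2pi; apply: cos_ge0_pihalf; apply/andP; split; nra.
have d1 : 0 < z ^+ 2 - 1 <= 20 by apply/andP; split; nra.
have d2 : 0 < z ^+ 2 - 9 <= 12 by apply/andP; split; nra.
move: d1 d2; set A := z ^+ 2 - 1; set B := z ^+ 2 - 9 => /andP[A0 A1] /andP[B0 B1].
rewrite ler_pdivlMr; last by rewrite !mulr_gt0.
have AB : A * B <= 240 by nra.
have : pi * A * B <= 4 * 240 by rewrite -mulrA; apply: ler_pM; nra.
lra.
Qed.

End Trig.

(** * The boundary of a convex body *)

Section Body.
Context {R : realType}.
Local Notation leb2 := (@lebesgue_measure R \x @lebesgue_measure R)%E.
Local Notation RR := (measurableTypeR R * measurableTypeR R)%type.
Implicit Types (C : set (R * R)) (x y p : R * R).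

Lemma convex_setP C x y (l : R) : convex_set C -> 0 <= l <= 1 ->
  C x -> C y -> C (l *: x + (1 - l) *: y).
Proof.
move=> cC /andP[l0 l1] Cx Cy.
have := cC x y (Itv01 l0 l1) (mem_set Cx) (mem_set Cy).
by move=> /set_mem.
Qed.

(** If a ball around p lies in C, then its image under a contraction towards a
    point c of C lies in C; c is taken in C so close to x that this image still
    contains a ball around p + l (x - p). *)
Lemma interior_homothety C p x (l : R) : convex_set C -> C° p ->
  closure C x -> 0 < l < 1 -> C° (p + l *: (x - p)).
Proof.
move=> cC /nbhs_ballP[r /= r0 pC] Cx /andP[l0 l1].
pose d := (1 - l) * r / 2.
have d0 : 0 < d by rewrite divr_gt0 // mulr_gt0 // subr_gt0.
have [c [Cc xc]] := Cx _ (nbhsx_ballx x d d0).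
apply/nbhs_ballP; exists d => //= z zy.
have l10 : 1 - l != 0 by rewrite subr_eq0 gt_eqF.
have -> : z = l *: c + (1 - l) *: ((1 - l)^-1 *: (z - l *: c)).
  by rewrite scalerA divff // scale1r addrC subrK.
apply: convex_setP => //; first by rewrite !ltW.
apply: pC.
have key (a b u v w : R) : `|u - v| < d -> `|(a + l * (u - a)) - w| < d ->
    `|a - (1 - l)^-1 * (w - l * v)| < r.
  move=> h1 h2.
  have -> : a - (1 - l)^-1 * (w - l * v) =
      (1 - l)^-1 * ((a + l * (u - a) - w) - l * (u - v)) by field.
  rewrite normrM gtr0_norm ?invr_gt0 ?subr_gt0 // ltr_pdivrMl ?subr_gt0 //.
  apply: le_lt_trans (ler_normB _ _) _.
  rewrite normrM (gtr0_norm l0).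
  have : l * `|u - v| <= `|u - v| by rewrite ler_piMl // ltW.
  by rewrite /d in h1 h2; lra.
case: xc zy => /= x1 x2 [/= z1 z2]; split; [exact: key x1 z1|exact: key x2 z2].
Qed.

Lemma closure_bounded_box C : bounded_set C ->
  exists2 K : R, 0 < K & forall x, closure C x -> `|x.1| <= K /\ `|x.2| <= K.
Proof.
move=> [M [_ hM]]; pose K := Num.max (M + 1) 1.
have MK : M < K by rewrite lt_max; apply/orP; left; lra.
have K1 : 1 <= K by rewrite le_max lexx orbT.
have hK x : C x -> `|x.1| <= K /\ `|x.2| <= K.
  move=> Cx; have := hM _ MK _ Cx; rewrite /= /Num.norm /= => h.
  by split; apply: le_trans h; rewrite le_max lexx ?orbT.
exists (K + 1); first lra.
move=> x Cx; have [c [Cc [/= h1 h2]]] := Cx _ (nbhsx_ballx x 1 ltr01).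
have [c1 c2] := hK _ Cc.
split; [rewrite -(subrK c.1 x.1)|rewrite -(subrK c.2 x.2)];
  (apply: le_trans (ler_normD _ _) _; rewrite addrC lerD //; exact: ltW).
Qed.

Lemma measurable_closure C : measurable (closure C : set RR).
Proof.
rewrite -[closure C]setCK; apply: measurableC; apply: open_measurable2.
exact/closed_openC/closed_closure.
Qed.

Lemma measurable_interior C : measurable (C° : set RR).
Proof. by apply: open_measurable2; exact: open_interior. Qed.

Lemma closure_finite C : bounded_set C -> (leb2 (closure C) < +oo)%E.
Proof.
move=> /closure_bounded_box[K K0 hK].
have mI : measurable (`[- K, K]%classic : set (measurableTypeR R)) by [].
apply: (@le_lt_trans _ _ (leb2 (`[- K, K] `*` `[- K, K]))).
  apply: le_measure; rewrite ?inE //; [exact: measurable_closure|exact: measurableX|].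
  by move=> x /hK[h1 h2]; split; rewrite /= in_itv /= -ler_norml.
rewrite product_measure1E //= !lebesgue_measure_itv /=.
by case: ifP => _; rewrite ?mul0e // -EFinB -EFinM ltry.
Qed.

Lemma le_of_scaled (b e : R) : 0 <= b -> 0 <= e ->
  (forall l : R, 0 < l < 1 -> l ^+ 2 * b <= e) -> b <= e.
Proof.
move=> b0 e0 h; rewrite leNgt; apply/negP => eb.
have bp : 0 < b by lra.
have := h ((b + e) / (2 * b)).
have -> : 0 < (b + e) / (2 * b) < 1.
  by rewrite divr_gt0 /= ?ltr_pdivrMr; lra.
move=> /(_ isT).
have -> : ((b + e) / (2 * b)) ^+ 2 * b = (b + e) ^+ 2 / (4 * b) by field; lra.
rewrite ler_pdivrMr; last lra.
nra.
Qed.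

(** A contraction of the closure by l < 1 towards an interior point lies in the
    interior, hence l^2 |closure C| <= |C°|. *)
Lemma body_boundary_null C : planar_convex_body C ->
  leb2 (closure C) = leb2 C°.
Proof.
move=> [cC bC [p Cp]].
have mB := measurable_closure C; have mE := measurable_interior C.
have EB : C° `<=` closure C by move=> x /interior_subset; exact: subset_closure.
have fB := closure_finite bC.
have leEB : (leb2 C° <= leb2 (closure C))%E by apply: le_measure; rewrite ?inE.
have fE : (leb2 C° < +oo)%E by exact: le_lt_trans leEB fB.
have scale (l : R) : 0 < l < 1 -> ((l ^+ 2)%:E * leb2 (closure C) <= leb2 C°)%E.
  move=> l01; have l0 : l != 0 by rewrite gt_eqF //; case/andP: l01.
  have iE (A : set RR) : measurable A -> leb2 A = (\int[leb2]_x (\1_A x)%:E)%E.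
    by move=> mA; rewrite integral_indic // setIT.
  have m1 (A : set RR) : measurable A -> measurable_fun [set: RR] (fun x => (\1_A x)%:E : \bar R).
    by move=> mA; apply/measurable_EFinP; exact: measurable_indic.
  rewrite !iE // (ge0_integral_homothety (p - l *: p) l0 (m1 _ mE)) //.
  apply: lee_wpmul2l; first by rewrite lee_fin sqr_ge0.
  apply: le_integral_nonneg => // x _.
  rewrite lee_fin !indicE.
  have [xB|xB] := boolP (x \in closure C) => //.
  rewrite (_ : _ \in _) //; apply/mem_set.
  have -> : p - l *: p + l *: x = p + l *: (x - p) by rewrite scalerBr addrA addrAC.
  by apply: interior_homothety => //; exact/set_mem.
apply/eqP; rewrite eq_le leEB andbT.
have fBn : leb2 (closure C) \is a fin_num by rewrite ge0_fin_numE.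
have fEn : leb2 C° \is a fin_num by rewrite ge0_fin_numE.
rewrite -(fineK fBn) -(fineK fEn) lee_fin.
set b := fine _; set e := fine _.
have b0 : 0 <= b by exact: fine_ge0.
have h (l : R) : 0 < l < 1 -> l ^+ 2 * b <= e.
  by move=> /scale; rewrite -(fineK fBn) -(fineK fEn) -EFinM lee_fin.
exact: le_of_scaled b0 (fine_ge0 (measure_ge0 _ _)) h.
Qed.

End Body.

(** * Unfolding of periodizations *)

Section Torus.
Context {R : realType}.
Local Notation leb2 := (@lebesgue_measure R \x @lebesgue_measure R)%E.
Local Notation RR := (measurableTypeR R * measurableTypeR R)%type.
Implicit Types (A B : set (R * R)) (x y u : R * R) (g : R * R -> R).

Lemma measurable_homothety (c : R * R) (s : R) :
  measurable_fun [set: RR] ((fun t : R * R => c + s *: t) : RR -> RR).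
Proof.
apply: (eq_measurable_fun ((fun t : R * R => (s * t.1 + c.1, s * t.2 + c.2)) : RR -> RR)).
  move=> t _; rewrite [c in RHS]surjective_pairing.
  by congr pair => /=; rewrite addrC.
by apply: measurable_fun_pair; apply: measurable_funD => //; apply: measurable_funM.
Qed.

Lemma bounded_measurable_homothety g (c : R * R) (s : R) :
  @bounded_measurable _ RR R g ->
  @bounded_measurable _ RR R (fun t => g (c + s *: t)).
Proof.
move=> [mg [G hG]]; split; last by exists G => t; exact: hG.
exact: (measurableT_comp mg (measurable_homothety c s)).
Qed.

Definition unit_square : set (R * R) := `[0, 1[ `*` `[0, 1[.

Lemma measurable_unit_square : measurable (unit_square : set RR).
Proof. by apply: measurableX. Qed.

Lemma unit_square_finite : (leb2 unit_square < +oo)%E.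
Proof.
rewrite product_measure1E //= !lebesgue_measure_itv /= lte_fin ltr01.
by rewrite -EFinB -EFinM ltry.
Qed.

Definition int_range (n : nat) : seq int := [seq i%:Z - n%:Z | i <- iota 0 (n + n).+1].

Lemma mem_int_range n (i : int) : (i \in int_range n) = (`|i| <= n%:Z).
Proof.
apply/mapP/idP => [[j]|hi]; first by rewrite mem_iota => /andP[_ h] ->; lia.
exists (absz (i + n%:Z)); last by lia.
by rewrite mem_iota; lia.
Qed.

Definition int_box (n : nat) : seq (int * int) :=
  [seq (i, j) | i <- int_range n, j <- int_range n].

Lemma mem_int_box n (k : int * int) :
  (k \in int_box n) = (`|k.1| <= n%:Z) && (`|k.2| <= n%:Z).
Proof.
case: k => i j; rewrite -!mem_int_range.
apply/allpairsP/andP => [[[a b] /= [ha hb [-> ->]]] //|[hi hj]].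
by exists (i, j).
Qed.

Lemma int_box_uniq n : uniq (int_box n).
Proof.
have u : uniq (int_range n) by rewrite map_inj_uniq ?iota_uniq // => a b; lia.
by apply: allpairs_uniq => // -[a b] [c d] _ _ [-> ->].
Qed.

(** The half-open unit square is a fundamental domain: the one translate that
    counts is the one by minus the integer parts of x. *)
Lemma sum_indic_unit_square n x : `|x.1| <= n%:R -> `|x.2| <= n%:R ->
  \sum_(k <- int_box n) \1_unit_square (x + lattice_point k) = 1 :> R.
Proof.
move=> x1 x2.
have inQ (z : R) (i : int) : (0 <= z + i%:~R < 1) = (i == - Num.floor z).
  apply/idP/eqP => [/andP[h1 h2]|->].
    apply: oppr_inj; rewrite opprK; apply/esym/floor_def.
    by rewrite rmorphD rmorphN /=; apply/andP; split; lra.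
  by rewrite rmorphN /=; have := floor_itv z; rewrite intrD; lra.
pose k0 : int * int := (- Num.floor x.1, - Num.floor x.2).
have k0b : k0 \in int_box n.
  have hfl (z : R) : `|z| <= n%:R -> `|- Num.floor z| <= n%:Z.
    rewrite normrN !ler_norml floor_ge_int rmorphN /= => /andP[-> h].
    by rewrite -(ler_int R) (le_trans (floor_le z)).
  by rewrite mem_int_box !hfl.
rewrite (bigD1_seq k0) ?int_box_uniq //= big1_seq ?addr0.
  rewrite indicE (_ : _ \in _) //; apply/mem_set; split; rewrite /= in_itv /=.
    by rewrite inQ.
  by rewrite inQ.
move=> k /andP[kk0 _]; rewrite indicE (_ : (_ \in _) = false) //.
apply/negbTE; apply: contraNN kk0 => /set_mem[]; rewrite /= !in_itv /= !inQ => /eqP e1 /eqP e2.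
by rewrite [k]surjective_pairing e1 e2.
Qed.

Lemma periodization_box n A x : (forall y, A y -> `|y.1 - x.1| <= n%:R /\ `|y.2 - x.2| <= n%:R) ->
  periodization A x = \sum_(k <- int_box n) \1_A (x + lattice_point k).
Proof.
move=> hA; rewrite /periodization (fsbigE (int_box n)) ?int_box_uniq //.
  by apply: eq_bigl => k; rewrite in_setT.
move=> k _ kn; rewrite indicE (_ : (_ \in _) = false) //; apply/negbTE.
apply: contraNN kn => /set_mem/hA; rewrite mem_int_box /= ![_ + _ - _]addrC !addKr.
by rewrite -!intr_norm -[n%:R]/(n%:Z%:~R) !ler_int => -[-> ->].
Qed.

Definition lattice_periodic g := forall x (k : int * int), g (x + lattice_point k) = g x.

(** A single finite box of lattice vectors serves for all base points t of the
    unit square, and also for the translates of the square that occur after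
    unfolding. *)
Lemma periodization_dilate_box B K (l : R) u :
  (forall y, B y -> `|y.1| <= K /\ `|y.2| <= K) -> 0 < l ->
  exists n : nat,
    (forall A t, A `<=` dilate l B -> unit_square t ->
       periodization A (u - t) = \sum_(k <- int_box n) \1_A (u - t + lattice_point k)) /\
    (forall y, B y -> `|(u - l *: y).1| <= n%:R /\ `|(u - l *: y).2| <= n%:R).
Proof.
move=> hB l0.
pose n := (Num.trunc (`|u.1| + `|u.2| + 1 + l * `|K|)).+1.
have nE : `|u.1| + `|u.2| + 1 + l * `|K| <= n%:R.
  have /truncn_itv/andP[_ /ltW//] : 0 <= `|u.1| + `|u.2| + 1 + l * `|K|.
  by rewrite !addr_ge0 ?normr_ge0 // mulr_ge0 ?normr_ge0 // ltW.
have hK y : B y -> `|l * y.1| <= l * `|K| /\ `|l * y.2| <= l * `|K|.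
  by move=> /hB[h1 h2]; rewrite !normrM (gtr0_norm l0) !ler_pM2l //;
    split; apply: le_trans (ler_norm _).
exists n; split=> [A t AB|y /hK[h1 h2]].
  move=> [/=]; rewrite !in_itv /= => t1 t2; apply: periodization_box => _ /AB[y /hK[h1 h2] <-] /=.
  have hz (a b c w : R) : 0 <= a < 1 -> `|w| <= l * `|K| -> 0 <= c ->
      `|b| + c + 1 + l * `|K| <= n%:R -> `|w - (b - a)| <= n%:R.
    move=> a01 hw c0 hn; apply: le_trans (ler_normB _ _) _.
    have := ler_normB b a; rewrite (ger0_norm (x := a)); lra.
  split; first exact: (hz _ _ _ _ t1 h1 (normr_ge0 _) nE).
  by apply: (hz _ _ _ _ t2 h2 (normr_ge0 u.1)); rewrite (addrC `|u.2|).
split; apply: le_trans (ler_normB _ _) _ => /=.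
  by have := normr_ge0 u.2; lra.
by have := normr_ge0 u.1; lra.
Qed.

Lemma indic_dilate (l : R) A x : 0 < l -> \1_(dilate l A) x = \1_A (l^-1 *: x) :> R.
Proof.
move=> l0; rewrite !indicE; congr (nat_of_bool _)%:R.
apply/idP/idP => /set_mem h; apply/mem_set.
  by case: h => y By <-; rewrite scalerA mulVf ?gt_eqF // scale1r.
by exists (l^-1 *: x) => //; rewrite scalerA mulfV ?gt_eqF // scale1r.
Qed.

Lemma bounded_measurable_dilate_translate B (l : R) u (k : int * int) :
  measurable (B : set RR) -> 0 < l ->
  @bounded_measurable _ RR R (fun t => \1_(dilate l B) (u - t + lattice_point k)).
Proof.
move=> mB l0; have bmB : @bounded_measurable _ RR R (\1_B) by exact: bounded_measurable_indic.
have := bounded_measurable_homothety (l^-1 *: (u + lattice_point k)) (- l^-1) bmB.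
congr bounded_measurable; apply/funext => t; rewrite indic_dilate //; congr (\1_B _).
by rewrite scaleNr -scalerBr addrAC.
Qed.

Lemma periodization_bounded_measurable B K (l : R) u : measurable (B : set RR) ->
  (forall y, B y -> `|y.1| <= K /\ `|y.2| <= K) -> 0 < l ->
  exists2 f, @bounded_measurable _ RR R f &
    forall t, unit_square t -> periodization (dilate l B) (u - t) = f t.
Proof.
move=> mB hB l0; have [n [hn _]] := periodization_dilate_box u hB l0.
exists (fun t => \sum_(k <- int_box n) \1_(dilate l B) (u - t + lattice_point k)).
  by apply: bounded_measurable_sum => k; exact: bounded_measurable_dilate_translate.
by move=> t Qt; exact: hn.
Qed.

Lemma le_periodization B K (l : R) u t A A' :
  (forall y, B y -> `|y.1| <= K /\ `|y.2| <= K) -> 0 < l ->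
  A `<=` A' -> A' `<=` dilate l B -> unit_square t ->
  periodization A (u - t) <= periodization A' (u - t).
Proof.
move=> hB l0 AA' A'B Qt; have [n [hn _]] := periodization_dilate_box u hB l0.
rewrite !hn //; last exact: subset_trans A'B.
apply: ler_sum => k _; rewrite !indicE ler_nat.
have [h|//] := boolP (_ \in A); rewrite (_ : _ \in A') //.
by apply/mem_set/AA'/set_mem.
Qed.

(** Unfolding: the substitution t = u + k - l y changes the integral over the
    unit square of the term of k into an integral over B, restricted to those y
    with u - l y + k in the unit square; these restrictions partition B when k
    varies. *)
Lemma integral_periodization B K (l : R) u g : measurable (B : set RR) -> (leb2 B < +oo)%E ->
  (forall y, B y -> `|y.1| <= K /\ `|y.2| <= K) -> 0 < l ->
  @bounded_measurable _ RR R g -> lattice_periodic g ->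
  \int[leb2]_(t in unit_square) (periodization (dilate l B) (u - t) * g t) =
  l ^+ 2 * \int[leb2]_(y in B) g (u - l *: y).
Proof.
move=> mB fB hB l0 bg pg.
have lN0 : - l != 0 by rewrite oppr_eq0 gt_eqF.
have [n [hn hK]] := periodization_dilate_box u hB l0.
have mQ := measurable_unit_square.
have bmQ : @bounded_measurable _ RR R (\1_unit_square) by exact: bounded_measurable_indic.
pose f (k : int * int) (t : R * R) := \1_(dilate l B) (u - t + lattice_point k) * g t.
have bf k : @bounded_measurable _ RR R (f k).
  by apply: bounded_measurableM => //; exact: bounded_measurable_dilate_translate.
transitivity (\int[leb2]_(t in unit_square) \sum_(k <- int_box n) f k t).
  by apply: eq_Rintegral => t /set_mem Qt; rewrite hn // mulr_suml.
rewrite (bm_integral_sum (mu := leb2) mQ unit_square_finite) //.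
pose h k y := \1_unit_square (u - l *: y + lattice_point k) * g (u - l *: y).
transitivity (\sum_(k <- int_box n) l ^+ 2 * \int[leb2]_(y in B) h k y).
  apply: eq_bigr => k _.
  rewrite Rintegral_mkcond (Rintegral_homothety (u + lattice_point k) lN0); last first.
    by apply/(measurable_restrictT _ mQ)/measurable_funTS; case: (bf k).
  rewrite sqrrN; congr (_ * _); rewrite [RHS]Rintegral_mkcond; apply: eq_Rintegral => y _.
  have e1 : u + lattice_point k + - l *: y = u - l *: y + lattice_point k.
    by rewrite scaleNr addrAC.
  have e2 : l^-1 *: (u - (u - l *: y + lattice_point k) + lattice_point k) = y.
    by rewrite opprD opprB addrA subrK addrC subrK scalerA mulVf ?gt_eqF // scale1r.
  rewrite e1 !patchE /f /h indic_dilate // e2 pg !indicE.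
  by case: (y \in B); case: (_ \in unit_square); rewrite ?mul1r ?mul0r.
have bh k : @bounded_measurable _ RR R (h k).
  have bQ' := bounded_measurable_homothety (u + lattice_point k) (- l) bmQ.
  have bg' := bounded_measurable_homothety u (- l) bg.
  have := bounded_measurableM bQ' bg'.
  by congr bounded_measurable; apply/funext => y; rewrite /h scaleNr addrAC.
rewrite -mulr_sumr -(bm_integral_sum (mu := leb2) mB fB) //.
congr (_ * _); apply: eq_Rintegral => y /set_mem /hK[h1 h2].
by rewrite -mulr_suml (@sum_indic_unit_square n) ?mul1r.
Qed.

End Torus.

(** * Trigonometric polynomials on the torus *)

Section Bessel.
Context {R : realType}.
Local Notation leb2 := (@lebesgue_measure R \x @lebesgue_measure R)%E.
Local Notation RR := (measurableTypeR R * measurableTypeR R)%type.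
Local Notation Q := (@unit_square R).
Implicit Types (A B : set (R * R)) (x y u : R * R) (g : R * R -> R) (m k : int * int).

Lemma phase_sub m x y : phase m (x - y) = phase m x - phase m y :> R.
Proof. by rewrite /phase /dot /=; ring. Qed.

Lemma phase_add m x y : phase m (x + y) = phase m x + phase m y :> R.
Proof. by rewrite /phase /dot /=; ring. Qed.

Lemma phase_scale m (l : R) x : phase m (l *: x) = l * phase m x.
Proof. by rewrite /phase /dot /= /GRing.scale /=; ring. Qed.

Lemma phase_lattice m k :
  phase m (lattice_point k) = (pi *+ 2) * (m.1 * k.1 + m.2 * k.2)%:~R :> R.
Proof. by rewrite /phase /dot /= intrD !intrM; ring. Qed.

Lemma periodic_int (f : R -> R) (T : R) : periodic f T ->
  forall (z : int) (x : R), f (x + T * z%:~R) = f x.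
Proof.
move=> pf [n|n] x; first by rewrite mulr_natr periodicn.
by rewrite NegzE rmorphN mulrN -[in RHS](subrK (T *+ n.+1) x) periodicn // -mulr_natr.
Qed.

Lemma lattice_periodic_phase (f : R -> R) m : periodic f (pi *+ 2) ->
  lattice_periodic (fun x => f (phase m x)).
Proof. by move=> pf x k; rewrite phase_add phase_lattice periodic_int. Qed.

Lemma measurable_phase m : measurable_fun [set: RR] (@phase R m : RR -> R).
Proof.
rewrite /phase /dot; apply: measurable_funM => //.
by apply: measurable_funD; apply: measurable_funM.
Qed.

Lemma bm_cos_phase m (l : R) : @bounded_measurable _ RR R (fun x => cos (l * phase m x)).
Proof.
apply: bounded_measurable_cos; apply: measurable_funM => //; exact: measurable_phase.
Qed.

Lemma bm_sin_phase m (l : R) : @bounded_measurable _ RR R (fun x => sin (l * phase m x)).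
Proof.
apply: bounded_measurable_sin; apply: measurable_funM => //; exact: measurable_phase.
Qed.

Lemma bm_cos_phase1 m : @bounded_measurable _ RR R (fun x => cos (phase m x)).
Proof. by apply: bounded_measurable_cos; exact: measurable_phase. Qed.

Lemma bm_sin_phase1 m : @bounded_measurable _ RR R (fun x => sin (phase m x)).
Proof. by apply: bounded_measurable_sin; exact: measurable_phase. Qed.

Lemma unit_square_bounded y : Q y -> `|y.1| <= 1 /\ `|y.2| <= 1.
Proof.
by case; rewrite /= !in_itv /= => /andP[h1 h2] /andP[h3 h4]; rewrite !ger0_norm // !ltW.
Qed.

Lemma periodization_unit_square x : periodization Q x = 1.
Proof.
pose n := (Num.trunc (`|x.1| + `|x.2| + 1)).+1.
have nE : `|x.1| + `|x.2| + 1 <= n%:R.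
  have /truncn_itv/andP[_ /ltW//] : 0 <= `|x.1| + `|x.2| + 1.
  by rewrite !addr_ge0.
have x10 := normr_ge0 x.1; have x20 := normr_ge0 x.2.
rewrite (@periodization_box _ n).
  by apply: sum_indic_unit_square; lra.
by move=> y /unit_square_bounded[h1 h2]; split; apply: le_trans (ler_normB _ _) _; lra.
Qed.

(** The unfolding identity for the unit square itself, whose periodization is
    the constant 1. *)
Lemma integral_torus_translate g u : @bounded_measurable _ RR R g -> lattice_periodic g ->
  \int[leb2]_(t in Q) g t = \int[leb2]_(t in Q) g (u - t).
Proof.
move=> bg pg.
have := @integral_periodization R Q 1 1 u g measurable_unit_square unit_square_finite
  (@unit_square_bounded) ltr01 bg pg.
rewrite (_ : dilate 1 Q = Q).
  under eq_Rintegral do rewrite periodization_unit_square mul1r.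
  by rewrite expr1n mul1r; under [in RHS]eq_Rintegral do rewrite scale1r.
by apply/seteqP; split=> [_ [y Qy <-]|y Qy]; [rewrite scale1r | exists y; rewrite ?scale1r].
Qed.

(** A translation by u with phase m u = pi / 2 exchanges sine and cosine, and a
    translation by 2 u changes the sign of the cosine. *)
Lemma integral_torus_cos_sin m : m != 0 ->
  \int[leb2]_(t in Q) cos (phase m t) = 0 /\ \int[leb2]_(t in Q) sin (phase m t) = 0.
Proof.
have half (z : R) : z = - z -> z = 0 by lra.
move=> m0.
have [u um] : exists u : R * R, phase m u = pi / 2.
  pose d : R := m.1%:~R ^+ 2 + m.2%:~R ^+ 2.
  have d0 : d != 0.
    rewrite paddr_eq0 ?sqr_ge0 // !sqrf_eq0 !intr_eq0.
    by apply: contra m0 => /andP[/eqP h1 /eqP h2]; rewrite [m]surjective_pairing h1 h2.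
  exists ((4 * d)^-1 *: lattice_point m); rewrite phase_scale /phase /dot /=.
  rewrite -!expr2 -/d; field; rewrite d0.
  by [].
have pc := lattice_periodic_phase m (@cosD2pi R); have ps := lattice_periodic_phase m (@sinD2pi R).
have e1 := integral_torus_translate u (bm_cos_phase1 m) pc.
have e2 := integral_torus_translate (u + u) (bm_cos_phase1 m) pc.
have es := integral_torus_translate u (bm_sin_phase1 m) ps.
have c0 : \int[leb2]_(t in Q) cos (phase m t) = 0.
  apply: half.
  rewrite [LHS]e2 -mulN1r -(bm_integralZl (mu := leb2) measurable_unit_square unit_square_finite) //.
    apply: eq_Rintegral => t _; rewrite phase_sub phase_add um -splitr cosB cospi sinpi; ring.
  exact: bm_cos_phase1.
split=> //; rewrite es -[RHS]c0; apply: eq_Rintegral => t _.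
by rewrite phase_sub um sinB cos_pihalf sin_pihalf mul0r subr0 mul1r.
Qed.

Lemma integral_torus_cos m : \int[leb2]_(t in Q) cos (phase m t) = (m == 0)%:R.
Proof.
have [->|m0] := eqVneq m 0; last by have [] := integral_torus_cos_sin m0.
under eq_Rintegral do rewrite /phase /dot /= !mul0r addr0 mulr0 cos0.
have Q1 : leb2 Q = 1%E.
  rewrite /unit_square product_measure1E //= !lebesgue_measure_itv /= lte_fin ltr01.
  by rewrite -EFinB -EFinM /= subr0 !mulr1.
rewrite Rintegral_cst; last exact: measurable_unit_square.
by rewrite (_ : fine _ = 1) ?mulr1 //; apply: (congr1 fine Q1).
Qed.

Lemma integral_torus_sin m : \int[leb2]_(t in Q) sin (phase m t) = 0.
Proof.
have [->|m0] := eqVneq m 0; last by have [] := integral_torus_cos_sin m0.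
under eq_Rintegral do rewrite /phase /dot /= !mul0r addr0 mulr0 sin0.
by rewrite Rintegral_cst ?mul0r //; exact: measurable_unit_square.
Qed.

Variables (a b : int * int -> R).
Hypotheses (aN : forall m, a (- m) = a m) (bN : forall m, b (- m) = - b m).

(** For a even and b odd in m, the frequencies m and - m have the same wave: the
    real form of a pair of conjugate Fourier coefficients. *)
Definition wave m x : R := a m * cos (phase m x) + b m * sin (phase m x).

Lemma bm_wave m : @bounded_measurable _ RR R (wave m).
Proof.
by apply: bounded_measurableD; apply: bounded_measurableM;
  [exact: bounded_measurable_cst|exact: bm_cos_phase1|exact: bounded_measurable_cst|exact: bm_sin_phase1].
Qed.

Lemma integral_wave_wave m k : \int[leb2]_(t in Q) (wave m t * wave k t) =
  2^-1 * ((a m * a k + b m * b k) * (k == m)%:R + (a m * a k - b m * b k) * (k == - m)%:R).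
Proof.
have mQ := @measurable_unit_square R; have fQ := @unit_square_finite R.
pose p := a m * a k + b m * b k; pose q := a m * a k - b m * b k.
pose r := b m * a k - a m * b k; pose s := a m * b k + b m * a k.
have bt (c : R) (f : R * R -> R) : @bounded_measurable _ RR R f -> @bounded_measurable _ RR R (fun t => c * f t).
  by move=> bf; apply: bounded_measurableM => //; exact: bounded_measurable_cst.
have b1 := bt p _ (bm_cos_phase1 (m - k)); have b2 := bt q _ (bm_cos_phase1 (m + k)).
have b3 := bt r _ (bm_sin_phase1 (m - k)); have b4 := bt s _ (bm_sin_phase1 (m + k)).
have b12 : @bounded_measurable _ RR R (fun t => p * cos (phase (m - k) t) + q * cos (phase (m + k) t)).
  exact: bounded_measurableD b1 b2.
have b34 : @bounded_measurable _ RR R (fun t => r * sin (phase (m - k) t) + s * sin (phase (m + k) t)).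
  exact: bounded_measurableD b3 b4.
have bS : @bounded_measurable _ RR R (fun t => p * cos (phase (m - k) t) + q * cos (phase (m + k) t) +
   (r * sin (phase (m - k) t) + s * sin (phase (m + k) t))).
  exact: bounded_measurableD b12 b34.
transitivity (\int[leb2]_(t in Q) (2^-1 * (p * cos (phase (m - k) t) + q * cos (phase (m + k) t) +
   (r * sin (phase (m - k) t) + s * sin (phase (m + k) t))))).
  apply: eq_Rintegral => t _.
  have -> : phase (m + k) t = phase m t + phase k t.
    by rewrite -[k in m + k]opprK phaseB -[- k]sub0r phaseB /phase /dot /=; ring.
  rewrite phaseB cosB cosD sinB sinD /wave /p /q /r /s.
  by field; rewrite ?pnatr_eq0.
rewrite (bm_integralZl (mu := leb2) mQ fQ) //; congr (_ * _).
rewrite (bm_integralD (mu := leb2) mQ fQ) // (bm_integralD (mu := leb2) mQ fQ) //.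
rewrite [X in _ + X = _](bm_integralD (mu := leb2) mQ fQ) //.
rewrite !(bm_integralZl (mu := leb2) mQ fQ); try exact: bm_cos_phase1; try exact: bm_sin_phase1.
rewrite !integral_torus_cos !integral_torus_sin !mulr0 !addr0.
by rewrite subr_eq0 (eq_sym m k) -[k == - m]addr_eq0 (addrC k m).
Qed.

(** Waves of frequencies other than m and - m are orthogonal to the wave of m,
    whose squared norm is half of a m ^+ 2 + b m ^+ 2 for m != 0; the other half
    is reached if - m is in F too. *)
Lemma integral_trig_poly_sqr_le (F : seq (int * int)) : uniq F ->
  \int[leb2]_(t in Q) ((\sum_(m <- F) wave m t) ^+ 2) <= \sum_(m <- F) (a m ^+ 2 + b m ^+ 2).
Proof.
move=> uF.
have mQ := @measurable_unit_square R; have fQ := @unit_square_finite R.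
have -> : \int[leb2]_(t in Q) ((\sum_(m <- F) wave m t) ^+ 2) =
    \sum_(m <- F) \sum_(k <- F) \int[leb2]_(t in Q) (wave m t * wave k t).
  under eq_Rintegral do rewrite expr2 mulr_suml.
  rewrite (bm_integral_sum (mu := leb2) mQ fQ); last first.
    move=> m; apply: bounded_measurableM; first exact: bm_wave.
    by apply: bounded_measurable_sum => k; exact: bm_wave.
  apply: eq_bigr => m _; under eq_Rintegral do rewrite mulr_sumr.
  rewrite (bm_integral_sum (mu := leb2) mQ fQ) // => k.
  by apply: bounded_measurableM; exact: bm_wave.
rewrite big_seq [leRHS]big_seq; apply: ler_sum => m mF.
under eq_bigr do rewrite integral_wave_wave.
rewrite -mulr_sumr big_split /=.
have pick (f : int * int -> R) (l : int * int) :
    \sum_(k <- F) f k * (k == l)%:R = if l \in F then f l else 0.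
  under eq_bigr do rewrite mulr_natr mulrb.
  rewrite -big_mkcond /=; case: ifPn => [lF|lF]; first exact: big_pred1_uniq.
  by rewrite big_seq_cond big1 // => k /andP[kF /eqP kl]; rewrite kl (negbTE lF) in kF.
rewrite !pick mF aN bN.
have := sqr_ge0 (a m); have := sqr_ge0 (b m).
by case: ifP => _; rewrite !expr2; lra.
Qed.

End Bessel.

(** * The discrepancy at a fixed dilation *)

Section Discrepancy.
Context {R : realType}.
Local Notation leb2 := (@lebesgue_measure R \x @lebesgue_measure R)%E.
Local Notation RR := (measurableTypeR R * measurableTypeR R)%type.
Local Notation Q := (@unit_square R).
Implicit Types (A B C : set (R * R)) (x y u : R * R) (m : int * int).
Local Open Scope quotient_scope.

(** Real part, and imaginary part up to the sign, of the Fourier transform of the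
    indicator function of B at l m. *)
Definition cos_transform B m (l : R) : R := \int[leb2]_(y in B) cos (l * phase m y).
Definition sin_transform B m (l : R) : R := \int[leb2]_(y in B) sin (l * phase m y).

Lemma phaseN m x : phase (- m) x = - phase m x :> R.
Proof. by rewrite -sub0r phaseB /phase /dot /=; ring. Qed.

Lemma cos_transformN B m l : cos_transform B (- m) l = cos_transform B m l.
Proof. by apply: eq_Rintegral => y _; rewrite phaseN mulrN cosN. Qed.

Lemma sin_transformN B m l : measurable (B : set RR) -> (leb2 B < +oo)%E -> sin_transform B (- m) l = - sin_transform B m l.
Proof.
move=> mB fB; rewrite /sin_transform -[RHS]mulN1r -(bm_integralZl (mu := leb2) mB fB); last exact: bm_sin_phase.
by apply: eq_Rintegral => y _; rewrite phaseN mulrN sinN mulN1r.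
Qed.

Lemma integral_periodization_cos B K (l : R) u m : measurable (B : set RR) -> (leb2 B < +oo)%E ->
  (forall y, B y -> `|y.1| <= K /\ `|y.2| <= K) -> 0 < l ->
  \int[leb2]_(t in Q) (periodization (dilate l B) (u - t) * cos (phase m t)) =
  l ^+ 2 * (cos (phase m u) * cos_transform B m l + sin (phase m u) * sin_transform B m l).
Proof.
move=> mB fB hB l0.
rewrite (integral_periodization u mB fB hB l0 (bm_cos_phase1 m) (lattice_periodic_phase m (@cosD2pi R))).
congr (_ * _); rewrite /cos_transform /sin_transform -!(bm_integralZl (mu := leb2) mB fB); try exact: bm_cos_phase; try exact: bm_sin_phase.
rewrite -(bm_integralD (mu := leb2) mB fB); last 2 first.
- by apply: bounded_measurableM; [exact: bounded_measurable_cst|exact: bm_cos_phase].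
- by apply: bounded_measurableM; [exact: bounded_measurable_cst|exact: bm_sin_phase].
by apply: eq_Rintegral => y _; rewrite phase_sub phase_scale cosB.
Qed.

Lemma integral_periodization_sin B K (l : R) u m : measurable (B : set RR) -> (leb2 B < +oo)%E ->
  (forall y, B y -> `|y.1| <= K /\ `|y.2| <= K) -> 0 < l ->
  \int[leb2]_(t in Q) (periodization (dilate l B) (u - t) * sin (phase m t)) =
  l ^+ 2 * (sin (phase m u) * cos_transform B m l - cos (phase m u) * sin_transform B m l).
Proof.
move=> mB fB hB l0.
rewrite (integral_periodization u mB fB hB l0 (bm_sin_phase1 m) (lattice_periodic_phase m (@sinD2pi R))).
congr (_ * _); rewrite /cos_transform /sin_transform -!(bm_integralZl (mu := leb2) mB fB); try exact: bm_cos_phase; try exact: bm_sin_phase.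
rewrite -(bm_integralB (mu := leb2) mB fB); last 2 first.
- by apply: bounded_measurableM; [exact: bounded_measurable_cst|exact: bm_cos_phase].
- by apply: bounded_measurableM; [exact: bounded_measurable_cst|exact: bm_sin_phase].
by apply: eq_Rintegral => y _; rewrite phase_sub phase_scale sinB.
Qed.

(** Let g be the part of the Fourier series of the counting function with
    frequencies in F, and D the discrepancy. Bessel's inequality is used in the
    form D^2 >= 2 D g - g^2, where kappa disappears from the integral since g has
    mean 0. The integral of the counting function of C times g is that of the
    counting function of the closure, because the functions for the interior and
    for the closure enclose the one for C and have equal integrals. *)
Lemma discrepancy_fourier C (P : {fset torus R}) (l kappa : R) (F : seq (int * int)) :
  planar_convex_body C -> 0 < l -> uniq F -> 0 \notin F ->
  ((\sum_(m <- F) l ^+ 4 * (cos_transform (closure C) m l ^+ 2 + sin_transform (closure C) m l ^+ 2) *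
      power [seq repr v | v <- P] m)%:E <=
   torus_integral (fun t : torus R =>
     (`|card_translate P (dilate l C) t - kappa| ^+ 2)%:E))%E.
Proof.
move=> bC l0 uF F0.
have [cC boC _] := bC.
have [K K0 hK] := closure_bounded_box boC.
set B := closure C; pose E := C°.
have mB : measurable (B : set RR) := measurable_closure C.
have mE : measurable (E : set RR) := measurable_interior C.
have EC : E `<=` C := @interior_subset _ C.
have CB : C `<=` B := @subset_closure _ C.
have hKE y : E y -> `|y.1| <= K /\ `|y.2| <= K by move=> /EC /CB /hK.
have fB : (leb2 B < +oo)%E := closure_finite boC.
have fE : (leb2 E < +oo)%E by rewrite -body_boundary_null.
have mQ := @measurable_unit_square R; have fQ := @unit_square_finite R.
set us := [seq repr v | v <- P].
pose a m := l ^+ 2 * ((\sum_(u <- us) cos (phase m u)) * cos_transform B m l + (\sum_(u <- us) sin (phase m u)) * sin_transform B m l).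
pose b m := l ^+ 2 * ((\sum_(u <- us) sin (phase m u)) * cos_transform B m l - (\sum_(u <- us) cos (phase m u)) * sin_transform B m l).
have aN m : a (- m) = a m.
  rewrite /a cos_transformN sin_transformN //.
  under eq_bigr do rewrite phaseN cosN.
  under [X in _ + X * _]eq_bigr do rewrite phaseN sinN.
  by rewrite sumrN mulrNN.
have bN m : b (- m) = - b m.
  rewrite /b cos_transformN sin_transformN //.
  under eq_bigr do rewrite phaseN sinN.
  under [X in _ - X * _]eq_bigr do rewrite phaseN cosN.
  by rewrite sumrN; ring.
pose g t := \sum_(m <- F) wave a b m t.
have bg : @bounded_measurable _ RR R g.
  by apply: bounded_measurable_sum => m; exact: bm_wave.
have [mg [G hG]] := bg.
pose n A t := \sum_(u <- us) periodization (dilate l A) (u - t) : R.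
have n_bm A : measurable (A : set RR) -> (forall y, A y -> `|y.1| <= K /\ `|y.2| <= K) ->
    exists2 f, @bounded_measurable _ RR R f & forall t, Q t -> n A t = f t.
  move=> mA hA; rewrite /n; elim: (us) => [|u s [f bf hf]].
    by exists (fun=> 0) => [|t _]; [exact: bounded_measurable_cst | rewrite big_nil].
  have [f' bf' hf'] := periodization_bounded_measurable u mA hA l0.
  exists (fun t => f' t + f t) => [|t Qt]; first exact: bounded_measurableD.
  by rewrite big_cons hf' // hf.
have [nB bnB nBE] := n_bm B mB hK; have [nE bnE nEE] := n_bm E mE hKE.
have n_int A f : measurable (A : set RR) -> (leb2 A < +oo)%E ->
    (forall y, A y -> `|y.1| <= K /\ `|y.2| <= K) ->
    @bounded_measurable _ RR R f ->
    \int[leb2]_(t in Q) (n A t * f t) = \sum_(u <- us) \int[leb2]_(t in Q) (periodization (dilate l A) (u - t) * f t).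
  move=> mA fA hA bf.
  pose p u := sval (cid2 (periodization_bounded_measurable u mA hA l0)).
  have bp u : @bounded_measurable _ RR R (p u) by rewrite /p; case: cid2.
  have hp u t : Q t -> periodization (dilate l A) (u - t) = p u t.
    by rewrite /p; case: cid2 => q /= _; exact.
  transitivity (\int[leb2]_(t in Q) (\sum_(u <- us) p u t * f t)).
    apply: eq_Rintegral => t /set_mem Qt; rewrite /n mulr_suml.
    by apply: eq_bigr => u _; rewrite hp.
  rewrite (bm_integral_sum (mu := leb2) mQ fQ); last by move=> u; exact: bounded_measurableM.
  by apply: eq_bigr => u _; apply: eq_Rintegral => t /set_mem Qt; rewrite hp.
have int_cos m : \int[leb2]_(t in Q) (nB t * cos (phase m t)) = a m.
  transitivity (\int[leb2]_(t in Q) (n B t * cos (phase m t))).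
    by apply: eq_Rintegral => t /set_mem Qt; rewrite nBE.
  rewrite n_int //; last exact: bm_cos_phase1.
  under eq_bigr do rewrite (integral_periodization_cos _ _ mB fB hK l0).
  by rewrite -mulr_sumr big_split /= -!mulr_suml.
have int_sin m : \int[leb2]_(t in Q) (nB t * sin (phase m t)) = b m.
  transitivity (\int[leb2]_(t in Q) (n B t * sin (phase m t))).
    by apply: eq_Rintegral => t /set_mem Qt; rewrite nBE.
  rewrite n_int //; last exact: bm_sin_phase1.
  under eq_bigr do rewrite (integral_periodization_sin _ _ mB fB hK l0).
  by rewrite -mulr_sumr sumrB /= -!mulr_suml.
have int_diff : \int[leb2]_(t in Q) (nB t - nE t) = 0.
  rewrite (bm_integralB (mu := leb2) mQ fQ) //.
  have cnt A : measurable (A : set RR) -> (leb2 A < +oo)%E ->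
      (forall y, A y -> `|y.1| <= K /\ `|y.2| <= K) ->
      \int[leb2]_(t in Q) n A t = \sum_(u <- us) l ^+ 2 * fine (leb2 A).
    move=> mA fA hA.
    transitivity (\int[leb2]_(t in Q) (n A t * 1)); first by apply: eq_Rintegral => t _; rewrite mulr1.
    rewrite n_int //; last exact: bounded_measurable_cst.
    apply: eq_bigr => u _; rewrite (integral_periodization u mA fA hA l0) //; last exact: bounded_measurable_cst.
    by rewrite Rintegral_cst // mul1r.
  have -> : \int[leb2]_(t in Q) nB t = \int[leb2]_(t in Q) n B t.
    by apply: eq_Rintegral => t /set_mem Qt; rewrite nBE.
  have -> : \int[leb2]_(t in Q) nE t = \int[leb2]_(t in Q) n E t.
    by apply: eq_Rintegral => t /set_mem Qt; rewrite nEE.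
  by rewrite !cnt // body_boundary_null // subrr.
have int_g : \int[leb2]_(t in Q) g t = 0.
  rewrite /g (bm_integral_sum (mu := leb2) mQ fQ); last by move=> m; exact: bm_wave.
  rewrite big_seq big1 // => m mF.
  have m0 : m == 0 = false by apply: contraNF F0 => /eqP <-.
  have b1 : @bounded_measurable _ RR R (fun t => a m * cos (phase m t)).
    by apply: bounded_measurableM; [exact: bounded_measurable_cst|exact: bm_cos_phase1].
  have b2 : @bounded_measurable _ RR R (fun t => b m * sin (phase m t)).
    by apply: bounded_measurableM; [exact: bounded_measurable_cst|exact: bm_sin_phase1].
  rewrite /wave (bm_integralD (mu := leb2) mQ fQ) // !(bm_integralZl (mu := leb2) mQ fQ);
    try exact: bm_cos_phase1; try exact: bm_sin_phase1.
  by rewrite integral_torus_cos integral_torus_sin m0 !mulr0 addr0.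
have int_nBg : \int[leb2]_(t in Q) (nB t * g t) = \sum_(m <- F) (a m ^+ 2 + b m ^+ 2).
  under eq_Rintegral do rewrite /g mulr_sumr.
  rewrite (bm_integral_sum (mu := leb2) mQ fQ); last first.
    by move=> m; apply: bounded_measurableM => //; exact: bm_wave.
  apply: eq_bigr => m _.
  have bc : @bounded_measurable _ RR R (fun t => nB t * cos (phase m t)).
    by apply: bounded_measurableM => //; exact: bm_cos_phase1.
  have bs : @bounded_measurable _ RR R (fun t => nB t * sin (phase m t)).
    by apply: bounded_measurableM => //; exact: bm_sin_phase1.
  transitivity (\int[leb2]_(t in Q) (a m * (nB t * cos (phase m t)) + b m * (nB t * sin (phase m t)))).
    by apply: eq_Rintegral => t _; rewrite /wave; ring.
  rewrite (bm_integralD (mu := leb2) mQ fQ); last 2 first.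
  - by apply: bounded_measurableM => //; exact: bounded_measurable_cst.
  - by apply: bounded_measurableM => //; exact: bounded_measurable_cst.
  by rewrite !(bm_integralZl (mu := leb2) mQ fQ) // int_cos int_sin.
(* A measurable lower bound for the squared discrepancy, which follows from
   nE <= n C <= nB and `|g| <= G. *)
pose r t := (2 * (nB t * g t - G * (nB t - nE t)) - 2 * kappa * g t) - g t ^+ 2.
have br1 : @bounded_measurable _ RR R (fun t => nB t * g t) by exact: bounded_measurableM.
have br2 : @bounded_measurable _ RR R (fun t => nB t - nE t) by exact: bounded_measurableB.
have br3 : @bounded_measurable _ RR R (fun t => G * (nB t - nE t)).
  by apply: bounded_measurableM => //; exact: bounded_measurable_cst.
have br4 : @bounded_measurable _ RR R (fun t => nB t * g t - G * (nB t - nE t)) by exact: bounded_measurableB.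
have br5 : @bounded_measurable _ RR R (fun t => 2 * (nB t * g t - G * (nB t - nE t))).
  by apply: bounded_measurableM => //; exact: bounded_measurable_cst.
have br6 : @bounded_measurable _ RR R (fun t => 2 * kappa * g t).
  by apply: bounded_measurableM => //; exact: bounded_measurable_cst.
have br7 : @bounded_measurable _ RR R (fun t => g t ^+ 2).
  under eq_fun do rewrite expr2; exact: bounded_measurableM.
have br8 : @bounded_measurable _ RR R (fun t => 2 * (nB t * g t - G * (nB t - nE t)) - 2 * kappa * g t).
  exact: bounded_measurableB.
have br : @bounded_measurable _ RR R r by exact: bounded_measurableB.
have hr : \sum_(m <- F) (a m ^+ 2 + b m ^+ 2) <= \int[leb2]_(t in Q) r t.
  rewrite /r (bm_integralB (mu := leb2) mQ fQ) // (bm_integralB (mu := leb2) mQ fQ) //.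
  rewrite (bm_integralZl (mu := leb2) mQ fQ) // (bm_integralB (mu := leb2) mQ fQ) //.
  rewrite !(bm_integralZl (mu := leb2) mQ fQ) // int_diff int_g int_nBg !mulr0 !subr0.
  have := integral_trig_poly_sqr_le aN bN uF.
  rewrite -/(g _); lra.
apply: (@le_trans _ _ (\int[leb2]_(t in Q) r t)%:E).
  rewrite lee_fin; apply: le_trans hr; rewrite le_eqVlt; apply/orP; left; apply/eqP.
  apply: eq_bigr => m _; rewrite /a /b /power; ring.
rewrite /torus_integral; apply: (bm_integral_le_nonneg (mu := leb2) mQ fQ) => // t Qt.
rewrite lee_fin real_normK ?num_real // card_translate_pi.
have -> : \sum_(v <- P) periodization (dilate l C) (repr v - t) = n C t.
  by rewrite /n /us big_map.
have dS (A A' : set (R * R)) : A `<=` A' -> dilate l A `<=` dilate l A'.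
  by move=> AA' _ [y Ay <-]; exists y => //; exact: AA'.
have n1 : n C t <= n B t.
  by apply: ler_sum => u _; apply: (le_periodization u hK l0 _ _ Qt) => //; exact: dS.
have n2 : n E t <= n C t.
  by apply: ler_sum => u _; apply: (le_periodization u hK l0 _ _ Qt) => //; exact: dS.
move: n1 n2; rewrite nBE // nEE // /r; move: (hG t); rewrite ler_norml => /andP[].
move: (n C t) (nB t) (nE t) (g t) => c p q z h1 h2 h3 h4.
have := sqr_ge0 (c - kappa - z); nra.
Qed.

End Discrepancy.

(** * Averaging over the dilation *)

Section Fubini.
Context d1 d2 (T1 : measurableType d1) (T2 : measurableType d2) (R : realType).
Variables (mu1 : {sigma_finite_measure set T1 -> \bar R})
          (mu2 : {sigma_finite_measure set T2 -> \bar R}).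
Variables (D1 : set T1) (D2 : set T2).
Hypotheses (mD1 : measurable D1) (mD2 : measurable D2).
Hypotheses (fD1 : (mu1 D1 < +oo)%E) (fD2 : (mu2 D2 < +oo)%E).
Variable f : T1 * T2 -> R.
Hypothesis bf : @bounded_measurable _ (T1 * T2)%type R f.

Lemma bounded_measurable_pair2 (x : T1) : bounded_measurable (fun y => f (x, y)).
Proof.
case: bf => mf [K hK]; split; last by exists K => y; exact: hK.
exact: measurable_fun_pair2.
Qed.

Lemma bounded_measurable_pair1 (y : T2) : bounded_measurable (fun x => f (x, y)).
Proof.
case: bf => mf [K hK]; split; last by exists K => x; exact: hK.
exact: measurable_fun_pair1.
Qed.

Let G (z : T1 * T2) : \bar R := (\1_D1 z.1 * \1_D2 z.2 * f z)%:E.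

Let iG : (mu1 \x mu2)%E.-integrable setT G.
Proof.
have mD : measurable (D1 `*` D2) by exact: measurableX.
have fD : ((mu1 \x mu2) (D1 `*` D2) < +oo)%E.
  rewrite product_measure1E //; apply: lte_mul_pinfty => //.
  by rewrite ge0_fin_numE.
have := bounded_measurable_integrable mD fD bf.
move/(integrable_mkcond _ mD); congr (_.-integrable _ _); apply/funext => -[x y].
rewrite /G /patch in_setX !indicE /=.
by case: (x \in D1); case: (y \in D2); rewrite ?mul1r ?mul0r.
Qed.

Let GE x : (\int[mu2]_y G (x, y) = (\1_D1 x * \int[mu2]_(y in D2) f (x, y))%:E)%E.
Proof.
have b2 := bounded_measurable_pair2 x.
rewrite EFinM -(bm_integral_fin (mu := mu2) mD2 fD2 b2).
rewrite [X in (_ * X)%E]integral_mkcond -integralZl //; last first.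
  by apply/(integrable_mkcond _ mD2)/bounded_measurable_integrable.
apply: eq_integral => y _; rewrite /G /patch !indicE /=.
by case: (y \in D2); rewrite ?mulr1 ?mulr0 ?mul0r ?mule0.
Qed.

Let GE2 y : (\int[mu1]_x G (x, y) = (\1_D2 y * \int[mu1]_(x in D1) f (x, y))%:E)%E.
Proof.
have b1 := bounded_measurable_pair1 y.
rewrite EFinM -(bm_integral_fin (mu := mu1) mD1 fD1 b1).
rewrite [X in (_ * X)%E]integral_mkcond -integralZl //; last first.
  by apply/(integrable_mkcond _ mD1)/bounded_measurable_integrable.
apply: eq_integral => x _; rewrite /G /patch !indicE /=.
by case: (x \in D1); rewrite ?mul1r ?mul0r ?mule0.
Qed.

Lemma bm_fubini : \int[mu1]_(x in D1) \int[mu2]_(y in D2) f (x, y) =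
  \int[mu2]_(y in D2) \int[mu1]_(x in D1) f (x, y).
Proof.
have patchE' T (D : set T) (h : T -> R) x : (h \_ D) x = \1_D x * h x.
  by rewrite /patch indicE; case: (x \in D); rewrite ?mul1r ?mul0r.
rewrite [LHS]Rintegral_mkcond [RHS]Rintegral_mkcond /Rintegral; congr fine.
under eq_integral do rewrite patchE' -GE.
under [RHS]eq_integral do rewrite patchE' -GE2.
exact: Fubini.
Qed.

Lemma bounded_measurable_integral :
  bounded_measurable (fun x => \1_D1 x * \int[mu2]_(y in D2) f (x, y)).
Proof.
split.
  apply/measurable_EFinP; have := measurable_fubini_F iG.
  by congr measurable_fun; apply/funext => x; exact: GE.
have [mf [K hK]] := bf; exists (K * fine (mu2 D2)) => x.
have b2 := bounded_measurable_pair2 x.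
apply: (@le_trans _ _ `|\int[mu2]_(y in D2) f (x, y)|).
  by rewrite normrM ler_piMl // indicE; case: (_ \in _); rewrite ?normr1 ?normr0.
rewrite -Rintegral_cst // ler_norml -mulN1r.
rewrite -(bm_integralZl (mu := mu2) mD2 fD2); last exact: bounded_measurable_cst.
have bN : @bounded_measurable _ T2 R (fun=> -1 * K) by exact: bounded_measurable_cst.
have bK : @bounded_measurable _ T2 R (fun=> K) by exact: bounded_measurable_cst.
by apply/andP; split; apply: (le_bm_integral (mu := mu2)) => // y _;
  have := hK (x, y); rewrite ler_norml ?mulN1r => /andP[].
Qed.
End Fubini.

Section Spectral.
Context {R : realType}.
Local Notation leb := (@lebesgue_measure R).
Local Notation leb2 := (@lebesgue_measure R \x @lebesgue_measure R)%E.
Local Notation RR := (measurableTypeR R * measurableTypeR R)%type.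
Local Notation I := (`[0, 1]%classic : set (measurableTypeR R)).
Implicit Types (m : int * int).

Lemma plane_sigma_finite : sigma_finite [set: RR] leb2.
Proof.
pose S (n : nat) : set (measurableTypeR R) := `[- n%:R, n%:R]%classic.
exists (fun n => S n `*` S n).
  apply/seteqP; split=> // -[x y] _.
  pose n := (Num.trunc (`|x| + `|y|)).+1.
  have nE : `|x| + `|y| <= n%:R.
    by have /truncn_itv/andP[_ /ltW//] : 0 <= `|x| + `|y| by rewrite addr_ge0.
  have hx := normr_ge0 x; have hy := normr_ge0 y.
  by exists n => //; split; rewrite /S /= in_itv /= -ler_norml; lra.
move=> n; have mS : measurable (S n) by exact: measurable_itv.
split; first exact: measurableX.
rewrite product_measure1E //= /S !lebesgue_measure_itv /=.
by case: ifP => _; rewrite ?mul0e // -EFinB -EFinM ltry.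
Qed.

(** The area together with its sigma-finiteness, so that it can be a factor of a
    further product measure. *)
Definition plane_measure : set RR -> \bar R := leb2.
HB.instance Definition _ := Measure.copy plane_measure leb2.
HB.instance Definition _ :=
  Measure_isSigmaFinite.Build _ _ _ plane_measure plane_sigma_finite.

Let fI : (leb I < +oo)%E.
Proof. by rewrite lebesgue_measure_itv /= lte_fin ltr01 -EFinB ltry. Qed.

(** sin x / x is the mean of cos (x t) over t in [0, 1]. *)
Lemma norm_sin_le (x : R) : `|sin x| <= `|x|.
Proof.
have [->|x0] := eqVneq x 0; first by rewrite sin0.
have b : @bounded_measurable _ (measurableTypeR R) R (fun t : R => cos (x * t + 0)).
  by apply: bounded_measurable_cos; exact: measurable_affine.
have e : \int[leb]_(t in I) cos (x * t + 0) = sin x / x.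
  by rewrite integral_cos_affine // addr0 sin0 subr0.
have h : `|sin x / x| <= 1.
  rewrite -e; apply: le_trans (le_normr_Rintegral _ _) _ => //.
    exact: bounded_measurable_integrable.
  apply: (@le_trans _ _ (\int[leb]_(t in I) 1)).
    apply: le_Rintegral => //.
    + apply: bounded_measurable_integrable => //; case: b => mb [K hK].
      split; first exact: measurableT_comp.
      by exists K => t; rewrite normr_id.
    + by apply: bounded_measurable_integrable => //; exact: bounded_measurable_cst.
    + by move=> t _; exact: cos_max.
  rewrite Rintegral_cst // mul1r /= lebesgue_measure_itv /= lte_fin ltr01 /=.
  by rewrite subr0.
by move: h; rewrite normrM normfV ler_pdivrMr ?mul1r // normr_gt0.
Qed.

Variables (B : set (R * R)).
Hypotheses (mB : measurable (B : set RR)) (fB : (leb2 B < +oo)%E).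

(** The real part of the transform after multiplication by e^(i l psi), which
    moves the origin of the phase, weighted by sin^3 (pi l). *)
Definition weighted_transform m (psi l : R) : R :=
  sin (pi * l) ^+ 3 * (cos (l * psi) * cos_transform B m l - sin (l * psi) * sin_transform B m l).

Lemma weighted_transform_integral m psi l : weighted_transform m psi l =
  \int[leb2]_(y in B) (sin (pi * l) ^+ 3 * cos (l * (phase m y + psi))).
Proof.
have bc := bm_cos_phase m l; have bs := bm_sin_phase m l.
rewrite /weighted_transform /cos_transform /sin_transform -!(bm_integralZl (mu := leb2) mB fB) //.
have cst (c : R) : @bounded_measurable _ RR R (fun=> c) by exact: bounded_measurable_cst.
rewrite -(bm_integralB (mu := leb2) mB fB); [|exact: bounded_measurableM..].
rewrite -(bm_integralZl (mu := leb2) mB fB); last first.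
  by apply: bounded_measurableB; exact: bounded_measurableM.
by apply: eq_Rintegral => y _; rewrite (mulrDr l) cosD; ring.
Qed.

Let bm_integrand m psi : @bounded_measurable _ (measurableTypeR R * RR)%type R
  (fun z => sin (pi * z.1) ^+ 3 * cos (z.1 * (phase m z.2 + psi))).
Proof.
apply: bounded_measurableM; last first.
  apply: bounded_measurable_cos; apply: measurable_funM => //.
  by apply: measurable_funD => //; apply: (measurableT_comp (measurable_phase m)).
have b : @bounded_measurable _ (measurableTypeR R * RR)%type R (fun z => sin (pi * z.1)).
  by apply: bounded_measurable_sin; apply: measurable_funM.
under eq_fun do rewrite exprSr expr2; apply: bounded_measurableM => //.
exact: bounded_measurableM.
Qed.

Lemma bm_weighted_transform m psi :
  @bounded_measurable _ (measurableTypeR R) R (fun l => \1_I l * weighted_transform m psi l).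
Proof.
have := @bounded_measurable_integral _ _ (measurableTypeR R) RR R leb plane_measure I B (measurable_itv _) mB fI fB _ (bm_integrand m psi).
by congr bounded_measurable; apply/funext => l; rewrite weighted_transform_integral.
Qed.

(** By Fubini's theorem the integral over l comes first and is the kernel. The
    phase pi (7/2 - 2 a) makes the level m . y = a correspond to the point 7/2,
    from which the kernel is nonnegative. *)
Lemma integral_weighted_transform m a :
  \int[leb]_(l in I) (\1_I l * weighted_transform m (pi * (7 / 2 - 2 * a)) l) =
  \int[leb2]_(y in B) kernel (2 * (dot (lattice_point m) y - a) + 7 / 2).
Proof.
set psi := pi * _.
transitivity (\int[leb]_(l in I) \int[leb2]_(y in B) (sin (pi * l) ^+ 3 * cos (l * (phase m y + psi)))).
  apply: eq_Rintegral => l lI; rewrite weighted_transform_integral indicE lI mul1r.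
  by [].
have fub := @bm_fubini _ _ (measurableTypeR R) RR R leb plane_measure I B (measurable_itv _) mB fI fB _ (bm_integrand m psi).
transitivity (\int[plane_measure]_(y in B) \int[leb]_(l in I) (sin (pi * l) ^+ 3 * cos (l * (phase m y + psi)))).
  exact: fub.
apply: eq_Rintegral => y _; rewrite /kernel; apply: eq_Rintegral => l _ /=.
by congr (_ * cos _); rewrite /psi /phase; field.
Qed.

(** The inequality 2 X Y - Y^2 <= X^2 for X = l^2 F, where F is the rotated real
    part of the transform, and Y = c sin^3(pi l) / l^2; here Y is at most
    c pi^2 in absolute value as |sin (pi l)| is at most 1 and at most pi l. *)
Lemma spectral_pointwise m psi1 psi2 (c l : R) : 0 <= c -> 0 <= l ->
  2 * c * ((weighted_transform m psi1 l + weighted_transform m psi2 l) / 2) - c ^+ 2 * pi ^+ 4 <=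
  l ^+ 4 * (cos_transform B m l ^+ 2 + sin_transform B m l ^+ 2).
Proof.
move=> c0 l0; rewrite /weighted_transform.
have key psi : 2 * c * (sin (pi * l) ^+ 3 * (cos (l * psi) * cos_transform B m l - sin (l * psi) * sin_transform B m l))
    - c ^+ 2 * pi ^+ 4 <= l ^+ 4 * (cos_transform B m l ^+ 2 + sin_transform B m l ^+ 2).
  set p := cos_transform B m l; set q := sin_transform B m l; set F := _ * p - _ * q; set s := sin (pi * l).
  have hF : F ^+ 2 <= p ^+ 2 + q ^+ 2.
    rewrite /F; have := cos2Dsin2 (l * psi).
    move: (cos _) (sin _) => x y xy.
    have : 0 <= (x * q + y * p) ^+ 2 by exact: sqr_ge0.
    have : (x * p - y * q) ^+ 2 + (x * q + y * p) ^+ 2 = (x ^+ 2 + y ^+ 2) * (p ^+ 2 + q ^+ 2) by ring.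
    rewrite xy; lra.
  have s1 : s ^+ 2 <= 1.
    by have := cos2Dsin2 (pi * l); have := sqr_ge0 (cos (pi * l)); rewrite -/s; lra.
  have sl : s ^+ 2 <= (pi * l) ^+ 2.
    by rewrite -[leLHS]real_normK ?num_real // -[leRHS]real_normK ?num_real // ler_pXn2r ?nnegrE // norm_sin_le.
  have s6 : s ^+ 6 <= pi ^+ 4 * l ^+ 4.
    rewrite (_ : s ^+ 6 = s ^+ 2 * (s ^+ 2) ^+ 2); last by ring.
    rewrite (_ : pi ^+ 4 * l ^+ 4 = 1 * ((pi * l) ^+ 2) ^+ 2); last by ring.
    by apply: ler_pM; rewrite ?sqr_ge0 // ler_pXn2r ?nnegrE ?sqr_ge0.
  have [l00|ln0] := eqVneq l 0.
    have s0 : s = 0 by rewrite /s l00 mulr0 sin0.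
    rewrite s0 [in leRHS]l00 !expr0n /= !mul0r mulr0 sub0r oppr_le0.
    by rewrite mulr_ge0 ?sqr_ge0 // exprn_ge0 // pi_ge0.
  have lp : 0 < l by rewrite lt_neqAle eq_sym ln0.
  have h4 : 0 < l ^+ 4 by rewrite exprn_gt0.
  (* (l^2 F - c s^3 / l^2)^2 >= 0 *)
  have sq : 0 <= (l ^+ 2 * F - c * s ^+ 3 / l ^+ 2) ^+ 2 by exact: sqr_ge0.
  have e : (l ^+ 2 * F - c * s ^+ 3 / l ^+ 2) ^+ 2 =
     l ^+ 4 * F ^+ 2 - 2 * c * (s ^+ 3 * F) + c ^+ 2 * (s ^+ 6 / l ^+ 4) by field.
  have h6 : s ^+ 6 / l ^+ 4 <= pi ^+ 4 by rewrite ler_pdivrMr.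
  have h7 : c ^+ 2 * (s ^+ 6 / l ^+ 4) <= c ^+ 2 * pi ^+ 4 by rewrite ler_wpM2l ?sqr_ge0.
  have h8 : l ^+ 4 * F ^+ 2 <= l ^+ 4 * (p ^+ 2 + q ^+ 2) by rewrite ler_pM2l.
  lra.
have := key psi1; have := key psi2; lra.
Qed.

End Spectral.

(** * Strips and chords *)

Section Strip.
Context {R : realType}.
Local Notation leb := (@lebesgue_measure R).
Local Notation leb2 := (@lebesgue_measure R \x @lebesgue_measure R)%E.
Local Notation RR := (measurableTypeR R * measurableTypeR R)%type.
Implicit Types (A C : set (R * R)) (Theta x y : R * R).

(** The rotation that takes (1, 0) to Theta. *)
Definition frame Theta (s t : R) : R * R :=
  (Theta.1 * s - Theta.2 * t, Theta.2 * s + Theta.1 * t).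

Lemma frame_dot Theta x : dot Theta Theta = 1 ->
  frame Theta (dot x Theta) (dot x (- Theta.2, Theta.1)) = x.
Proof.
rewrite /dot /frame /= => h; rewrite [x in RHS]surjective_pairing; congr pair.
  by rewrite -[RHS]mul1r -h; ring.
by rewrite -[RHS]mul1r -h; ring.
Qed.

Lemma measurable_frame Theta :
  measurable_fun [set: RR] ((fun z : R * R => frame Theta z.1 z.2) : RR -> RR).
Proof.
by apply: measurable_fun_pair; [apply: measurable_funB|apply: measurable_funD];
  apply: measurable_funM.
Qed.

Lemma measurable_frame_section A Theta s : measurable (A : set RR) ->
  measurable ([set t | A (frame Theta s t)] : set (measurableTypeR R)).
Proof.
move=> mA; rewrite -[X in measurable X]setTI.
have m2 : measurable_fun [set: measurableTypeR R] ((fun t : R => frame Theta s t) : _ -> RR).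
  by apply: measurable_fun_pair; [apply: measurable_funB|apply: measurable_funD] => //;
    apply: measurable_funM.
exact: m2.
Qed.

(** A rotation with negative cosine is the central symmetry followed by one with
    positive cosine. *)
Lemma ge0_integral_frame (f : R * R -> \bar R) Theta : dot Theta Theta = 1 ->
  measurable_fun [set: RR] f -> (forall x, 0 <= f x)%E ->
  (\int[leb2]_x f x = \int[leb2]_x f (frame Theta x.1 x.2))%E.
Proof.
rewrite /dot -!expr2 => T1 mf f0; have [c0|c0] := leP 0 Theta.1.
  exact: ge0_integral_rotation.
have m1 : (-1 : R) != 0 by rewrite oppr_eq0 oner_eq0.
have mN : measurable_fun [set: RR] (fun x : R * R => f (0 + (-1) *: x)).
  exact: (measurableT_comp mf (measurable_homothety 0 (-1))).
rewrite (ge0_integral_homothety 0 m1 mf f0) sqrrN expr1n mul1e.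
rewrite (@ge0_integral_rotation _ (fun x => f (0 + (-1) *: x)%R) (- Theta.1) (- Theta.2)) ?sqrrN //; last lra.
by apply: eq_integral => x _; congr f; rewrite add0r scaleN1r /frame /=; congr pair => /=; ring.
Qed.

Lemma area_frame A Theta (a : R) : dot Theta Theta = 1 -> measurable (A : set RR) ->
  (leb2 A = \int[leb]_s leb [set t | A (frame Theta (a + s) t)])%E.
Proof.
move=> T1 mA.
have mI : measurable_fun [set: RR] (fun x => (\1_A x)%:E : \bar R).
  by apply/measurable_EFinP; exact: measurable_indic.
have mF : measurable_fun [set: RR] (fun x : R * R => (\1_A (frame Theta x.1 x.2))%:E : \bar R).
  exact: (measurableT_comp mI (measurable_frame Theta)).
have I0 (x : R * R) : (0 <= (\1_A x)%:E :> \bar R)%E by rewrite lee_fin indicE.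
have -> : leb2 A = (\int[leb2]_x (\1_A x)%:E)%E by rewrite integral_indic // setIT.
rewrite (ge0_integral_frame T1 mI I0) (fubini_tonelli1 _ mF) //.
have mG := measurable_fun_fubini_tonelli_F (m2 := leb) _ mF (fun x => I0 _).
have G0 s : (0 <= fubini_F leb (fun x : R * R => (\1_A (frame Theta x.1 x.2))%:E) s)%E.
  by apply: integral_ge0 => t _; exact: I0.
rewrite (ge0_integral_affine a (oner_neq0 R) mG G0).
rewrite normr1 mul1e; apply: eq_integral => s _; rewrite /fubini_F /= mul1r addrC.
have -> : (fun t : R => (\1_A (frame Theta (a + s) t))%:E : \bar R) =
    (fun t : R => (\1_[set t | A (frame Theta (a + s) t)] t)%:E).
  by apply/funext => t; rewrite !indicE; congr ((nat_of_bool _)%:R%:E); apply/idP/idP => /set_mem h; apply/mem_set.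
by rewrite integral_indic ?setIT //; exact: measurable_frame_section.
Qed.

Definition strip C Theta (w : R) : set (R * R) :=
  [set y | closure C y /\ 0 <= dot y Theta - inf [set dot y Theta | y in C] <= w].

Lemma measurable_dot Theta : measurable_fun [set: RR] ((fun y => dot y Theta) : RR -> R).
Proof. by rewrite /dot; apply: measurable_funD; apply: measurable_funM. Qed.

Lemma measurable_strip C Theta w : measurable (strip C Theta w : set RR).
Proof.
pose a := inf [set dot y Theta | y in C].
have m := measurable_dot Theta measurableT (measurable_itv `[a, a + w]).
rewrite setTI in m; have := measurableI _ _ (measurable_closure C) m.
congr measurable; apply/seteqP; split=> y [h1] /=; rewrite -/a in_itv /= => /andP[h2 h3];
  by split=> //; apply/andP; split; lra.
Qed.

(** By convexity a chord is an interval of its line, hence measurable, and it is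
    contained in the section of the strip by that line. *)
Lemma chord_length_le C Theta (d w : R) : convex_set C -> dot Theta Theta = 1 -> 0 <= d <= w ->
  (chord_length C Theta d <=
   leb [set t | strip C Theta w (frame Theta (inf [set dot y Theta | y in C] + d) t)])%E.
Proof.
move=> cC T1 dw; rewrite /chord_length; set a := inf _.
apply: le_measure; rewrite ?inE.
- apply: is_interval_measurable => _ _ [x [Cx xd] <-] [y [Cy yd] <-] z /andP[xz zy].
  set p := dot x _ in xz *; set q := dot y _ in zy *.
  have [pq|pq] := eqVneq p q; first by exists x => //; rewrite -/p; lra.
  have pq' : p < q by rewrite lt_neqAle pq /=; lra.
  pose l := (q - z) / (q - p).
  have l01 : 0 <= l <= 1.
    by rewrite divr_ge0 ?ler_pdivrMr /= ?mul1r; lra.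
  exists (l *: x + (1 - l) *: y); last first.
    transitivity (l * p + (1 - l) * q); first by rewrite /p /q /dot /= /GRing.scale /=; ring.
    by rewrite /l; field; lra.
  split; first exact: convex_setP.
  transitivity (l * dot x Theta + (1 - l) * dot y Theta).
    by rewrite /dot /= /GRing.scale /=; ring.
  by rewrite xd yd -/a; ring.
- apply: measurable_frame_section; exact: measurable_strip.
- move=> _ [x [Cx xd] <-] /=.
  rewrite -/a in xd; rewrite -xd frame_dot //; split; first exact: subset_closure.
  by rewrite xd -/a addrAC subrr add0r.
Qed.

Lemma measurable_section_length A Theta (a : R) : measurable (A : set RR) ->
  measurable_fun [set: measurableTypeR R]
    (fun s : R => leb [set t | A (frame Theta (a + s) t)]).
Proof.
move=> mA.
have mf : measurable_fun [set: RR] ((fun z : R * R => frame Theta (a + z.1) z.2) : RR -> RR).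
  by apply: measurable_fun_pair; [apply: measurable_funB|apply: measurable_funD];
    apply: measurable_funM => //; apply: measurable_funD.
have mS := mf measurableT A mA; rewrite setTI in mS.
have := measurable_fun_xsection leb mS.
congr measurable_fun; apply/funext => s /=; congr (leb _).
by apply/seteqP; split=> t; rewrite /xsection /= inE.
Qed.

(** By Cavalieri's principle the area of a strip is the integral of the lengths
    of its sections, which are at least the chord lengths. *)
Lemma strip_areas C Theta (v w K : R) : convex_set C -> dot Theta Theta = 1 ->
  0 <= v <= w -> 0 <= K ->
  (forall d, v <= d <= w -> (K%:E <= chord_length C (- Theta)%R d + chord_length C Theta d)%E) ->
  ((K * (w - v))%:E <= leb2 (strip C (- Theta)%R w) + leb2 (strip C Theta w))%E.
Proof.
move=> cC T1 /andP[v0 vw] K0 hK.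
have TN : dot (- Theta) (- Theta) = 1 by rewrite -T1 /dot /=; ring.
pose a T := inf [set dot y T | y in C].
rewrite (@area_frame _ _ (a (- Theta)) TN (measurable_strip _ _ _)).
rewrite (@area_frame _ _ (a Theta) T1 (measurable_strip _ _ _)).
have mh T : measurable_fun [set: measurableTypeR R]
    (fun s : R => leb [set t | strip C T w (frame T (a T + s) t)]).
  exact: measurable_section_length (measurable_strip _ _ _).
rewrite -ge0_integralD //=.
have mI : measurable (`[v, w]%classic : set (measurableTypeR R)) by [].
apply: (@le_trans _ _ (\int[leb]_(s in `[v, w]) K%:E)%E).
  rewrite integral_cst //= lebesgue_measure_itv /= lte_fin.
  case: ltP => [_|wv]; first by rewrite -EFinB -EFinM.
  by rewrite mule0 lee_fin (_ : w = v) ?subrr ?mulr0 //; lra.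
rewrite integral_mkcond; apply: le_integral_nonneg => s _.
  by rewrite patchE; case: ifP => //; rewrite lee_fin.
rewrite patchE; case: ifPn => [/set_mem|_]; last exact: adde_ge0.
rewrite /= in_itv /= => vsw; apply: le_trans (hK s vsw) _.
by apply: leeD; apply: chord_length_le => //; lra.
Qed.
End Strip.

(** * The averaged transform and the chords *)

Section Ends.
Context {R : realType}.
Local Notation leb := (@lebesgue_measure R).
Local Notation leb2 := (@lebesgue_measure R \x @lebesgue_measure R)%E.
Local Notation RR := (measurableTypeR R * measurableTypeR R)%type.
Local Notation I := (`[0, 1]%classic : set (measurableTypeR R)).
Implicit Types (A C : set (R * R)) (Theta x y : R * R) (m : int * int).

Lemma unit_vector_le1 Theta : dot Theta Theta = 1 -> `|Theta.1| <= 1 /\ `|Theta.2| <= 1.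
Proof.
rewrite /dot -!expr2 => T1.
by split; rewrite ler_norml; apply/andP; split; nra.
Qed.

Lemma dot_dist_le Theta x y : dot Theta Theta = 1 ->
  `|dot x Theta - dot y Theta| <= `|x.1 - y.1| + `|x.2 - y.2|.
Proof.
move=> /unit_vector_le1[t1 t2].
rewrite (_ : _ - _ = (x.1 - y.1) * Theta.1 + (x.2 - y.2) * Theta.2); last by rewrite /dot; ring.
apply: le_trans (ler_normD _ _) _; rewrite !normrM.
by apply: lerD; rewrite ler_piMr.
Qed.

Lemma inf_dot_le C Theta y : bounded_set C -> dot Theta Theta = 1 -> closure C y ->
  inf [set dot y Theta | y in C] <= dot y Theta.
Proof.
move=> bC T1 Cy; have [K K0 hK] := closure_bounded_box bC.
set a := inf _.
have lb : has_lbound [set dot y Theta | y in C].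
  exists (- (K + K)) => _ [x /subset_closure /hK[h1 h2] <-].
  have := dot_dist_le x 0 T1; rewrite /dot /= !mul0r addr0 !subr0 ler_norml => /andP[h _].
  lra.
rewrite leNgt; apply/negP => ya.
pose e := (a - dot y Theta) / 2; have e0 : 0 < e by rewrite divr_gt0 // subr_gt0.
have [c [Cc [/= h1 h2]]] := Cy _ (nbhsx_ballx y e e0).
have ac : a <= dot c Theta by apply: ge_inf => //; exists c.
have := dot_dist_le c y T1; rewrite (distrC c.1) (distrC c.2) => h.
have := ler_norm (dot c Theta - dot y Theta).
rewrite /ball /= in h1 h2; rewrite /e in h1 h2; lra.
Qed.

(** With a the minimum of dot y Theta, the argument of the kernel is
    2 M (dot y Theta - a) + 7/2. It is at least 7/2 on the whole body and at most
    9/2 in the strip of width 1 / (2 M), where the kernel is at least 1/200. *)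
Lemma kernel_integral_ge C m Theta (M : R) : planar_convex_body C ->
  dot Theta Theta = 1 -> 0 < M -> lattice_point m = M *: Theta ->
  200^-1 * fine (leb2 (strip C Theta (2 * M)^-1)) <=
  \int[leb2]_(y in closure C)
     kernel (2 * (dot (lattice_point m) y - M * inf [set dot y Theta | y in C]) + 7 / 2).
Proof.
move=> [cC bC _] T1 M0 mM; set a := inf _.
have mB := measurable_closure C; have fB := closure_finite bC.
have mS := measurable_strip C Theta (2 * M)^-1.
pose k y := kernel (2 * (dot (lattice_point m) y - M * a) + 7 / 2).
have zE y : 2 * (dot (lattice_point m) y - M * a) + 7 / 2 = 2 * M * (dot y Theta - a) + 7 / 2.
  by rewrite mM /dot /= /GRing.scale /=; ring.
have fI : (leb I < +oo)%E.
  by rewrite lebesgue_measure_itv /= lte_fin ltr01 -EFinB ltry.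
have bk : @bounded_measurable _ RR R (fun y => \1_(closure C) y * k y).
  have bf : @bounded_measurable _ (RR * measurableTypeR R)%type R
     (fun z => sin (pi * z.2) ^+ 3 * cos (pi * (2 * (dot (lattice_point m) z.1 - M * a) + 7 / 2) * z.2)).
    apply: bounded_measurableM.
      have b : @bounded_measurable _ (RR * measurableTypeR R)%type R (fun z => sin (pi * z.2)).
        by apply: bounded_measurable_sin; apply: measurable_funM.
      under eq_fun do rewrite exprSr expr2; apply: bounded_measurableM => //.
      exact: bounded_measurableM.
    apply: bounded_measurable_cos; apply: measurable_funM => //; apply: measurable_funM => //.
    apply: measurable_funD => //; apply: measurable_funM => //; apply: measurable_funB => //.
    apply: measurable_funD; apply: measurable_funM => //.
      exact: (measurableT_comp measurable_fst measurable_fst).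
    exact: (measurableT_comp measurable_snd measurable_fst).
  exact: (@bounded_measurable_integral _ _ RR (measurableTypeR R) R plane_measure leb
    (closure C) I mB (measurable_itv _) fB fI _ bf).
have bS : @bounded_measurable _ RR R (\1_(strip C Theta (2 * M)^-1)).
  exact: bounded_measurable_indic.
have SB : strip C Theta (2 * M)^-1 `<=` closure C by move=> y [].
have -> : 200^-1 * fine (leb2 (strip C Theta (2 * M)^-1)) =
   \int[leb2]_(y in closure C) (200^-1 * \1_(strip C Theta (2 * M)^-1) y).
  rewrite (bm_integralZl (mu := leb2) mB fB) //; congr (_ * _).
  rewrite /Rintegral integral_indic //; congr (fine (leb2 _)).
  by apply/esym/setIidl.
have -> : \int[leb2]_(y in closure C) k y = \int[leb2]_(y in closure C) (\1_(closure C) y * k y).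
  by apply: eq_Rintegral => y yB; rewrite indicE yB mul1r.
apply: (le_bm_integral (mu := leb2) mB fB) => //.
  by apply: bounded_measurableM => //; exact: bounded_measurable_cst.
move=> y yB; rewrite [\1_(closure C) y]indicE mem_set // mul1r /k zE.
have ay : 0 <= dot y Theta - a by rewrite subr_ge0 inf_dot_le.
have z0 : 0 <= 2 * M * (dot y Theta - a) by rewrite mulr_ge0 // mulr_ge0 // ltW.
rewrite indicE; case: (boolP (y \in _)) => [/set_mem[_ /andP[_ h]]|_] /=; last first.
  by rewrite mulr0; apply: kernel_ge0; lra.
rewrite mulr1 -div1r; apply: kernel_ge; apply/andP; split; first lra.
have : 2 * M * (dot y Theta - a) <= 2 * M * (2 * M)^-1 by rewrite ler_wpM2l // mulr_ge0 // ltW.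
rewrite mulfV; first lra.
by rewrite mulf_neq0 // gt_eqF.
Qed.

Lemma weighted_transformN (B : set (R * R)) m (psi l : R) : measurable (B : set RR) -> (leb2 B < +oo)%E ->
  weighted_transform B (- m) psi l = weighted_transform B m (- psi) l.
Proof.
by move=> mB fB; rewrite /weighted_transform cos_transformN sin_transformN // !mulrN cosN sinN; ring.
Qed.

Lemma inv_le_inv (M : R) : 0 < M -> 0 <= (4 * M)^-1 <= (2 * M)^-1.
Proof.
move=> M0; apply/andP; split; first by rewrite invr_ge0; lra.
by rewrite lef_pV2 ?posrE; lra.
Qed.

Lemma average_arith (k f1 f2 i1 i2 : R) : 200^-1 * f1 <= i1 -> 200^-1 * f2 <= i2 ->
  k <= f2 + f1 -> 400^-1 * k <= 2^-1 * (i1 + i2).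
Proof. lra. Qed.

(** The two phases belong to the two ends of the body in the directions Theta and
    - Theta, and their average controls the sum of the areas of both end strips.
    The constant is 1600 = 2 * 200 * 4: half the bound for the kernel, and
    1 / (2 M) - 1 / (4 M) = 1 / (4 M). *)
Lemma spectral_weight C m Theta (M K : R) : planar_convex_body C ->
  dot Theta Theta = 1 -> 0 < M -> lattice_point m = M *: Theta -> 0 <= K ->
  (forall d, (4 * M)^-1 <= d <= (2 * M)^-1 ->
     (K%:E <= chord_length C (- Theta)%R d + chord_length C Theta d)%E) ->
  exists psi1 psi2, K / (1600 * M) <=
    \int[leb]_(l in I) (\1_I l * ((weighted_transform (closure C) m psi1 l +
       weighted_transform (closure C) m psi2 l) / 2)).
Proof.
move=> bC T1 M0 mM K0 hK; have [cC boC _] := bC.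
have mB := measurable_closure C; have fB := closure_finite boC.
have TN : dot (- Theta) (- Theta) = 1 by rewrite -T1 /dot /=; ring.
have mN : lattice_point (- m) = M *: (- Theta).
  by rewrite scalerN -mM /lattice_point /=; congr pair; rewrite /= rmorphN.
have h1 := kernel_integral_ge bC T1 M0 mM.
have h2 := kernel_integral_ge bC TN M0 mN.
set a1 := M * inf _ in h1; set a2 := M * inf _ in h2.
exists (pi * (7 / 2 - 2 * a1)), (- (pi * (7 / 2 - 2 * a2))).
rewrite -(integral_weighted_transform mB fB) in h1; rewrite -(integral_weighted_transform mB fB) in h2.
have fI : (leb I < +oo)%E.
  by rewrite lebesgue_measure_itv /= lte_fin ltr01 -EFinB ltry.
set psi1 := pi * _ in h1 *; set psi2 := pi * _ in h2 *.
have b1 := bm_weighted_transform mB fB m psi1.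
have b2 := bm_weighted_transform mB fB (- m) psi2.
have -> : \int[leb]_(l in I) (\1_I l * ((weighted_transform (closure C) m psi1 l +
       weighted_transform (closure C) m (- psi2) l) / 2)) =
   \int[leb]_(l in I) (2^-1 * (\1_I l * weighted_transform (closure C) m psi1 l +
       \1_I l * weighted_transform (closure C) (- m) psi2 l)).
  by apply: eq_Rintegral => l _; rewrite weighted_transformN //; field.
have mI : measurable I by exact: measurable_itv.
rewrite (bm_integralZl (mu := leb) mI fI); last exact: bounded_measurableD.
rewrite (bm_integralD (mu := leb) mI fI) //.
have vw := inv_le_inv M0.
have := strip_areas cC T1 vw K0 hK.
have fS T : (leb2 (strip C T (2 * M)^-1) \is a fin_num).
  rewrite ge0_fin_numE //; apply: le_lt_trans fB; apply: le_measure; rewrite ?inE //.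
    exact: measurable_strip.
  by move=> y [].
rewrite -(fineK (fS Theta)) -(fineK (fS (- Theta))) -EFinD lee_fin => h3.
rewrite (_ : K / (1600 * M) = 400^-1 * (K * ((2 * M)^-1 - (4 * M)^-1))); last first.
  by field; rewrite gt_eqF.
exact: average_arith h1 h2 h3.
Qed.
End Ends.

(** * Frequencies in a cone *)

Section Directions.
Context {R : realType}.
Implicit Types (Theta x y : R * R) (k m : int * int).

Definition norm2 x : R := Num.sqrt (dot x x).

Lemma dot_ge0 x : 0 <= dot x x.
Proof. by rewrite /dot -!expr2 addr_ge0 ?sqr_ge0. Qed.

Lemma norm2_sqr x : norm2 x ^+ 2 = dot x x.
Proof. by rewrite /norm2 sqr_sqrtr ?dot_ge0. Qed.

Lemma norm2_lattice0 : norm2 (lattice_point 0) = 0.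
Proof. by rewrite /norm2 /dot /= !mulr0 addr0 sqrtr0. Qed.

Lemma norm2_gt0 x : x != 0 -> 0 < norm2 x.
Proof.
move=> x0; rewrite /norm2 sqrtr_gt0 lt_neqAle dot_ge0 andbT eq_sym.
rewrite /dot -!expr2 paddr_eq0 ?sqr_ge0 // !sqrf_eq0.
by apply: contra x0 => /andP[/eqP h1 /eqP h2]; rewrite [x]surjective_pairing h1 h2.
Qed.

Lemma dot_unit x : x != 0 -> dot ((norm2 x)^-1 *: x) ((norm2 x)^-1 *: x) = 1.
Proof.
move=> /norm2_gt0 n0; transitivity ((norm2 x)^-1 ^+ 2 * dot x x).
  by rewrite /dot /= /GRing.scale /=; ring.
by rewrite -norm2_sqr exprVn mulVf // expf_neq0 // gt_eqF.
Qed.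

Lemma direction_exists Theta : dot Theta Theta = 1 ->
  exists2 t : R, - pi < t < pi & Theta = direction t \/ Theta = - direction t.
Proof.
have key (c s : R) : c ^+ 2 + s ^+ 2 = 1 -> 0 <= c ->
    exists2 t : R, - pi < t < pi & (c, s) = direction t.
  move=> cs c0; have s1 : -1 <= s <= 1 by apply/andP; split; nra.
  exists (asin s).
    have := asin_geNpi2 s1; have := asin_lepi2 s1; have := pi_gt0 R; lra.
  rewrite /direction asinK ?in_itv //= cos_asin //; congr pair.
  by rewrite -[LHS]ger0_norm // -sqrtr_sqr; congr Num.sqrt; lra.
rewrite /dot -!expr2; case: Theta => c s /= cs; have [c0|c0] := leP 0 c.
  by have [t tp e] := key c s cs c0; exists t => //; left.
have [||t tp e] := key (- c) (- s); [by rewrite !sqrrN|lra|].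
by exists t => //; right; rewrite -e; congr pair; rewrite /= opprK.
Qed.

(** The angle from direction om to x is atan (q / p), where p and q are the
    coordinates of x along direction om and across it. *)
Lemma cone_direction x (om t eta : R) : 0 < t -> atan t <= eta ->
  let p := dot x (direction om) in let q := dot x (- (direction om).2, (direction om).1) in
  0 < p -> `|q| <= t * p ->
  exists2 phi, `|phi| <= eta & x = norm2 x *: direction (om + phi).
Proof.
move=> t0 te p q p0 qp.
have r1 : `|q / p| <= t by rewrite normrM normfV (gtr0_norm p0) ler_pdivrMr.
exists (atan (q / p)).
  move: r1; rewrite !ler_norml => /andP[h1 h2]; apply/andP; split.
    by rewrite lerNl -atanN (le_trans _ te) // le_atan // lerNl.
  by rewrite (le_trans _ te) // le_atan.
have dE : dot x x = p ^+ 2 + q ^+ 2.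
  rewrite /p /q /direction /dot /=; have := cos2Dsin2 om.
  move: (cos om) (sin om) => c s cs.
  transitivity ((c ^+ 2 + s ^+ 2) * (x.1 * x.1 + x.2 * x.2)); first by rewrite cs mul1r.
  by ring.
have nE : norm2 x = p * Num.sqrt (1 + (q / p) ^+ 2).
  have pE : p = Num.sqrt (p ^+ 2) by rewrite sqrtr_sqr gtr0_norm.
  rewrite [X in _ = X * _]pE -sqrtrM ?sqr_ge0 // /norm2 dE; congr Num.sqrt.
  by field; rewrite gt_eqF.
have s0 : Num.sqrt (1 + (q / p) ^+ 2) != 0.
  by rewrite gt_eqF // sqrtr_gt0; have := sqr_ge0 (q / p); lra.
have cE : norm2 x * cos (atan (q / p)) = p by rewrite cos_atan nE mulfK.
have sE : norm2 x * sin (atan (q / p)) = q.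
  have ca : cos (atan (q / p)) != 0 by rewrite cos_atan invr_eq0.
  have := atanK (q / p); rewrite /tan => /(congr1 ( *%R^~ (cos (atan (q / p))))).
  by rewrite /= mulfVK // => ->; rewrite mulrCA cE mulfVK // gt_eqF.
move: cE sE; move: (atan (q / p)) => phi cE sE.
rewrite /direction cosD sinD [LHS]surjective_pairing; congr pair; rewrite /GRing.scale /=.
  transitivity (p * cos om - q * sin om); last by rewrite -cE -sE; ring.
  rewrite /p /q /dot /direction /=; have := cos2Dsin2 om; move: (cos om) (sin om) => c s cs.
  by rewrite -[LHS]mul1r -cs; ring.
transitivity (p * sin om + q * cos om); last by rewrite -cE -sE; ring.
rewrite /p /q /dot /direction /=; have := cos2Dsin2 om; move: (cos om) (sin om) => c s cs.
by rewrite -[LHS]mul1r -cs; ring.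
Qed.

(** The product of the Gaussian integers T k.1 + i k.2 and v: a stretch of the
    first axis, which narrows a cone around it, followed by a similarity, which
    turns it towards v. *)
Definition stretch (v : int * int) (T : nat) k : int * int :=
  (T%:Z * k.1 * v.1 - k.2 * v.2, T%:Z * k.1 * v.2 + k.2 * v.1).

Lemma stretchB v T k m : stretch v T (k - m) = stretch v T k - stretch v T m.
Proof. by rewrite /stretch /=; congr pair; rewrite /=; ring. Qed.

Lemma dot_stretch v T k : dot (lattice_point (stretch v T k)) (lattice_point (stretch v T k)) =
  dot (lattice_point v) (lattice_point v) * (T%:R ^+ 2 * k.1%:~R ^+ 2 + k.2%:~R ^+ 2) :> R.
Proof.
rewrite /dot /stretch /= !(intrD, intrM, rmorphN) /= -[T%:~R]/(T%:R).
by ring.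
Qed.

(** v is the integer part of a long vector L direction om, so its direction is
    close to om, and a large T makes the image of the cone narrow. Both errors
    are measured by the tangent t of the permitted angle. *)
Lemma stretch_in_cone (om eta M0 : R) : 0 < eta -> 0 < M0 ->
  exists (v : int * int) (T : nat), [/\ (0 < T)%N, M0 <= norm2 (lattice_point v) &
    forall k, k != 0 -> `|k.2| <= 2 * `|k.1| ->
      exists2 phi, `|phi| <= eta &
        lattice_point (stretch v T k) = norm2 (lattice_point (stretch v T k)) *: direction (om + phi) \/
        lattice_point (stretch v T k) = norm2 (lattice_point (stretch v T k)) *: - direction (om + phi)].
Proof.
move=> eta0 M00.
pose eta' := Num.min eta (pi / 4).
have pi0 := pi_gt0 R.
have e'0 : 0 < eta' by rewrite lt_min eta0 /=; lra.
have e'p : eta' <= pi / 4 by rewrite ge_min lexx orbT.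
pose t := tan eta'.
have te : atan t <= eta.
  by rewrite /t tanK ?ge_min ?lexx // in_itv /=; apply/andP; split; lra.
have t0 : 0 < t.
  rewrite -tan0 /t ltr_tan // in_itv /=; apply/andP; split; lra.
have t1 : t <= 1.
  rewrite -tan_piquarter /t leNgt ltr_tan -?leNgt // in_itv /=; apply/andP; split; lra.
pose L := 2 + 8 / t + M0.
pose v := (Num.floor (L * cos om), Num.floor (L * sin om)).
pose T := (Num.trunc (16 / t)).+1.
have Tt : 16 <= T%:R * t.
  have /truncn_itv/andP[_ /ltW] : 0 <= 16 / t by rewrite divr_ge0 // ltW.
  by rewrite ler_pdivrMr.
have [A0 AM BA] : [/\ 0 < dot (lattice_point v) (direction om),
   M0 <= dot (lattice_point v) (direction om) &
   `|dot (lattice_point v) (- sin om, cos om)| <= t / 4 * dot (lattice_point v) (direction om)].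
  have := cos2Dsin2 om; rewrite /dot /direction /=.
  have := floor_itv (L * cos om); have := floor_itv (L * sin om); rewrite !intrD /=.
  move: ((Num.floor (L * cos om))%:~R : R) ((Num.floor (L * sin om))%:~R : R) => x y.
  have := cos_le1 om; have := cos_geN1 om; have := sin_le1 om; have := sin_geN1 om.
  move: (cos om) (sin om) => c s h1 h2 h3 h4 hy hx cs.
  have [e1 e1E] : exists e, e = L * c - x by eexists.
  have [e2 e2E] : exists e, e = L * s - y by eexists.
  have e11 : 0 <= e1 <= 1 by lra.
  have e21 : 0 <= e2 <= 1 by lra.
  have xE : x = L * c - e1 by lra.
  have yE : y = L * s - e2 by lra.
  have aE : x * c + y * s = L - (e1 * c + e2 * s).
    by rewrite xE yE -[L in RHS]mulr1 -cs; ring.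
  have bE : x * - s + y * c = e1 * s - e2 * c by rewrite xE yE; ring.
  have h5 : e1 * c + e2 * s <= 2 by nra.
  have h6 : `|e1 * s - e2 * c| <= 2 by rewrite ler_norml; apply/andP; split; nra.
  have t8 : 8 / t > 0 by rewrite divr_gt0.
  have tt : t / 4 * (8 / t) = 2 by field; rewrite gt_eqF.
  rewrite aE bE; split; [rewrite /L; lra|rewrite /L; lra|].
  apply: le_trans h6 _; rewrite -tt ler_pM2l; last lra.
  by rewrite /L; lra.
have T0N : (0 < T)%N by [].
clearbody v T t; exists v, T; split=> //.
  apply: le_trans AM _; rewrite -[leLHS]gtr0_norm // -sqrtr_sqr /norm2 ler_sqrt ?dot_ge0 //.
  rewrite /dot /direction /=; have := cos2Dsin2 om; move: (cos om) (sin om) => c s cs.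
  move: (v.1%:~R : R) (v.2%:~R : R) => a b.
  rewrite -[leRHS]mulr1 -cs; have := sqr_ge0 (a * s - b * c); nra.
have key k : 0 < k.1 -> `|k.2| <= 2 * k.1 -> exists2 phi, `|phi| <= eta &
    lattice_point (stretch v T k) = norm2 (lattice_point (stretch v T k)) *: direction (om + phi).
  move=> k1 k2.
  have k1R : 0 < k.1%:~R :> R by rewrite ltr0z.
  have k2R : `|k.2%:~R| <= 2 * k.1%:~R :> R.
    by rewrite -intr_norm -[2]/(2%:~R) -intrM ler_int.
  set A := dot (lattice_point v) (direction om) in A0 AM BA.
  set Bq := dot (lattice_point v) (- sin om, cos om) in BA.
  have pE : dot (lattice_point (stretch v T k)) (direction om) = T%:R * k.1%:~R * A - k.2%:~R * Bq.
    by rewrite /A /Bq /dot /direction /stretch /= !(intrD, intrM, rmorphN) /= -[T%:~R]/(T%:R); ring.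
  have qE : dot (lattice_point (stretch v T k)) (- (direction om).2, (direction om).1) =
      T%:R * k.1%:~R * Bq + k.2%:~R * A.
    by rewrite /A /Bq /dot /direction /stretch /= !(intrD, intrM, rmorphN) /= -[T%:~R]/(T%:R); ring.
  have T0 : 0 < T%:R :> R by rewrite ltr0n.
  clearbody A Bq; clear AM.
  move: k1R k2R pE qE; move: k.1%:~R k.2%:~R T%:R T0 Tt => a b T' T0 Tt a0 ba pE qE.
  have bB : `|b * Bq| <= 2 * a * (t / 4 * A).
    by rewrite normrM ler_pM.
  have bA : `|b * A| <= 2 * a * A by rewrite normrM (gtr0_norm A0) ler_pM2r.
  have aB : `|T' * a * Bq| <= T' * a * (t / 4 * A).
    by rewrite normrM gtr0_norm ?mulr_gt0 // ler_pM2l ?mulr_gt0.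
  have aA : 0 < a * A by exact: mulr_gt0.
  have TaA : 16 * (a * A) <= T' * t * (a * A) by rewrite ler_pM2r.
  have taA : t * (a * A) <= a * A by rewrite ler_piMl // ltW.
  have t2aA : t * (t * (a * A)) <= a * A.
    by apply: (le_trans _ taA); rewrite ler_pM2l // taA.
  apply: (cone_direction t0 te).
    have TaA' : 16 * (a * A) <= T' * (a * A).
      apply: le_trans TaA _; rewrite ler_pM2r // ler_piMr //; exact: ltW.
    rewrite pE; move: bB; rewrite ler_norml => /andP[_ h]; lra.
  rewrite pE qE; apply: le_trans (ler_normD _ _) _.
  have := ler_norm (t * (b * Bq)); rewrite normrM (gtr0_norm t0).
  have : t * `|b * Bq| <= t * (2 * a * (t / 4 * A)) by rewrite ler_pM2l.
  lra.
move=> k k0 k21.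
have [k1|k1] := ltP 0 k.1.
  have [|phi h1 h2] := key k k1; first by rewrite (gtr0_norm k1) in k21.
  by exists phi => //; left.
have k1' : k.1 < 0.
  rewrite lt_neqAle k1 andbT; apply: contraNneq k0 => e.
  by move: k21; rewrite e normr0 mulr0 normr_le0 => /eqP e2; rewrite [k]surjective_pairing e e2.
have [| |phi h1 h2] := key (- k); first by rewrite /= oppr_gt0.
  by rewrite /= normrN (ltr0_norm k1') in k21 *.
exists phi => //; right.
have eN : lattice_point (stretch v T (- k)) = - lattice_point (stretch v T k) :> R * R.
  have -> : stretch v T (- k) = - stretch v T k by rewrite /stretch; congr pair; rewrite /=; ring.
  by rewrite /lattice_point; congr pair; rewrite /= rmorphN.
have nN : norm2 (- lattice_point (stretch v T k)) = norm2 (lattice_point (stretch v T k)).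
  by rewrite /norm2; congr Num.sqrt; rewrite /dot /=; ring.
by move: h2; rewrite eN nN scalerN => <-; rewrite opprK.
Qed.

End Directions.

(** * The weights of the frequencies *)

Section Assembly.
Context {R : realType}.
Local Notation leb := (@lebesgue_measure R).
Local Notation I01 := (`[0, 1]%classic : set (measurableTypeR R)).
Implicit Types (C : set (R * R)) (Theta : R * R) (k m : int * int).

Lemma interval_center (J : interval R) : (0 < leb [set` J])%E ->
  exists om eta : R, 0 < eta /\ forall phi, `|phi| <= eta -> om + phi \in J.
Proof.
move=> J0.
have [x [y [xJ yJ xy]]] : exists x y : R, [/\ x \in J, y \in J & x < y].
  apply: contrapT => nxy.
  have [[x xJ]|nJ] := pselect (exists x, x \in J); last first.
    have J00 : [set` J] = set0.
      by apply/seteqP; split=> // z /= zJ; exfalso; apply: nJ; exists z.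
    by move: J0; rewrite J00 measure0 ltxx.
  have J1 : [set` J] = [set x].
    apply/seteqP; split=> z /=; last by move=> ->.
    move=> zJ; apply: contrapT => /eqP zx.
    by have [h|h] := ltP x z; apply: nxy; [exists x, z|exists z, x]; split=> //; rewrite lt_neqAle zx.
  by move: J0; rewrite J1 lebesgue_measure_set1 ltxx.
exists ((x + y) / 2), ((y - x) / 2); split; first lra.
move=> phi; rewrite ler_norml => h.
apply: (@interval_is_interval _ J x y xJ yJ); apply/andP; split; lra.
Qed.

Lemma leb01 : leb I01 = 1%E.
Proof. by rewrite lebesgue_measure_itv /= lte_fin ltr01 -EFinB subr0. Qed.

Lemma ratio_le (kap a b f : R) : 0 < kap -> 0 < a -> 0 < f -> f <= a * b ->
  kap / a <= kap / f * b.
Proof.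
move=> k0 a0 f0 h; rewrite -mulrA ler_pM2l // mulrC ler_pdivlMr // mulrC.
by rewrite ler_pdivrMr // mulrC.
Qed.

Section Weights.
Variables (v : int * int) (T : nat).
Hypotheses (T0 : (0 < T)%N) (v1 : 1 <= norm2 (lattice_point v : R * R)).

Let freq k : R := norm2 (lattice_point (stretch v T k)).
Let A : R := norm2 (lattice_point v) * (T%:R + 2).

Lemma freq_sqr k : freq k ^+ 2 =
  norm2 (lattice_point v) ^+ 2 * (T%:R ^+ 2 * k.1%:~R ^+ 2 + k.2%:~R ^+ 2).
Proof. by rewrite /freq !norm2_sqr dot_stretch. Qed.

Lemma norm2_ge0 (x : R * R) : 0 <= norm2 x. Proof. exact: sqrtr_ge0. Qed.

Lemma freq_ge k : k != 0 -> norm2 (lattice_point v) <= freq k.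
Proof.
move=> k0; rewrite -(@ler_pXn2r _ 2) ?nnegrE ?norm2_ge0 // freq_sqr.
rewrite ler_peMr ?sqr_ge0 //.
have TR : 1 <= T%:R :> R by rewrite ler1n.
have sq (i : int) : i != 0 -> 1 <= i%:~R ^+ 2 :> R.
  move=> i0; rewrite -[1]/(1%:~R) -rmorphXn ler_int.
  have : 0 < i ^+ 2 by rewrite exprn_even_gt0.
  by [].
have [k10|k10] := eqVneq k.1 0.
  have k20 : k.2 != 0.
    by apply: contraNneq k0 => k20; rewrite [k]surjective_pairing k10 k20.
  by rewrite k10 expr0n mulr0 add0r sq.
have := sq _ k10; have := sqr_ge0 (k.2%:~R : R) => h1 h2.
have h3 : 1 <= T%:R ^+ 2 :> R by rewrite exprn_ege1.
have : 1 * 1 <= T%:R ^+ 2 * k.1%:~R ^+ 2 :> R by apply: ler_pM.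
lra.
Qed.

Lemma freq_le k (a b : R) : 0 <= b -> `|k.1|%:~R <= b -> `|k.2|%:~R <= 2 * b ->
  freq k <= A * b.
Proof.
move=> b0 h1 h2; rewrite -(@ler_pXn2r _ 2) ?nnegrE ?norm2_ge0 //; last first.
  by rewrite /A !mulr_ge0 ?norm2_ge0 // addr_ge0 ?ler0n.
rewrite freq_sqr /A !exprMn -mulrA ler_wpM2l ?sqr_ge0 //.
have sq (i : int) (c : R) : `|i|%:~R <= c -> i%:~R ^+ 2 <= c ^+ 2 :> R.
  move=> h; rewrite -[leLHS]real_normK ?num_real // -intr_norm ler_pXn2r ?nnegrE ?ler0z //.
  exact: le_trans h.
have := sq _ _ h1; have := sq _ _ h2 => h3 h4.
have T0' : 0 <= T%:R :> R by exact: ler0n.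
have : T%:R ^+ 2 * k.1%:~R ^+ 2 <= T%:R ^+ 2 * b ^+ 2 :> R by rewrite ler_wpM2l ?sqr_ge0.
rewrite exprMn in h3; have : 0 <= T%:R * b ^+ 2 by rewrite mulr_ge0 ?sqr_ge0.
lra.
Qed.

(** The exponent of the bound for the chords that is available at the frequency
    stretch v T k: inside the cone its direction belongs to I up to the sign. *)
Definition decay (sigma : R) k : R := if `|k.2| <= 2 * `|k.1| then 1 / 2 else sigma.

Definition weight (kappa sigma : R) k : R := kappa / freq k `^ (2 + 2 * decay sigma k).

(** freq k is at most A times a bound for the coordinates of k, and
    A ^+ 4 dominates all the powers of A that come up, as exponents are at most
    4. *)
Lemma weight_ge (kappa sigma : R) : 0 < kappa -> 1 / 2 <= sigma <= 1 ->
  (forall (k : int * int) (B : R), k != 0 -> `|k.1|%:~R <= B -> `|k.2|%:~R <= B ->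
     kappa / A ^+ 4 <= weight kappa sigma k * B `^ (2 + 2 * sigma)) /\
  (forall k : int * int, k != 0 -> `|k.2| <= 2 * `|k.1| ->
     kappa / A ^+ 4 <= weight kappa sigma k * `|k.1|%:~R ^+ 3).
Proof.
move=> kap0 /andP[s1 s2].
have A1 : 1 <= A.
  have T0' : 0 <= T%:R :> R by exact: ler0n.
  have T1 : 1 <= T%:R + 2 :> R by lra.
  by rewrite -[1]mulr1 ler_pM.
have A0 : 0 < A by lra.
have powA (s : R) : s <= 1 -> A `^ (2 + 2 * s) <= A ^+ 4.
  by move=> ss; exact: powR_le_exp4.
have main k (B s : R) : k != 0 -> 0 <= B -> freq k <= A * B -> decay sigma k <= s -> 1 / 2 <= s <= 1 ->
    kappa / A ^+ 4 <= weight kappa sigma k * B `^ (2 + 2 * s).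
  move=> k0 B0 MAB ds /andP[hs1 hs2].
  have M1 : 1 <= freq k := le_trans v1 (freq_ge k0).
  have M0 : 0 < freq k by lra.
  have p1 : freq k `^ (2 + 2 * decay sigma k) <= freq k `^ (2 + 2 * s) by rewrite ler_powR //; lra.
  have p2 : freq k `^ (2 + 2 * s) <= A `^ (2 + 2 * s) * B `^ (2 + 2 * s).
    have AB0 : 0 <= A * B by exact: mulr_ge0 (ltW A0) B0.
    rewrite -powRM ?(ltW A0) //; apply: ge0_ler_powR => //; first lra.
    by rewrite nnegrE ltW.
  have p3 : A `^ (2 + 2 * s) * B `^ (2 + 2 * s) <= A ^+ 4 * B `^ (2 + 2 * s).
    by rewrite ler_wpM2r ?powR_ge0 // powA.
  have pw : 0 < freq k `^ (2 + 2 * decay sigma k) by rewrite powR_gt0.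
  have A4 : 0 < A ^+ 4 by rewrite exprn_gt0.
  rewrite /weight; apply: (ratio_le kap0 A4 pw).
  exact: le_trans p1 (le_trans p2 p3).
split=> k.
  move=> B k0 h1 h2; have B0 : 0 <= B by apply: le_trans h1; rewrite ler0z.
  apply: main => //; [|by rewrite /decay; case: ifP; lra|by apply/andP; split].
  by apply: freq_le => //; lra.
move=> k0 h; have -> : `|k.1|%:~R ^+ 3 = `|k.1|%:~R `^ (2 + 2 * (1 / 2)) :> R.
  rewrite (_ : 2 + 2 * (1 / 2) = 3%:R); last by field.
  by rewrite powR_mulrn // ler0z.
apply: main => //; rewrite ?ler0z //.
- apply: freq_le => //; rewrite ?ler0z //.
  by rewrite -[2]/(2%:~R) -intrM ler_int.
- by rewrite /decay h.
- by apply/andP; split; lra.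
Qed.

End Weights.
End Assembly.

(** * The variance of the discrepancy *)

Section Final.
Context {R : realType}.
Local Notation leb := (@lebesgue_measure R).
Local Notation I01 := (`[0, 1]%classic : set (measurableTypeR R)).
Implicit Types (C : set (R * R)) (Theta : R * R) (k m : int * int).

(** The average of the weighted transforms for the two ends of the body. *)
Definition mean_transform C m (psi1 psi2 l : R) : R :=
  \1_I01 l * ((weighted_transform (closure C) m psi1 l + weighted_transform (closure C) m psi2 l) / 2).

Definition mean_spectrum C m (psi : R * R) : R :=
  \int[leb]_(l in I01) mean_transform C m psi.1 psi.2 l.

Lemma bm_mean_transform C m psi1 psi2 : planar_convex_body C ->
  @bounded_measurable _ (measurableTypeR R) R (mean_transform C m psi1 psi2).
Proof.
move=> [cC boC _]; have mB := measurable_closure C; have fB := closure_finite boC.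
have h p := bm_weighted_transform mB fB m p.
have -> : mean_transform C m psi1 psi2 = (fun l => 2^-1 * (\1_I01 l * weighted_transform (closure C) m psi1 l + \1_I01 l * weighted_transform (closure C) m psi2 l)).
  by apply/funext => l; rewrite /mean_transform; ring.
by apply: bounded_measurableM; [exact: bounded_measurable_cst|exact: bounded_measurableD].
Qed.

(** The Fourier lower bound followed by the pointwise bound at each frequency. For
    l = 0 the left-hand side is nonpositive. *)
Lemma discrepancy_slice C (P : {fset torus R}) (l kappa : R) (G : seq (int * int))
    (m : int * int -> int * int) (psi : int * int -> R * R) (c : int * int -> R) :
  planar_convex_body C -> uniq (map m G) -> 0 \notin map m G ->
  (forall k, k \in G -> 0 <= c k) -> I01 l ->
  ((\sum_(k <- G) power [seq repr v | v <- P] (m k) *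
     (2 * c k * mean_transform C (m k) (psi k).1 (psi k).2 l - c k ^+ 2 * pi ^+ 4))%:E <=
   torus_integral (fun t => (`|card_translate P (dilate l C) t - kappa| ^+ 2)%:E))%E.
Proof.
move=> bC uG nG c0 Il; set us := [seq repr v | v <- P].
have /andP[l0 l1] : 0 <= l <= 1 by move: Il => /=; rewrite in_itv.
have mE k : mean_transform C (m k) (psi k).1 (psi k).2 l =
    (weighted_transform (closure C) (m k) (psi k).1 l + weighted_transform (closure C) (m k) (psi k).2 l) / 2.
  by rewrite /mean_transform indicE mem_set // mul1r.
have pw k := @spectral_pointwise _ (closure C) (m k) (psi k).1 (psi k).2 (c k) l.
have [l00|lp] := eqVneq l 0; last first.
  have lpos : 0 < l by rewrite lt_neqAle eq_sym lp.
  apply: le_trans (discrepancy_fourier P kappa bC lpos uG nG).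
  rewrite lee_fin big_map big_seq [leRHS]big_seq; apply: ler_sum => k kG.
  by rewrite mulrC ler_wpM2r ?power_ge0 // mE; exact: pw _ (c0 _ kG) l0.
apply: (@le_trans _ _ 0%E); last first.
  by apply: integral_ge0 => x _; rewrite lee_fin sqr_ge0.
rewrite lee_fin big_seq; apply: sumr_le0 => k kG.
apply: mulr_ge0_le0; first exact: power_ge0.
by have := pw _ (c0 _ kG) l0; rewrite mE l00 expr0n mul0r.
Qed.

(** c k = b k / pi ^+ 4 maximizes 2 c b - c^2 pi^4, with the maximum
    b^2 / pi^4. *)
Lemma variance_lower_bound C (P : {fset torus R}) (kappa : R -> R) (G : seq (int * int))
    (m : int * int -> int * int) (psi : int * int -> R * R) (b w : int * int -> R) :
  planar_convex_body C -> uniq (map m G) -> 0 \notin map m G ->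
  (forall k, k \in G -> [/\ 0 <= b k,
     b k <= mean_spectrum C (m k) (psi k) &
     w k <= b k ^+ 2 / pi ^+ 4]) ->
  ((\sum_(k <- G) w k * power [seq repr v | v <- P] (m k))%:E <=
   \int[leb]_(l in `[0%R, 1%R]) torus_integral (fun t =>
     (`|card_translate P (dilate l C) t - kappa l| ^+ 2)%:E))%E.
Proof.
move=> bC uG nG hb; set us := [seq repr v | v <- P].
have pi4 : 0 < (pi : R) ^+ 4 by rewrite exprn_gt0 ?pi_gt0.
pose c k := b k / pi ^+ 4.
have c0 k : k \in G -> 0 <= c k by move=> /hb[b0 _ _]; rewrite divr_ge0 // ltW.
pose f k l := power us (m k) * (2 * c k * mean_transform C (m k) (psi k).1 (psi k).2 l - c k ^+ 2 * pi ^+ 4).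
have bt k := bm_mean_transform (m k) (psi k).1 (psi k).2 bC.
have bf k : @bounded_measurable _ (measurableTypeR R) R (f k).
  apply: bounded_measurableM; first exact: bounded_measurable_cst.
  apply: bounded_measurableB; last exact: bounded_measurable_cst.
  by apply: bounded_measurableM => //; exact: bounded_measurable_cst.
have mI : measurable (I01) by exact: measurable_itv.
have fI : (leb I01 < +oo)%E by rewrite leb01 ltry.
apply: (@le_trans _ _ (\int[leb]_(l in I01) \sum_(k <- G) f k l)%:E); last first.
  apply: (bm_integral_le_nonneg (mu := leb) mI fI).
  - by apply: bounded_measurable_sum.
  - by move=> l _; apply: integral_ge0 => x _; rewrite lee_fin sqr_ge0.
  - by move=> l Il; exact: discrepancy_slice.
rewrite lee_fin bm_integral_sum // big_seq [leRHS]big_seq; apply: ler_sum => k kG.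
have [b0 bi wb] := hb _ kG.
rewrite /f bm_integralZl //; last first.
  apply: bounded_measurableB; last exact: bounded_measurable_cst.
  by apply: bounded_measurableM => //; exact: bounded_measurable_cst.
rewrite mulrC ler_wpM2l ?power_ge0 //.
rewrite bm_integralB //; [|by apply: bounded_measurableM => //; exact: bounded_measurable_cst|exact: bounded_measurable_cst].
rewrite bm_integralZl // Rintegral_cst //.
have -> : fine (leb I01) = 1 by rewrite leb01.
rewrite mulr1.
apply: le_trans wb _; rewrite /c.
have h : 2 * (b k / pi ^+ 4) * b k <= 2 * (b k / pi ^+ 4) * mean_spectrum C (m k) (psi k).
  by rewrite ler_wpM2l // mulr_ge0 // divr_ge0 // ltW.
apply: le_trans (lerB h (lexx _)).
have sq (x p : R) : p != 0 -> 2 * (x / p) * x - (x / p) ^+ 2 * p = x ^+ 2 / p.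
  by move=> p0; field.
by rewrite sq // gt_eqF.
Qed.

(** The exponent e is at most 1, so (4 M)^(-e) >= M^(-e) / 4; whence
    6400 = 4 * 1600. *)
Lemma weight_le_sqr (c0 M e : R) : 0 < c0 -> 1 <= M -> 0 <= e <= 1 ->
  (c0 ^+ 2 / (6400 ^+ 2 * pi ^+ 4)) / M `^ (2 + 2 * e) <=
  (c0 * ((4 * M)^-1) `^ e / (1600 * M)) ^+ 2 / pi ^+ 4.
Proof.
move=> c00 M1 /andP[e0 e1]; have M0 : 0 < M by lra.
have pi0 : 0 < (pi : R) by exact: pi_gt0.
have p : 0 < M `^ e by rewrite powR_gt0.
have -> : M `^ (2 + 2 * e) = M ^+ 2 * (M `^ e) ^+ 2.
  rewrite powRD ?(gt_eqF M0) ?implybT // powR_mulrn ?(ltW M0) //; congr (_ * _).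
  by rewrite mulrC powRrM powR_mulrn ?powR_ge0.
have q : 4^-1 / M `^ e <= ((4 * M)^-1) `^ e.
  rewrite invfM powRM ?invr_ge0 ?(ltW M0) //.
  have -> : M^-1 `^ e = (M `^ e)^-1.
    by rewrite -powR_inv1 ?(ltW M0) // -powRrM mulN1r powRN.
  rewrite ler_wpM2r ?invr_ge0 ?(ltW p) //.
  rewrite -[leLHS]powRr1 ?invr_ge0 //; apply: ger_powR => //.
  by apply/andP; split; [rewrite invr_gt0|rewrite invf_le1 // ler1n].
set y := (4 * M)^-1 `^ e in q *; set x := M `^ e in p q *.
have xi : 0 <= x^-1 by rewrite invr_ge0 ltW.
have -> : c0 ^+ 2 / (6400 ^+ 2 * pi ^+ 4) / (M ^+ 2 * x ^+ 2) =
   (c0 * (4^-1 / x) / (1600 * M)) ^+ 2 / pi ^+ 4.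
  have h (c P N z : R) : P != 0 -> N != 0 -> z != 0 ->
      c ^+ 2 / (6400 ^+ 2 * P) / (N ^+ 2 * z ^+ 2) = (c * (4^-1 / z) / (1600 * N)) ^+ 2 / P.
    by move=> P0 N0 z0; field; rewrite P0 N0 z0.
  by rewrite h // gt_eqF // exprn_gt0.
have P4 : 0 <= (pi ^+ 4)^-1 :> R by rewrite invr_ge0 exprn_ge0 // ltW.
rewrite ler_wpM2r //.
have M16 : 0 <= (1600 * M)^-1 by rewrite invr_ge0; exact: mulr_ge0 (ler0n _ _) (ltW M0).
have y0 : 0 <= 4^-1 / x by apply: mulr_ge0 => //; rewrite invr_ge0 ler0n.
move: (4^-1 / x) (1600 * M)^-1 y0 q M16 => u z y0 q z0; have c0' := ltW c00.
have h : c0 * u * z <= c0 * y * z. by rewrite ler_wpM2r // ler_wpM2l.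
have h0 : 0 <= c0 * u * z by rewrite mulr_ge0 // mulr_ge0.
by rewrite ler_pXn2r // nnegrE (le_trans h0 h).
Qed.

Section ChordHypothesis.
Variables (C : set (R * R)) (c1 c2 sigma : R) (J : interval R).
Hypotheses (bC : planar_convex_body C) (c10 : 0 < c1) (c20 : 0 < c2).
Hypotheses (s1 : 1 / 2 <= sigma <= 1).

Definition chord_sum Theta d : \bar R :=
  (chord_length C (- Theta)%R d + chord_length C Theta d)%E.

Lemma chord_sumN Theta d : chord_sum (- Theta) d = chord_sum Theta d.
Proof. by rewrite /chord_sum opprK addeC. Qed.

Definition chord_lower_bounds d :=
    (forall theta : R, theta \in J ->
      ((c1 * d `^ (1 / 2))%:E <= chord_sum (direction theta) d)%E) /\
    (forall theta : R, - pi < theta < pi -> theta \notin J ->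
      ((c2 * d `^ sigma)%:E <= chord_sum (direction theta) d)%E).

(** As d <= 1 and sigma >= 1/2, the bound in the directions of J implies the one
    in the other directions. *)
Lemma chord_sum_ge Theta d : 0 < d <= 1 -> chord_lower_bounds d -> dot Theta Theta = 1 ->
  ((Num.min c1 c2 * d `^ sigma)%:E <= chord_sum Theta d)%E.
Proof.
move=> /andP[d0 d1] [hJ hnJ] /direction_exists[t tpi tE].
have -> : chord_sum Theta d = chord_sum (direction t) d by case: tE => ->; rewrite ?chord_sumN.
have dp : 0 <= d `^ sigma by exact: powR_ge0.
have dd : d `^ sigma <= d `^ (1 / 2).
  by apply: ger_powR; [rewrite d0|move: s1 => /andP[]].
have [tJ|tJ] := boolP (t \in J).
  apply: le_trans (hJ t tJ); rewrite lee_fin; apply: ler_pM => //.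
    by rewrite le_min !ltW.
  by rewrite ge_min lexx.
apply: le_trans (hnJ t tpi tJ); rewrite lee_fin ler_wpM2r //.
by rewrite ge_min lexx orbT.
Qed.

Lemma chord_sum_ge_in Theta d t : chord_lower_bounds d -> t \in J ->
  Theta = direction t \/ Theta = - direction t ->
  ((Num.min c1 c2 * d `^ (1 / 2))%:E <= chord_sum Theta d)%E.
Proof.
move=> [hJ _] tJ tE.
have -> : chord_sum Theta d = chord_sum (direction t) d by case: tE => ->; rewrite ?chord_sumN.
apply: le_trans (hJ t tJ); rewrite lee_fin ler_wpM2r ?powR_ge0 //.
by rewrite ge_min lexx.
Qed.

Lemma mean_spectrum_ge m (d1 e : R) : 0 < d1 -> (2 * d1)^-1 <= norm2 (lattice_point m) ->
  0 <= e ->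
  (forall d, 0 < d <= d1 -> ((Num.min c1 c2 * d `^ e)%:E <=
     chord_sum ((norm2 (lattice_point m))^-1 *: lattice_point m) d)%E) ->
  exists psi, Num.min c1 c2 * ((4 * norm2 (lattice_point m))^-1) `^ e /
    (1600 * norm2 (lattice_point m)) <= mean_spectrum C m psi.
Proof.
move=> d10 Md e0; set M := norm2 (lattice_point m) in Md *; set Theta := _ *: _ => hd.
have c00 : 0 < Num.min c1 c2 by rewrite lt_min c10 c20.
have M0 : 0 < M by apply: lt_le_trans Md; rewrite invr_gt0 mulr_gt0.
have TE : lattice_point m = M *: Theta by rewrite scalerA divff ?gt_eqF // scale1r.
have T1 : dot Theta Theta = 1.
  by apply: dot_unit; apply: contraTneq M0 => h; rewrite /M h norm2_lattice0 ltxx.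
have K0 : 0 <= Num.min c1 c2 * ((4 * M)^-1) `^ e by rewrite mulr_ge0 ?powR_ge0 // ltW.
have hK d : (4 * M)^-1 <= d <= (2 * M)^-1 ->
    ((Num.min c1 c2 * ((4 * M)^-1) `^ e)%:E <= chord_sum Theta d)%E.
  move=> /andP[dl du].
  have p4 : 0 < (4 * M)^-1 by rewrite invr_gt0 mulr_gt0.
  have dpos : 0 < d by exact: lt_le_trans dl.
  have dd1 : d <= d1.
    apply: le_trans du _; rewrite -[leRHS]invrK lef_pV2 ?posrE ?mulr_gt0 ?invr_gt0 //.
    by rewrite -ler_pdivrMl // -invfM.
  apply: (@le_trans _ _ (Num.min c1 c2 * d `^ e)%:E); last by apply: hd; rewrite dpos.
  by rewrite lee_fin (ler_pM2l c00) ge0_ler_powR // nnegrE ltW.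
have [p1 [p2 hp]] := spectral_weight bC T1 M0 TE K0 hK.
by exists (p1, p2).
Qed.

End ChordHypothesis.
End Final.

Theorem theorem7 (R : realType) (C : set (R * R))
    (delta0 c1 c2 sigma : R) (I : interval R) :
  planar_convex_body C ->
  0 < delta0 -> 0 < c1 -> 0 < c2 ->
  1 / 2 <= sigma <= 1 ->
  [set` I] `<=` `]- pi, pi[ ->
  (0 < lebesgue_measure [set` I])%E ->
  (forall delta : R, 0 < delta <= delta0 ->
    (forall theta : R, theta \in I ->
      ((c1 * delta `^ (1 / 2))%:E
        <= chord_length C (- direction theta)%R delta
           + chord_length C (direction theta) delta)%E) /\
    (forall theta : R, - pi < theta < pi -> theta \notin I ->
      ((c2 * delta `^ sigma)%:E
        <= chord_length C (- direction theta)%R delta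
           + chord_length C (direction theta) delta)%E)) ->
  exists c : R, 0 < c /\
    forall (N : nat) (P : {fset torus R}), (1 <= N)%N -> #|` P| = N ->
      ((c * N%:R `^ (2 / (2 * sigma + 3)))%:E
        <= \int[lebesgue_measure]_(lambda in `[0%R, 1%R])
             torus_integral (fun t : torus R =>
               (`|card_translate P (dilate lambda C) t
                  - lambda ^+ 2 * N%:R * area C| ^+ 2)%:E))%E.
Proof.
move=> bC delta0_gt0 c10 c20 s1 _ I0 chords.
have [om [eta [eta0 etaI]]] := interval_center I0.
pose d1 : R := Num.min delta0 1.
have d10 : 0 < d1 by rewrite lt_min delta0_gt0 ltr01.
have {chords} chords d : 0 < d <= d1 -> 0 < d <= 1 /\ chord_lower_bounds C c1 c2 sigma I d.
  move=> /andP[d0]; rewrite le_min => /andP[dd d1'].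
  by rewrite d0; split=> //; apply: chords; rewrite d0.
have i0 : 0 < (2 * d1)^-1 by rewrite invr_gt0 mulr_gt0.
(* Frequencies of norm at least (2 d1)^-1 only see chords at distance at most d1
   from the ends of the body; for those of norm at least 1, a larger exponent
   means a larger power of the norm. *)
have M00 : 0 < 1 + (2 * d1)^-1 by rewrite addr_gt0.
have [v [T [T0 vM cone]]] := stretch_in_cone om eta0 M00.
have v1 : 1 <= norm2 (lattice_point v : R * R) by apply: le_trans vM; rewrite lerDl ltW.
pose freq k : R := norm2 (lattice_point (stretch v T k)).
pose e k : R := decay sigma k.
have e01 k : 0 <= e k <= 1 by rewrite /e /decay; move: s1 => /andP[]; case: ifP; lra.
pose b k : R := Num.min c1 c2 * ((4 * freq k)^-1) `^ e k / (1600 * freq k).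
have c00 : 0 < Num.min c1 c2 by rewrite lt_min c10 c20.
pose kappa : R := Num.min c1 c2 ^+ 2 / (6400 ^+ 2 * pi ^+ 4).
have kappa0 : 0 < kappa.
  apply: divr_gt0; first exact: exprn_gt0.
  by apply: mulr_gt0; apply: exprn_gt0; [rewrite ltr0n|exact: pi_gt0].
have freq1 k : k != 0 -> 1 <= freq k by move=> k0; apply: le_trans v1 _; exact: freq_ge.
have spec k : exists psi : R * R, k != 0 -> b k <= mean_spectrum C (stretch v T k) psi.
  have [->|k0] := eqVneq k 0; first by exists (0, 0).
  have Md : (2 * d1)^-1 <= freq k.
    by apply: le_trans (freq_ge v T0 k0); apply: le_trans vM; rewrite lerDr.
  have M0 : 0 < freq k by exact: lt_le_trans Md.
  have /andP[ek _] := e01 k.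
  have [|psi hpsi] := mean_spectrum_ge bC c10 c20 d10 Md ek; last by exists psi.
  move=> d /chords[d01 hd]; rewrite -/(freq k).
  set Theta := (freq k)^-1 *: _.
  have TE : lattice_point (stretch v T k) = freq k *: Theta.
    by rewrite scalerA divff ?gt_eqF // scale1r.
  rewrite /e /decay; case: ifP => hk; last first.
    apply: (chord_sum_ge c10 c20 s1 d01 hd); apply: dot_unit.
    by apply: contraTneq M0 => h; rewrite /freq h norm2_lattice0 ltxx.
  have [phi pe hphi] := cone _ k0 hk.
  apply: (chord_sum_ge_in hd (etaI _ pe)).
  have inj (x y : R * R) : freq k *: x = freq k *: y -> x = y.
    by apply: scalerI; rewrite gt_eqF.
  by case: hphi => h; [left|right]; apply: inj; rewrite -TE.
have {spec} [psi spec] := choice spec.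
pose A : R := norm2 (lattice_point v) * (T%:R + 2).
have A4 : 0 < A ^+ 4.
  by rewrite exprn_gt0 // mulr_gt0 ?(lt_le_trans _ v1) // ltr_wpDl ?ler0n.
have [w1 w2] := weight_ge T0 v1 kappa0 s1.
(* kappa / A ^+ 4 is the constant of the two hypotheses on the weights. *)
have [c c_gt0 lattice] := lattice_sum_lower_bound (divr_gt0 kappa0 A4) s1 w1 w2.
exists c; split=> // N P N1 PN.
have [F [uF nF Fsum]] := lattice N N1.
have usN : size [seq repr u | u <- P] = N by rewrite size_map.
have k0 k : k \in F -> k != 0 by apply: contraTneq => ->.
have stretchI k : stretch v T k = 0 -> k = 0.
  move=> h; apply/eqP; apply: contraT => /freq1; rewrite /freq h.
  by rewrite norm2_lattice0 ler10.
apply: le_trans (variance_lower_bound P (fun l => l ^+ 2 * N%:R * area C) (G := F)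
   (m := stretch v T) (psi := psi) (b := b) (w := weight v T kappa sigma) bC _ _ _).
- by rewrite lee_fin; apply: Fsum => // k l; exact: stretchB.
- rewrite map_inj_uniq // => k l h; apply/eqP; rewrite -subr_eq0; apply/eqP.
  by apply: stretchI; rewrite stretchB h subrr.
- by apply/mapP => -[k kF /esym/stretchI k00]; rewrite k00 in kF; rewrite kF in nF.
- move=> k /k0 kn0; have M1 := freq1 _ kn0.
  split; [|exact: spec|exact: weight_le_sqr].
  apply: divr_ge0; first exact: mulr_ge0 (ltW c00) (powR_ge0 _ _).
  exact: mulr_ge0 (ler0n _ _) (le_trans ler01 M1).
Qed.
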